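(* Let $\alpha,\beta>0$ and $m\in\mathbb{N}$. Put $p=\frac{m+1-2m\beta}{2\alpha m}$, $a_0=\frac{1}{\alpha\sqrt m}(2\pi)^{(1-m)/2}$, $$G(t)=2a_0\,t^{p}\exp\!\Big(m\,t^{\frac{1}{\alpha m}}\cos\tfrac{\pi}{\alpha m}\Big)\cos\!\Big(\pi p+m\,t^{\frac{1}{\alpha m}}\sin\tfrac{\pi}{\alpha m}\Big),\qquad H_K(t)=\sum_{k=1}^{K}\frac{(-1)^{k+1}t^{-k}}{[\Gamma(\beta-\alpha k)]^{m}},$$ with the convention $1/\Gamma(-n)=0$ for $n=0,1,2,\dots$. Then, as $t\to+\infty$: (i) if $0<\alpha m<2$, for every $K\in\mathbb{N}$, $F_{\alpha,\beta}^{(m)}(-t)=H_K(t)+O(t^{-K-1})$; (ii) if $\alpha m=2$, for every $K\in\mathbb{N}$, $F_{\alpha,\beta}^{(m)}(-t)=G(t)+H_K(t)+O(t^{p-\frac{1}{2}})+O(t^{-K-1})$; (iii) if $\alpha m>2$, $F_{\alpha,\beta}^{(m)}(-t)=G(t)+O\!\Big(t^{p-\frac{1}{\alpha m}}\exp\big(m\,t^{\frac{1}{\alpha m}}\cos\tfrac{\pi}{\alpha m}\big)\Big)$.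
   Context: For $\alpha,\beta>0$ and $m\in\mathbb{N}$, $F_{\alpha,\beta}^{(m)}(z)=\sum_{k=0}^{\infty}\frac{z^k}{[\Gamma(\alpha k+\beta)]^{m}}$, an entire function of $z$. *)

(* Defs.v *)
From Stdlib Require Import Reals.
From Coquelicot Require Import Coquelicot.
Open Scope R_scope.

(* Reciprocal Gamma function 1/Gamma(x), via Gauss' product formula
     1/Gamma(x) = lim_{n->oo} x(x+1)...(x+n) / (n! n^x),
   valid for every real x; it is entire and vanishes exactly at
   x = 0,-1,-2,...  (this realises the convention 1/Gamma(-n) = 0). *)
Definition rgamma (x : R) : R :=
  real (Lim_seq (fun n : nat =>
    prod_f_R0 (fun j => x + INR j) n / (INR (Factorial.fact n) * Rpower (INR n) x))).

Definition Fml (alpha beta : R) (m : nat) (z : R) : R :=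
  Series (fun k : nat => z ^ k * (rgamma (alpha * INR k + beta)) ^ m).

Definition p_exp (alpha beta : R) (m : nat) : R :=
  (INR m + 1 - 2 * INR m * beta) / (2 * alpha * INR m).

Definition a0 (alpha : R) (m : nat) : R :=
  / (alpha * sqrt (INR m)) * Rpower (2 * PI) ((1 - INR m) / 2).

Definition Gfun (alpha beta : R) (m : nat) (t : R) : R :=
  2 * a0 alpha m * Rpower t (p_exp alpha beta m)
  * exp (INR m * Rpower t (/ (alpha * INR m)) * cos (PI / (alpha * INR m)))
  * cos (PI * p_exp alpha beta m
         + INR m * Rpower t (/ (alpha * INR m)) * sin (PI / (alpha * INR m))).

Definition Hfun (alpha beta : R) (m K : nat) (t : R) : R :=
  sum_n_m (fun k : nat => (-1) ^ (k + 1) * / t ^ k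
                          * (rgamma (beta - alpha * INR k)) ^ m) 1 K.

(* Main.v *)
Require Import Defs.
From Stdlib Require Import Reals Arith Factorial Lra Lia Psatz.
From Coquelicot Require Import Coquelicot.
Open Scope R_scope.

(* Write [a = alpha m] and [b = m beta - (m - 1) / 2].

   For [m = 1] the sum is a Mittag-Leffler function.  Summing Hankel's integral for [1/Gamma] under
   the integral sign turns [sum z^k / Gamma (nu k + b)] into the integral of
   [e^w w^{1-b} / (1 - z w^{-nu})] over large circular arcs in the coordinate [log w].  For [nu < 1]
   there is at most one pole [w0 = z^{1/nu}] between such an arc and the unit arc; its contribution
   is found by subtracting the kernel with [nu = b = 1], whose sum is [e^{w0}] and which has a pole
   at the same place.  Splitting the exponents by residues modulo [n > a] reduces every [a] to
   [nu = a / n < 1].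

   For general [m], [1 / Gamma (x)^m = A m^{m x} / Gamma (m x - (m - 1) / 2)] times an infinite
   product of rational functions of [x].  Multiplying the [k]-th coefficient by [1 / (k + X)]
   amounts to averaging the sum over [(0, t)], so it preserves bounds on the negative axis with an
   explicit norm; the product therefore acts as [1 + O (1/x)] and only costs a factor [t^{-1/a}] in
   the error.

   None of this needs [beta > 0], and [F_beta (-t)] differs from
   [(-t)^{-K} F_{beta - alpha K} (-t)] exactly by [H_K (t)], so the algebraic expansion is contained
   in the boundedness statement. *)

(** * Holomorphic functions of two real variables *)

(** Hankel's contour never appears as a path with two rays. By Cauchy's theorem the integral over an
    arc [|y| <= phi] varies with its abscissa only through two end values, and for [cos phi < 0]
    these are doubly exponentially small; so the arcs converge, and moving one inwards costs a
    bounded amount. The restriction [nu < 1] isolates the pole: in the coordinate [log w] the poles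
    are [2 PI / nu] apart, more than a full turn.

    For general [m] the obstacle is that a small relative change of the coefficients says nothing
    about an alternating sum, which may be bounded while the sum of absolute values grows
    exponentially. Changes are therefore measured as operators on sums over the negative axis. The
    norm of [1 / (k + X)] is at most [1 / (X - M)], where [M] is the growth exponent of the weight,
    so the argument of Gamma is first shifted by a large [N]. The gain of [t^{-1/a}] comes from
    [1 / Gamma (w) = w / Gamma (w + 1)]: a change of relative size [1/w] is a bounded operator
    applied to the coefficients with [b + 1]. *)

Definition cexp (z : C) : C := (exp (fst z) * cos (snd z), exp (fst z) * sin (snd z)).

Lemma cexp_plus (z w : C) : cexp (z + w)%C = (cexp z * cexp w)%C.
Proof.
  destruct z as [a b], w as [c d]; unfold cexp, Cplus, Cmult; simpl.
  rewrite exp_plus, cos_plus, sin_plus.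
  apply injective_projections; simpl; ring.
Qed.

Lemma Cmod_cexp (z : C) : Cmod (cexp z) = exp (fst z).
Proof.
  unfold Cmod, cexp; simpl.
  set (e := exp (fst z)).
  replace (e * cos (snd z) * (e * cos (snd z) * 1) + e * sin (snd z) * (e * sin (snd z) * 1))
    with (e * e * (Rsqr (sin (snd z)) + Rsqr (cos (snd z)))) by (unfold Rsqr; ring).
  rewrite sin2_cos2, Rmult_1_r.
  apply sqrt_square, Rlt_le, exp_pos.
Qed.

Lemma cexp_0 : cexp 0 = 1%C.
Proof.
  unfold cexp; simpl; rewrite exp_0, cos_0, sin_0.
  apply injective_projections; simpl; ring.
Qed.

Lemma Rabs_fst_le_Cmod (z : C) : Rabs (fst z) <= Cmod z.
Proof. generalize (Rmax_Cmod z), (Rmax_l (Rabs (fst z)) (Rabs (snd z))); lra. Qed.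

Lemma Rabs_snd_le_Cmod (z : C) : Rabs (snd z) <= Cmod z.
Proof. generalize (Rmax_Cmod z), (Rmax_r (Rabs (fst z)) (Rabs (snd z))); lra. Qed.

(* Complex functions of [x + i y] are written as functions of the two real variables, and
   [hol f f' x y] is holomorphy in Cauchy-Riemann form with continuous derivative [f']. *)
Record hol (f f' : R -> R -> C) (x y : R) : Prop := {
  hol_ux : is_derive (fun s => fst (f s y)) x (fst (f' x y));
  hol_vx : is_derive (fun s => snd (f s y)) x (snd (f' x y));
  hol_uy : is_derive (fun s => fst (f x s)) y (- snd (f' x y));
  hol_vy : is_derive (fun s => snd (f x s)) y (fst (f' x y));
  hol_cu : continuity_2d_pt (fun s t => fst (f s t)) x y;
  hol_cv : continuity_2d_pt (fun s t => snd (f s t)) x y;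
  hol_cu' : continuity_2d_pt (fun s t => fst (f' s t)) x y;
  hol_cv' : continuity_2d_pt (fun s t => snd (f' s t)) x y }.

Lemma is_derive_eq (f : R -> R) (x l l' : R) : is_derive f x l -> l = l' -> is_derive f x l'.
Proof. intros H <-; exact H. Qed.

Lemma is_derive_Rmult (f g : R -> R) (x df dg : R) :
  is_derive f x df -> is_derive g x dg ->
  is_derive (fun s => f s * g s) x (df * g x + f x * dg).
Proof. intros; now apply (is_derive_mult f g); [| | intros; apply Rmult_comm]. Qed.

Lemma is_derive_Rplus (f g : R -> R) (x df dg : R) :
  is_derive f x df -> is_derive g x dg -> is_derive (fun s => f s + g s) x (df + dg).
Proof. intros; now apply (is_derive_plus f g). Qed.

Lemma is_derive_Rminus (f g : R -> R) (x df dg : R) :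
  is_derive f x df -> is_derive g x dg -> is_derive (fun s => f s - g s) x (df - dg).
Proof. intros; now apply (is_derive_minus f g). Qed.

Lemma hol_const (c : C) x y : hol (fun _ _ => c) (fun _ _ => 0%C) x y.
Proof.
  split; simpl; try rewrite Ropp_0; try apply (is_derive_const (V := R_NormedModule));
    apply continuity_2d_pt_const.
Qed.

Lemma hol_id x y : hol (fun s t => (s, t)) (fun _ _ => 1%C) x y.
Proof.
  split; simpl; try rewrite Ropp_0.
  - apply (is_derive_id (K := R_AbsRing)).
  - apply (is_derive_const (V := R_NormedModule)).
  - apply (is_derive_const (V := R_NormedModule)).
  - apply (is_derive_id (K := R_AbsRing)).
  - apply continuity_2d_pt_id1.
  - apply continuity_2d_pt_id2.
  - apply continuity_2d_pt_const.
  - apply continuity_2d_pt_const.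
Qed.

Ltac c2d := repeat (try assumption; lazymatch goal with
  | |- continuity_2d_pt (fun _ _ => _ + _) _ _ => apply continuity_2d_pt_plus
  | |- continuity_2d_pt (fun _ _ => _ - _) _ _ => apply continuity_2d_pt_minus
  | |- continuity_2d_pt (fun _ _ => _ * _) _ _ => apply continuity_2d_pt_mult
  | |- continuity_2d_pt (fun _ _ => - _) _ _ => apply continuity_2d_pt_opp
  | |- continuity_2d_pt (fun _ _ => 1) _ _ => apply continuity_2d_pt_const
  end).

Ltac drv := lazymatch goal with
  | |- is_derive (fun _ => _ + _) _ _ => apply is_derive_Rplus; drv
  | |- is_derive (fun _ => _ - _) _ _ => apply is_derive_Rminus; drv
  | |- is_derive (fun _ => _ * _) _ _ => apply is_derive_Rmult; drv
  | |- is_derive (fun _ => - _) _ _ => apply @is_derive_opp; drv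
  | |- is_derive (fun _ => exp _) _ _ => apply (is_derive_comp exp); [apply is_derive_exp | drv]
  | |- is_derive (fun _ => cos _) _ _ => apply (is_derive_comp cos); [apply is_derive_cos | drv]
  | |- is_derive (fun _ => sin _) _ _ => apply (is_derive_comp sin); [apply is_derive_sin | drv]
  | |- is_derive (fun _ => 1) _ _ => apply (is_derive_const (V := R_NormedModule))
  | |- is_derive (fun _ => / _) _ _ => apply is_derive_inv; [drv | try assumption]
  | |- is_derive _ _ _ => eassumption
  end.

Ltac drv_eq := eapply is_derive_eq; [drv | unfold scal, opp, zero; simpl; unfold mult; simpl].

Lemma hol_plus f f' g g' x y : hol f f' x y -> hol g g' x y ->
  hol (fun s t => f s t + g s t)%C (fun s t => f' s t + g' s t)%C x y.
Proof. intros [] []; split; simpl; c2d; drv_eq; ring. Qed.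

Lemma hol_mult f f' g g' x y : hol f f' x y -> hol g g' x y ->
  hol (fun s t => f s t * g s t)%C (fun s t => f' s t * g s t + f s t * g' s t)%C x y.
Proof. intros [] []; split; simpl; c2d; drv_eq; ring. Qed.

Lemma hol_cexp f f' x y : hol f f' x y ->
  hol (fun s t => cexp (f s t)) (fun s t => f' s t * cexp (f s t))%C x y.
Proof.
  intros [].
  assert (He : continuity_2d_pt (fun s t => exp (fst (f s t))) x y).
  { apply (continuity_1d_2d_pt_comp exp); [apply derivable_continuous_pt, derivable_pt_exp | easy].
    }
  assert (Hc : continuity_2d_pt (fun s t => cos (snd (f s t))) x y).
  { apply (continuity_1d_2d_pt_comp cos); [apply continuity_cos | easy]. }
  assert (Hs : continuity_2d_pt (fun s t => sin (snd (f s t))) x y).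
  { apply (continuity_1d_2d_pt_comp sin); [apply continuity_sin | easy]. }
  split; simpl; c2d; drv_eq; ring.
Qed.

Lemma Cnorm2_neq0 (z : C) : z <> 0%C -> fst z * fst z + snd z * snd z <> 0.
Proof.
  intros Hz H; apply Hz; destruct z as [a b]; simpl in H |- *.
  assert (a = 0 /\ b = 0) as [-> ->] by (split; nra). reflexivity.
Qed.

Lemma hol_inv f f' x y : hol f f' x y -> f x y <> 0%C ->
  hol (fun s t => / f s t)%C (fun s t => - f' s t * (/ f s t * / f s t))%C x y.
Proof.
  intros [] Hn; apply Cnorm2_neq0 in Hn.
  assert (Hn' : fst (f x y) ^ 2 + snd (f x y) ^ 2 <> 0) by (simpl; rewrite !Rmult_1_r; exact Hn).
  assert (Hi : continuity_2d_pt (fun s t => / (fst (f s t) ^ 2 + snd (f s t) ^ 2)) x y).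
  { apply continuity_2d_pt_inv; [simpl; c2d | exact Hn']. }
  unfold Cinv, Rdiv; simpl in *; split; simpl; c2d; drv_eq; field; exact Hn.
Qed.

Lemma hol_ext f g f' x y : (forall s t, f s t = g s t) -> hol f f' x y -> hol g f' x y.
Proof.
  intros Hfg []; split; try assumption.
  - apply is_derive_ext with (2 := hol_ux0); intros; now rewrite Hfg.
  - apply is_derive_ext with (2 := hol_vx0); intros; now rewrite Hfg.
  - apply is_derive_ext with (2 := hol_uy0); intros; now rewrite Hfg.
  - apply is_derive_ext with (2 := hol_vy0); intros; now rewrite Hfg.
  - apply continuity_2d_pt_ext with (2 := hol_cu0); intros; now rewrite Hfg.
  - apply continuity_2d_pt_ext with (2 := hol_cv0); intros; now rewrite Hfg.
Qed.

Lemma continuity_2d_pt_snd (u : R -> R -> R) x y :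
  continuity_2d_pt u x y -> continuous (fun t => u x t) y.
Proof.
  intros H; apply continuity_2d_pt_filterlim in H.
  intros P HP; destruct (H P HP) as [d Hd]; exists d; intros t Ht.
  apply (Hd (x, t)); split; [apply ball_center | exact Ht].
Qed.

Lemma ex_RInt_2d (u : R -> R -> R) x y1 y2 : y1 <= y2 ->
  (forall y, y1 <= y <= y2 -> continuity_2d_pt u x y) -> ex_RInt (fun t => u x t) y1 y2.
Proof.
  intros Hy H; apply (@ex_RInt_continuous R_CompleteNormedModule).
  rewrite Rmin_left, Rmax_right by easy.
  intros z Hz; apply continuity_2d_pt_snd; auto.
Qed.

(* Cauchy's theorem for a rectangle, differentiated in its width. *)
Lemma cauchy_vertical f f' (x0 y1 y2 : R) (d : posreal) : y1 <= y2 ->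
  locally x0 (fun x => forall y, y1 - d <= y <= y2 + d -> hol f f' x y) ->
  is_derive (fun x => RInt (fun y => fst (f x y)) y1 y2) x0 (snd (f x0 y2) - snd (f x0 y1)).
Proof.
  intros Hy H.
  assert (Hx0 := locally_singleton _ _ H).
  assert (Hd := cond_pos d).
  replace (snd (f x0 y2) - snd (f x0 y1))
    with (RInt (fun t => Derive (fun s => fst (f s t)) x0) y1 y2).
  - apply (is_derive_RInt_param (fun x y => fst (f x y))).
    + revert H; apply filter_imp; intros x Hx t Ht.
      rewrite Rmin_left, Rmax_right in Ht by easy.
      eexists; apply (hol_ux _ _ _ _ (Hx t ltac:(lra))).
    + rewrite Rmin_left, Rmax_right by easy.
      intros t Ht.
      apply continuity_2d_pt_ext_loc with (f := fun u v => fst (f' u v)).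
      * destruct H as [e He].
        assert (Hm : 0 < Rmin e d) by (apply Rmin_pos; [apply cond_pos | easy]).
        exists (mkposreal _ Hm); simpl; intros u v Hu Hv.
        generalize (Rmin_l e d), (Rmin_r e d); intros.
        assert (Hh : hol f f' u v).
        { apply He; [apply Rlt_le_trans with (1 := Hu); easy|].
          apply Rabs_lt_between' in Hv; lra. }
        symmetry; apply is_derive_unique, (hol_ux _ _ _ _ Hh).
      * apply (hol_cu' _ _ _ _ (Hx0 t ltac:(lra))).
    + revert H; apply filter_imp; intros x Hx.
      apply (ex_RInt_2d (fun x t => fst (f x t))); [easy|].
      intros y Hyy; apply (hol_cu _ _ _ _ (Hx y ltac:(lra))).
  (* By the Cauchy-Riemann equations the [x]-derivative of the real part is also the [y]-derivative
     of the imaginary part, so its integral is a difference of end values. *)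
  - transitivity (RInt (fun t => fst (f' x0 t)) y1 y2).
    + apply RInt_ext; intros t Ht; rewrite Rmin_left, Rmax_right in Ht by easy.
      apply is_derive_unique, (hol_ux _ _ _ _ (Hx0 t ltac:(lra))).
    + apply is_RInt_unique, (is_RInt_derive (fun t => snd (f x0 t)));
        rewrite Rmin_left, Rmax_right by easy; intros t Ht.
      * apply (hol_vy _ _ _ _ (Hx0 t ltac:(lra))).
      * apply (continuity_2d_pt_snd (fun x t => fst (f' x t))).
        apply (hol_cu' _ _ _ _ (Hx0 t ltac:(lra))).
Qed.

(** Mean value inequality with a variable majorant: [B - M] and [B + M] are both nondecreasing. It
    stands in for the integration of derivative bounds throughout. *)
Lemma Rabs_increment_le (M dM B dB : R -> R) (a b : R) : a <= b ->
  (forall x, a <= x <= b -> is_derive M x (dM x)) ->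
  (forall x, a <= x <= b -> is_derive B x (dB x)) ->
  (forall x, a <= x <= b -> Rabs (dM x) <= dB x) ->
  Rabs (M b - M a) <= B b - B a.
Proof.
  intros Hab HM HB Hd.
  assert (Hgen : forall N dN, (forall x, a <= x <= b -> is_derive N x (dN x)) ->
    (forall x, a <= x <= b -> 0 <= dN x) -> N a <= N b).
  { intros N dN HN Hp.
    destruct (MVT_gen N a b dN) as (c & Hc & He);
      rewrite ?Rmin_left, ?Rmax_right in * by easy.
    - intros x Hx; apply HN; lra.
    - intros x Hx; apply continuity_pt_filterlim, (ex_derive_continuous N).
      eexists; apply HN, Hx.
    - assert (0 <= dN c * (b - a)) by (apply Rmult_le_pos; [apply Hp, Hc | lra]). lra. }
  assert (H1 := Hgen (fun x => B x - M x) (fun x => dB x - dM x)).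
  assert (H2 := Hgen (fun x => B x + M x) (fun x => dB x + dM x)).
  simpl in H1, H2; apply Rabs_le; split.
  - cut (B a + M a <= B b + M b); [lra | apply H2].
    + intros x Hx; apply is_derive_Rplus; auto.
    + intros x Hx; specialize (Hd x Hx); apply Rabs_le_between in Hd; lra.
  - cut (B a - M a <= B b - M b); [lra | apply H1].
    + intros x Hx; apply is_derive_Rminus; auto.
    + intros x Hx; specialize (Hd x Hx); apply Rabs_le_between in Hd; lra.
Qed.

(** * Convergence forced by doubly exponential decay *)

Lemma is_derive_exp_exp (K kap x : R) : 0 < kap ->
  is_derive (fun s => - (K / kap) * exp (- kap * exp s)) x (K * (exp x * exp (- kap * exp x))).
Proof. intros Hk; auto_derive; [easy|]; field; lra. Qed.

Lemma is_lim_exp_exp (K kap : R) : 0 < kap ->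
  is_lim (fun s => K * exp (- kap * exp s)) p_infty 0.
Proof.
  intros Hk.
  replace (Finite 0) with (Rbar_mult K 0) by (simpl; f_equal; ring).
  apply is_lim_scal_l.
  apply is_lim_comp with m_infty; [apply is_lim_exp_m| |exists 0; easy].
  replace m_infty with (Rbar_mult (- kap) p_infty).
  - apply is_lim_scal_l, is_lim_exp_p.
  - simpl; destruct Rle_dec; [exfalso; lra|easy].
Qed.

(* The contour integrals converge because their derivative in the abscissa is doubly
   exponentially small. *)
Lemma exp_exp_tail (M dM : R -> R) (K kap X : R) : 0 < kap ->
  (forall x, X <= x -> is_derive M x (dM x)) ->
  (forall x, X <= x -> Rabs (dM x) <= K * (exp x * exp (- kap * exp x))) ->
  exists l : R, is_lim M p_infty l.
Proof.
  intros Hk HM Hd.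
  assert (Hinc : forall a b, X <= a <= b ->
    Rabs (M b - M a) <= K / kap * exp (- kap * exp a) - K / kap * exp (- kap * exp b)).
  { intros a b Hab.
    assert (H := Rabs_increment_le M dM (fun s => - (K / kap) * exp (- kap * exp s))
      (fun x => K * (exp x * exp (- kap * exp x))) a b (proj2 Hab)
      (fun x Hx => HM x ltac:(lra)) (fun x _ => is_derive_exp_exp K kap x Hk)
      (fun x Hx => Hd x ltac:(lra))).
    simpl in H; lra. }
  assert (HL := is_lim_exp_exp (K / kap) kap Hk).
  cut (exists l : R, filterlim M (Rbar_locally' p_infty) (locally l)); [easy|].
  apply (@filterlim_locally_cauchy _ R_CompleteSpace (Rbar_locally' p_infty) _ M).
  intros eps.
  assert (HL' : Rbar_locally' p_infty (fun s => X <= s /\ Rabs (K / kap * exp (- kap * exp s)) <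
    eps / 2)).
  { apply filter_and; [exists X; intros; lra|].
    assert (H2 : 0 < eps / 2) by (generalize (cond_pos eps); lra).
    apply is_lim_spec in HL. destruct (HL (mkposreal _ H2)) as [m Hm]; exists m.
    intros x Hx; specialize (Hm x Hx); simpl in Hm; now rewrite Rminus_0_r in Hm. }
  eexists; split; [exact HL'|].
  assert (Hle : forall u v, X <= u /\ Rabs (K / kap * exp (- kap * exp u)) < eps / 2 ->
    X <= v /\ Rabs (K / kap * exp (- kap * exp v)) < eps / 2 -> u <= v -> Rabs (M v - M u) < eps).
  { intros u v [Hu Hu'] [Hv Hv'] Huv.
    apply Rle_lt_trans with (1 := Hinc u v (conj Hu Huv)).
    apply Rabs_lt_between in Hu', Hv'; lra. }
  intros u v Hu Hv; change (Rabs (M v - M u) < eps).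
  destruct (Rle_lt_dec u v) as [H|H]; [now apply Hle|].
  rewrite Rabs_minus_sym; apply Hle; auto; lra.
Qed.

Lemma is_lim_Rabs_le (f g : R -> R) (l g' : R) : is_lim f p_infty l -> is_lim g p_infty g' ->
  Rbar_locally' p_infty (fun x => Rabs (f x) <= g x) -> Rabs l <= g'.
Proof.
  intros Hf Hg H.
  apply Rabs_le; split.
  - apply (is_lim_le_loc (fun x => - g x) f p_infty (- g') l); auto.
    + revert H; apply filter_imp; intros x Hx; apply Rabs_le_between in Hx; lra.
    + now apply (is_lim_opp g p_infty g').
  - apply (is_lim_le_loc f g p_infty l g'); auto.
    revert H; apply filter_imp; intros x Hx; apply Rabs_le_between in Hx; lra.
Qed.

(** The explicit rate of this convergence: the increment bound telescopes through the primitive of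
    [K e^x exp (- kap e^x)], whose far end tends to 0. *)
Lemma exp_exp_tail_le (M dM : R -> R) (K kap X l : R) : 0 < kap ->
  (forall x, X <= x -> is_derive M x (dM x)) ->
  (forall x, X <= x -> Rabs (dM x) <= K * (exp x * exp (- kap * exp x))) ->
  is_lim M p_infty l -> Rabs (l - M X) <= K / kap * exp (- kap * exp X).
Proof.
  intros Hk HM Hd HL.
  apply (is_lim_Rabs_le (fun x => M x - M X)
    (fun x => K / kap * exp (- kap * exp X) - K / kap * exp (- kap * exp x))).
  - apply (is_lim_minus' M); [easy | apply is_lim_const].
  - replace (Finite (K / kap * exp (- kap * exp X)))
      with (Finite (K / kap * exp (- kap * exp X) - 0)) by (now rewrite Rminus_0_r).
    apply is_lim_minus'; [apply is_lim_const | apply is_lim_exp_exp; easy].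
  - exists X; intros x Hx.
    assert (H := Rabs_increment_le M dM (fun s => - (K / kap) * exp (- kap * exp s))
      (fun x => K * (exp x * exp (- kap * exp x))) X x (Rlt_le _ _ Hx)
      (fun x Hx => HM x ltac:(lra)) (fun x _ => is_derive_exp_exp K kap x Hk)
      (fun x Hx => Hd x ltac:(lra))).
    simpl in H; lra.
Qed.

(** * Elementary inequalities for exp, sin and cos *)

Lemma exp_le (x y : R) : x <= y -> exp x <= exp y.
Proof. intros [H| ->]; [left; now apply exp_increasing | right; easy]. Qed.

Lemma Rabs_sin_le (x : R) : Rabs (sin x) <= Rabs x.
Proof.
  assert (H : forall x, 0 <= x -> Rabs (sin x - sin 0) <= x - 0).
  { intros t Ht; apply (Rabs_increment_le sin cos (fun s => s) (fun _ => 1)); [easy| | |].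
    - intros; apply is_derive_sin.
    - intros; apply (is_derive_id (K := R_AbsRing)).
    - intros; apply Rabs_le; generalize (COS_bound x0); lra. }
  destruct (Rle_lt_dec 0 x) as [Hx|Hx].
  - specialize (H x Hx); rewrite sin_0, !Rminus_0_r in H; now rewrite (Rabs_pos_eq x).
  - specialize (H (- x) ltac:(lra)); rewrite sin_0, !Rminus_0_r, sin_neg, Rabs_Ropp in H.
    now rewrite (Rabs_left x).
Qed.

Lemma one_minus_cos (x : R) : 1 - cos x = 2 * sin (x / 2) ^ 2.
Proof.
  replace x with (2 * (x / 2)) at 1 by field. rewrite cos_2a_sin; ring.
Qed.

Lemma one_minus_cos_le (x : R) : 0 <= 1 - cos x <= x ^ 2 / 2.
Proof.
  rewrite one_minus_cos.
  assert (H := Rabs_sin_le (x / 2)).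
  apply Rsqr_le_abs_1 in H; unfold Rsqr in H. split; [nra|simpl; lra].
Qed.

(** Quadratic accuracy is all that the later cancellation of two poles needs, and it follows from
    the crude derivative bound [1 - cos s <= 2 s]. *)
Lemma Rabs_sin_minus_le (x : R) : Rabs (sin x - x) <= x ^ 2.
Proof.
  assert (H : forall x, 0 <= x -> Rabs ((sin x - x) - (sin 0 - 0)) <= x * x - 0 * 0).
  { intros t Ht; apply (Rabs_increment_le (fun s => sin s - s) (fun s => cos s - 1) (fun s => s *
    s) (fun s => 2 * s)); [easy| | |].
    - intros; auto_derive; [easy|ring].
    - intros; auto_derive; [easy|ring].
    - intros s Hs; rewrite Rabs_minus_sym, Rabs_pos_eq by apply one_minus_cos_le.
      generalize (one_minus_cos_le s), (COS_bound s); intros.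
      destruct (Rle_lt_dec s 1); [simpl in *; nra | lra]. }
  destruct (Rle_lt_dec 0 x) as [Hx|Hx].
  - specialize (H x Hx); rewrite sin_0 in H.
    replace (sin x - x - (0 - 0)) with (sin x - x) in H by ring. simpl; lra.
  - specialize (H (- x) ltac:(lra)); rewrite sin_0, sin_neg in H.
    replace (- sin x - - x - (0 - 0)) with (- (sin x - x)) in H by ring.
    rewrite Rabs_Ropp in H; simpl; lra.
Qed.

Lemma Rabs_exp_minus1_le (x : R) : Rabs (exp x - 1) <= Rabs x * exp (Rabs x).
Proof.
  assert (H1 := exp_ineq1_le x); assert (H2 := exp_ineq1_le (- x)).
  rewrite exp_Ropp in H2; assert (Hp := exp_pos x).
  assert (H3 : exp x * (1 + - x) <= 1)
    by (replace 1 with (exp x * / exp x) at 2 by (field; lra); apply Rmult_le_compat_l; lra).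
  destruct (Rle_lt_dec 0 x) as [Hx|Hx].
  - rewrite (Rabs_pos_eq x) by easy. rewrite Rabs_pos_eq by lra. nra.
  - rewrite (Rabs_left x) by easy.
    assert (exp x <= 1) by (rewrite <- exp_0; apply exp_le; lra).
    rewrite Rabs_left1 by lra.
    assert (1 <= exp (- x)) by (rewrite <- exp_0; apply exp_le; lra). nra.
Qed.

Lemma Rabs_exp_minus1_minus_le (x : R) : Rabs (exp x - 1 - x) <= x ^ 2 * exp (Rabs x).
Proof.
  assert (H1 := exp_ineq1_le x); assert (H2 := exp_ineq1_le (- x)).
  assert (H := Rabs_exp_minus1_le x).
  rewrite exp_Ropp in H2; assert (Hp := exp_pos x).
  assert (H3 : exp x * (1 + - x) <= 1)
    by (replace 1 with (exp x * / exp x) at 2 by (field; lra); apply Rmult_le_compat_l; lra).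
  rewrite Rabs_pos_eq by lra.
  apply Rle_trans with (x * (exp x - 1)); [lra|].
  apply Rle_trans with (Rabs x * Rabs (exp x - 1)).
  - rewrite <- Rabs_mult; apply Rle_abs.
  - replace (x ^ 2) with (Rabs x * Rabs x) by (rewrite <- Rabs_mult; rewrite Rabs_pos_eq;
    [ring|nra]).
    rewrite Rmult_assoc; apply Rmult_le_compat_l; [apply Rabs_pos | easy].
Qed.

(** * Stirling's formula *)

Definition wallis (n : nat) : R := RInt (fun x => sin x ^ n) 0 (PI / 2).

Lemma continuous_sin_pow n x : continuous (fun x => sin x ^ n) x.
Proof. apply (ex_derive_continuous (fun x => sin x ^ n)); auto_derive; easy. Qed.

Lemma ex_RInt_sin_pow n : ex_RInt (fun x => sin x ^ n) 0 (PI / 2).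
Proof. apply (@ex_RInt_continuous R_CompleteNormedModule); intros; apply continuous_sin_pow. Qed.

(** The difference of the two integrands is the derivative of [cos x * sin x ^ (n + 1)], which
    vanishes at both ends. *)
Lemma wallis_rec n : INR (n + 2) * wallis (n + 2) = INR (n + 1) * wallis n.
Proof.
  assert (H : is_RInt (fun x => INR (n + 1) * sin x ^ n - INR (n + 2) * sin x ^ (n + 2)) 0 (PI / 2)
    (cos (PI / 2) * sin (PI / 2) ^ (n + 1) - cos 0 * sin 0 ^ (n + 1))).
  { apply (is_RInt_derive (fun x => cos x * sin x ^ (n + 1))).
    - intros x _; auto_derive; [easy|].
      replace (Init.Nat.pred (n + 1)) with n by lia.
      rewrite !pow_add, !plus_INR; simpl.
      assert (H : cos x * cos x = 1 - sin x * sin x)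
        by (generalize (sin2_cos2 x); unfold Rsqr; lra).
      ring [H].
    - intros x _; apply (ex_derive_continuous (fun x => INR (n + 1) * sin x ^ n - INR (n + 2) * sin
      x ^ (n + 2))).
      auto_derive; easy. }
  apply (is_RInt_unique (V := R_CompleteNormedModule)) in H.
  rewrite (RInt_minus (V := R_CompleteNormedModule) (fun x => INR (n + 1) * sin x ^ n) (fun x =>
    INR (n + 2) * sin x ^ (n + 2))) in H
   by (apply @ex_RInt_scal, ex_RInt_sin_pow).
  rewrite (RInt_scal (V := R_CompleteNormedModule) (fun x => sin x ^ n)) in H by apply
    ex_RInt_sin_pow.
  rewrite (RInt_scal (V := R_CompleteNormedModule) (fun x => sin x ^ (n + 2))) in H by apply
    ex_RInt_sin_pow.
  rewrite cos_PI2, sin_0, pow_i in H by lia.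
  unfold minus, plus, opp, scal in H; simpl in H; unfold mult in H; simpl in H.
  fold (wallis n) (wallis (n + 2)) in H. lra.
Qed.

Lemma wallis_decr n : wallis (n + 1) <= wallis n.
Proof.
  assert (Hpi := PI2_1).
  apply RInt_le; [lra | apply ex_RInt_sin_pow | apply ex_RInt_sin_pow|].
  intros x Hx; rewrite pow_add, pow_1.
  assert (0 < sin x) by (apply sin_gt_0; lra).
  assert (0 < sin x ^ n) by now apply pow_lt.
  generalize (SIN_bound x); nra.
Qed.

Lemma wallis_0 : wallis 0 = PI / 2.
Proof.
  unfold wallis; simpl; rewrite RInt_const; unfold scal; simpl; unfold mult; simpl; ring.
Qed.

Lemma wallis_1 : wallis 1 = 1.
Proof.
  apply is_RInt_unique.
  replace 1 with (- cos (PI / 2) - - cos 0) by (rewrite cos_PI2, cos_0; ring).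
  apply (is_RInt_derive (fun x => - cos x)).
  - intros; auto_derive; [easy|ring].
  - intros; apply continuous_sin_pow.
Qed.

(** By [wallis_rec] the left side does not change with [n], so it keeps its value at [n = 0]. *)
Lemma wallis_prod n : INR (n + 1) * (wallis n * wallis (n + 1)) = PI / 2.
Proof.
  induction n as [|n IH].
  - simpl; rewrite wallis_0, wallis_1; ring.
  - rewrite <- IH; assert (H := wallis_rec n).
    replace (S n + 1)%nat with (n + 2)%nat by lia; replace (S n) with (n + 1)%nat by lia.
    replace (INR (n + 2) * (wallis (n + 1) * wallis (n + 2)))
      with (wallis (n + 1) * (INR (n + 2) * wallis (n + 2))) by ring.
    rewrite H; ring.
Qed.

Lemma wallis_even n :
  wallis (2 * n) = PI / 2 * (INR (fact (2 * n)) / (4 ^ n * INR (fact n) ^ 2)).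
Proof.
  induction n as [|n IH].
  - simpl Nat.mul; rewrite wallis_0; simpl; field.
  - assert (H := wallis_rec (2 * n)).
    replace (2 * S n)%nat with (2 * n + 2)%nat by lia.
    assert (H2 : 0 < INR (2 * n + 2)) by (apply lt_0_INR; lia).
    apply (Rmult_eq_reg_l (INR (2 * n + 2))); [|lra].
    rewrite H, IH.
    replace (fact (2 * n + 2)) with ((2 * n + 2) * ((2 * n + 1) * fact (2 * n)))%nat
      by (replace (2 * n + 2)%nat with (S (S (2 * n))) by lia;
          rewrite !fact_simpl; f_equal; f_equal; lia).
    rewrite fact_simpl, !mult_INR.
    assert (Hf := INR_fact_lt_0 n).
    assert (Hn := pos_INR n).
    assert (H4 : 4 ^ n <> 0) by (apply pow_nonzero; lra).
    change (4 ^ S n) with (4 * 4 ^ n).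
    rewrite !plus_INR, !mult_INR, !S_INR.
    generalize (INR (fact (2 * n))); intros F; simpl INR.
    field; repeat split; lra.
Qed.

Definition stirling_seq (n : nat) : R :=
  INR (fact n) * exp (INR n) / (INR n ^ n * sqrt (INR n)).

Lemma stirling_seq_pos n : (0 < n)%nat -> 0 < stirling_seq n.
Proof.
  intros H; assert (Hn : 0 < INR n) by now apply lt_0_INR.
  apply Rdiv_lt_0_compat; apply Rmult_lt_0_compat.
  - apply INR_fact_lt_0.
  - apply exp_pos.
  - now apply pow_lt.
  - now apply sqrt_lt_R0.
Qed.

(** [2 x / (2 + x)] is a Padé approximant of [ln (1 + x)]; the derivative of the difference lies
    between 0 and [x^2 / 4]. At [x = 1 / n] the approximant times [n + 1/2] is exactly 1, which is
    why it suits Stirling's sequence. *)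
Lemma ln_1p_bounds (x : R) : 0 <= x ->
  0 <= ln (1 + x) - 2 * x / (2 + x) <= x ^ 3 / 12.
Proof.
  intros Hx.
  assert (Hd : forall s, 0 <= s <= x -> is_derive (fun s => ln (1 + s) - 2 * s / (2 + s)) s
     (s ^ 2 / ((1 + s) * (2 + s) ^ 2))).
  { intros s Hs; auto_derive; [split; [lra | split; [lra | easy]]|]. field; lra. }
  assert (Hp : forall s, 0 <= s <= x -> 0 <= s ^ 2 / ((1 + s) * (2 + s) ^ 2) <= s ^ 2 / 4).
  { intros s Hs; split.
    - apply Rdiv_le_0_compat; [apply pow2_ge_0|]. apply Rmult_lt_0_compat; [lra|apply pow_lt; lra].
    - apply Rmult_le_compat_l; [apply pow2_ge_0|]. apply Rinv_le_contravar; [lra|]. simpl; nra. }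
  set (f := fun s => ln (1 + s) - 2 * s / (2 + s)) in *.
  assert (Hf0 : f 0 = 0) by (unfold f; rewrite Rplus_0_r, ln_1; field).
  assert (H1 : Rabs (f x - f 0) <= f x - f 0).
  { apply Rabs_increment_le with (1 := Hx) (2 := Hd) (3 := Hd); intros s Hs.
    rewrite Rabs_pos_eq; [lra | now apply Hp]. }
  assert (H2 : Rabs (f x - f 0) <= x * x * x / 12 - 0 * 0 * 0 / 12).
  { apply (Rabs_increment_le f _ (fun s => s * s * s / 12) (fun s => s ^ 2 / 4) 0 x Hx Hd).
    - intros; auto_derive; [easy | simpl; field].
    - intros s Hs; rewrite Rabs_pos_eq; now apply Hp. }
  rewrite Hf0 in *; fold (f x).
  generalize (Rabs_pos (f x - 0)), (Rle_abs (f x - 0)); simpl; lra.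
Qed.

(** The bound on [e] is a telescoping difference, so that [stirling_seq n] is nonincreasing while
    [stirling_seq n * exp (- / (4 n))] is nondecreasing. The two together keep the limit
    positive. *)
Lemma stirling_seq_ratio n : (0 < n)%nat ->
  exists e, 0 <= e <= / (4 * INR n) - / (4 * INR (S n)) /\
    stirling_seq n = stirling_seq (S n) * exp e.
Proof.
  intros Hn0; assert (Hn : 1 <= INR n) by (apply (le_INR 1); lia).
  exists ((INR n + / 2) * ln (1 + / INR n) - 1).
  assert (Hx : 0 < / INR n) by (apply Rinv_0_lt_compat; lra).
  assert (Hb := ln_1p_bounds (/ INR n) (Rlt_le _ _ Hx)).
  set (l := ln (1 + / INR n)) in *.
  split; [split|].
  - apply Rle_trans with ((INR n + / 2) * (l - 2 * / INR n / (2 + / INR n))).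
    + apply Rmult_le_pos; lra.
    + right; field; nra.
  - apply Rle_trans with ((INR n + / 2) * (l - 2 * / INR n / (2 + / INR n))).
    + right; field; nra.
    + apply Rle_trans with ((INR n + / 2) * ((/ INR n) ^ 3 / 12)).
      * apply Rmult_le_compat_l; lra.
      * rewrite S_INR.
        replace (/ (4 * INR n) - / (4 * (INR n + 1))) with (/ (4 * INR n * (INR n + 1))) by (field;
          lra).
        replace ((INR n + / 2) * ((/ INR n) ^ 3 / 12)) with ((2 * INR n + 1) / (24 * INR n ^ 3)) by
          (field; lra).
        replace (/ (4 * INR n * (INR n + 1))) with (6 * INR n ^ 2 / (INR n + 1) / (24 * INR n ^ 3))
          by (field; lra).
        apply Rmult_le_compat_r.
        { left; apply Rinv_0_lt_compat, Rmult_lt_0_compat; [lra | apply pow_lt; lra]. }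
        apply Rle_div_r; [lra | simpl; nra].
  - unfold stirling_seq.
    replace (exp ((INR n + / 2) * l - 1)) with
      ((1 + / INR n) ^ n * sqrt (1 + / INR n) * exp (- 1)).
    + rewrite fact_simpl, mult_INR, S_INR, exp_plus.
      replace (1 + / INR n) with ((INR n + 1) / INR n) by (field; lra).
      rewrite sqrt_div by lra.
      assert (0 < sqrt (INR n)) by (apply sqrt_lt_R0; lra).
      assert (0 < sqrt (INR n + 1)) by (apply sqrt_lt_R0; lra).
      assert (0 < INR n ^ n) by (apply pow_lt; lra).
      assert (0 < (INR n + 1) ^ n) by (apply pow_lt; lra).
      replace (((INR n + 1) / INR n) ^ n) with ((INR n + 1) ^ n / INR n ^ n)
        by (unfold Rdiv; rewrite Rpow_mult_distr, pow_inv; easy).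
      replace (exp (- 1)) with (/ exp 1) by (rewrite <- exp_Ropp; f_equal; lra).
      assert (0 < exp 1) by apply exp_pos.
      simpl pow. field; repeat split; lra.
    + assert (Hl : exp l = 1 + / INR n) by (apply exp_ln; lra).
      replace ((INR n + / 2) * l - 1) with (INR n * l + (/ 2 * l + - 1)) by ring.
      rewrite !exp_plus, <- Rmult_assoc; f_equal; f_equal.
      * rewrite <- Rpower_pow by lra. unfold Rpower; fold l; easy.
      * rewrite <- Rpower_sqrt by lra. unfold Rpower; fold l; easy.
Qed.

Lemma stirling_seq_bounds n : (0 < n)%nat ->
  stirling_seq (S n) <= stirling_seq n /\
  stirling_seq n * exp (- / (4 * INR n)) <= stirling_seq (S n) * exp (- / (4 * INR (S n))).
Proof.
  intros Hn; destruct (stirling_seq_ratio n Hn) as (e & He & H).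
  assert (Hp := stirling_seq_pos (S n) ltac:(lia)).
  rewrite H; split.
  - apply Rle_trans with (stirling_seq (S n) * 1); [lra|].
    apply Rmult_le_compat_l; [lra|]. rewrite <- exp_0; apply exp_le; lra.
  - rewrite Rmult_assoc, <- exp_plus; apply Rmult_le_compat_l; [lra|]. apply exp_le; lra.
Qed.

Lemma stirling_seq_ub n : (0 < n)%nat -> stirling_seq n <= stirling_seq 1.
Proof.
  destruct n as [|n]; [lia|intros _]; induction n as [|n IH]; [lra|].
  generalize (proj1 (stirling_seq_bounds (S n) ltac:(lia))); lra.
Qed.

Lemma stirling_seq_lb n : (0 < n)%nat -> stirling_seq 1 * exp (- / 4) <= stirling_seq n.
Proof.
  intros Hn.
  apply Rle_trans with (stirling_seq n * exp (- / (4 * INR n))).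
  - destruct n as [|n]; [lia|clear Hn]; induction n as [|n IH].
    + simpl; rewrite Rmult_1_r; lra.
    + generalize (proj2 (stirling_seq_bounds (S n) ltac:(lia))); lra.
  - assert (H1 := stirling_seq_pos n Hn).
    assert (0 < INR n) by now apply lt_0_INR.
    apply Rle_trans with (stirling_seq n * 1); [|lra]. apply Rmult_le_compat_l; [lra|].
    rewrite <- exp_0; apply exp_le.
    assert (0 < / (4 * INR n)) by (apply Rinv_0_lt_compat; lra). lra.
Qed.

Lemma stirling_seq_sq n : (0 < n)%nat ->
  stirling_seq n ^ 2 = INR (fact n) ^ 2 * exp (INR n) ^ 2 / (INR n ^ n * INR n ^ n * INR n).
Proof.
  intros Hn0; assert (Hn : 0 < INR n) by now apply lt_0_INR.
  assert (Hs : sqrt (INR n) * sqrt (INR n) = INR n) by (apply sqrt_sqrt; lra).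
  assert (0 < sqrt (INR n)) by (apply sqrt_lt_R0; lra).
  assert (Hnn : 0 < INR n ^ n) by (apply pow_lt; lra).
  unfold stirling_seq.
  replace (INR n ^ n * INR n ^ n * INR n)
    with (INR n ^ n * INR n ^ n * (sqrt (INR n) * sqrt (INR n))) by (rewrite Hs; ring).
  field; split; lra.
Qed.

(** Eliminating the factorials from [wallis_even] leaves a relation between Stirling's sequence at
    [n] and at [2 n]; in the limit [l] it reads [PI / 4 * l^4 = PI^2 / 2 * l^2]. *)
Lemma stirling_wallis n : (0 < n)%nat ->
  wallis (2 * n) ^ 2 * INR n * stirling_seq n ^ 4 = PI ^ 2 / 2 * stirling_seq (2 * n) ^ 2.
Proof.
  intros Hn0; assert (Hn : 0 < INR n) by now apply lt_0_INR.
  replace (stirling_seq n ^ 4) with ((stirling_seq n ^ 2) ^ 2) by ring.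
  rewrite wallis_even, !stirling_seq_sq by lia.
  assert (Hf := INR_fact_lt_0 n).
  set (F := INR (fact (2 * n))).
  replace (INR (2 * n)) with (2 * INR n) by (rewrite mult_INR; simpl; ring).
  rewrite !(Rpow_mult_distr 2).
  replace (exp (2 * INR n)) with (exp (INR n) * exp (INR n))
    by (rewrite <- exp_plus; f_equal; ring).
  replace (INR n ^ (2 * n)) with (INR n ^ n * INR n ^ n)
    by (rewrite <- pow_add; f_equal; lia).
  replace (2 ^ (2 * n)) with (4 ^ n) by (rewrite pow_mult; f_equal; ring).
  assert (H4 : 0 < 4 ^ n) by (apply pow_lt; lra).
  assert (Hnn : 0 < INR n ^ n) by (apply pow_lt; lra).
  field; repeat split; lra.
Qed.

Lemma wallis_pos n : 0 < wallis n.
Proof.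
  assert (Hpi := PI2_1).
  apply RInt_gt_0; [lra| |intros; apply continuous_sin_pow].
  intros x Hx; apply pow_lt, sin_gt_0; lra.
Qed.

Lemma is_lim_seq_INR_inv : is_lim_seq (fun n => / INR n) 0.
Proof. apply (is_lim_seq_inv INR p_infty); [apply is_lim_seq_INR | easy]. Qed.

(** Monotonicity squeezes the square of [wallis (2 n)] between its products with the next and the
    previous Wallis integral, and these products are known from [wallis_prod]. *)
Lemma wallis_lim : is_lim_seq (fun n => wallis (2 * n) ^ 2 * INR n) (PI / 4).
Proof.
  assert (Hpi := PI2_1).
  apply is_lim_seq_le_le_loc with (fun n => PI / 4 * (1 - / (2 * INR n + 1))) (fun n => PI / 4).
  - exists 1%nat; intros n Hn0; assert (Hn : 0 < INR n) by now apply lt_0_INR.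
    assert (H1 := wallis_prod (2 * n)); assert (H2 := wallis_decr (2 * n)).
    assert (H3 := wallis_prod (2 * n - 1)); assert (H4 := wallis_decr (2 * n - 1)).
    replace (2 * n - 1 + 1)%nat with (2 * n)%nat in * by lia.
    assert (Hp := wallis_pos (2 * n)); assert (Hp' := wallis_pos (2 * n + 1)).
    rewrite plus_INR, mult_INR in H1; rewrite mult_INR in H3.
    revert H1 H2 H3 H4 Hp Hp'.
    generalize (wallis (2 * n)) (wallis (2 * n + 1)) (wallis (2 * n - 1)); simpl.
    intros w w' w'' H1 H2 H3 H4 Hp Hp'.
    assert (H5 : w * w' <= w * w) by nra; assert (H6 : w * w <= w'' * w) by nra.
    assert (H7 := Rmult_le_compat_l (2 * INR n + 1) _ _ ltac:(lra) H5).
    assert (H8 := Rmult_le_compat_l (2 * INR n) _ _ ltac:(lra) H6).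
    split; [|lra].
    replace (PI / 4 * (1 - / (2 * INR n + 1))) with (PI / 2 / (2 * INR n + 1) * INR n) by (field;
      lra).
    apply Rmult_le_compat_r; [lra|].
    apply Rle_div_l; [lra|]. lra.
  - replace (Finite (PI / 4)) with (Rbar_mult (PI / 4) 1) by (simpl; f_equal; ring).
    apply is_lim_seq_scal_l.
    replace (Finite 1) with (Finite (1 - 0)) by (f_equal; ring).
    apply is_lim_seq_minus'; [apply is_lim_seq_const|].
    apply is_lim_seq_ext with (fun n => / INR (2 * n + 1)).
    { intros n; rewrite plus_INR, mult_INR; simpl; f_equal; ring. }
    apply (is_lim_seq_subseq (fun n => / INR n)).
    + apply eventually_subseq; intros; lia.
    + apply is_lim_seq_INR_inv.
  - apply is_lim_seq_const.
Qed.

Lemma stirling_lim : is_lim_seq stirling_seq (sqrt (2 * PI)).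
Proof.
  assert (Hpi := PI2_1).
  assert (Hl1 := stirling_seq_pos 1 ltac:(lia)).
  assert (He : 0 < exp (- / 4)) by apply exp_pos.
  destruct (ex_finite_lim_seq_decr (fun n => stirling_seq (S n)) 0) as [l Hl].
  - intros n; apply stirling_seq_bounds; lia.
  - intros n; left; apply stirling_seq_pos; lia.
  - apply (is_lim_seq_incr_1 stirling_seq).
    (* Positivity of the limit is needed to cancel [l^2] in the equation that determines it. *)
    assert (Hlow : stirling_seq 1 * exp (- / 4) <= l).
    { apply (is_lim_seq_le (fun _ => stirling_seq 1 * exp (- / 4)) (fun n => stirling_seq (S n))
      (Finite (stirling_seq 1 * exp (- / 4))) l);
       [intros; apply stirling_seq_lb; lia | apply is_lim_seq_const | easy]. }
    assert (Hl0 : 0 < l) by nra.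
    assert (Hl' : is_lim_seq stirling_seq l) by now apply is_lim_seq_incr_1.
    assert (H2 : is_lim_seq (fun n => stirling_seq (2 * n)) l).
    { apply (is_lim_seq_subseq stirling_seq l (fun n => (2 * n)%nat)); [|easy].
      apply eventually_subseq; intros; lia. }
    assert (HA : is_lim_seq (fun n => wallis (2 * n) ^ 2 * INR n * stirling_seq n ^ 4)
       (PI / 4 * (l * (l * (l * (l * 1)))))).
    { apply is_lim_seq_mult'; [apply wallis_lim|]; simpl.
      repeat (apply is_lim_seq_mult'; [easy|]); apply is_lim_seq_const. }
    assert (HB : is_lim_seq (fun n => wallis (2 * n) ^ 2 * INR n * stirling_seq n ^ 4)
       (PI ^ 2 / 2 * (l * (l * 1)))).
    { apply is_lim_seq_ext_loc with (fun n => PI ^ 2 / 2 * stirling_seq (2 * n) ^ 2).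
      { exists 1%nat; intros n Hn; symmetry; apply stirling_wallis; lia. }
      apply is_lim_seq_mult'; [apply is_lim_seq_const|].
      repeat (apply is_lim_seq_mult'; [easy|]); apply is_lim_seq_const. }
    apply is_lim_seq_unique in HA; apply is_lim_seq_unique in HB.
    rewrite HA in HB; injection HB; intros E.
    assert (E2 : l * l = 2 * PI).
    { apply (Rmult_eq_reg_l (PI / 4 * (l * l))); [|nra]. simpl in E; lra. }
    rewrite <- E2, sqrt_square by lra. easy.
Qed.

(** * The Hankel integral for the reciprocal Gamma function *)

(* The Hankel integrand [e^w w^{1-b}] in the logarithmic coordinate [w = exp (x + i y)]; the extra
   factor [w] is the Jacobian. *)
Definition hankel (b x y : R) : C := cexp (cexp (x, y) + RtoC (1 - b) * (x, y))%C.

(** Only the real part is kept: by conjugate symmetry the imaginary part integrates to zero over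
    [[- phi, phi]]. In general it is only the limit for large [x] that is [1 / Gamma (b)]. *)
Definition arc (phi b x : R) : R :=
  / (2 * PI) * RInt (fun y => fst (hankel b x y)) (- phi) phi.

(** In the coordinate [z = log w] the derivative of [e^w w^{1-b}] is [w + 1 - b] times that
    function, and the factor [w] lowers [b] by one. *)
Definition hankel' (b x y : R) : C := (hankel (b - 1) x y + RtoC (1 - b) * hankel b x y)%C.

Lemma hankel_shift b c x y :
  hankel (b - c) x y = (cexp ((c * x)%R, (c * y)%R) * hankel b x y)%C.
Proof.
  unfold hankel; rewrite <- cexp_plus; f_equal.
  destruct (cexp (x, y)) as [u v]; apply injective_projections; simpl; ring.
Qed.

Lemma hol_hankel b x y : hol (hankel b) (hankel' b) x y.
Proof.
  assert (H1 := hol_id x y).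
  assert (H2 := hol_cexp _ _ _ _ (hol_plus _ _ _ _ _ _ (hol_cexp _ _ _ _ H1)
                   (hol_mult _ _ _ _ _ _ (hol_const (RtoC (1 - b)) x y) H1))).
  assert (He : forall s t, hankel' b s t =
    ((1 * cexp (s, t) + (0 * (s, t) + RtoC (1 - b) * 1)) * hankel b s t)%C).
  { intros s t; unfold hankel'; rewrite hankel_shift, !Rmult_1_l; ring. }
  destruct H2 as [? ? ? ? ? ? Hcu Hcv]; split; try assumption; rewrite ?He; try assumption.
  - eapply continuity_2d_pt_ext; [|exact Hcu]; intros; now rewrite He.
  - eapply continuity_2d_pt_ext; [|exact Hcv]; intros; now rewrite He.
Qed.

Lemma Cmod_hankel b x y : Cmod (hankel b x y) = exp (exp x * cos y + (1 - b) * x).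
Proof. unfold hankel; rewrite Cmod_cexp; f_equal; simpl; ring. Qed.

Lemma exp_ge_sq (x : R) : 0 <= x -> x ^ 2 / 2 <= exp x.
Proof.
  intros Hx.
  assert (H := Rabs_increment_le (fun s => s * s / 2) (fun s => s) exp exp 0 x Hx).
  assert (H' : Rabs (x * x / 2 - 0 * 0 / 2) <= exp x - exp 0).
  { apply H.
    - intros; auto_derive; [easy | field].
    - intros; apply is_derive_exp.
    - intros t Ht; rewrite Rabs_pos_eq by lra. generalize (exp_ineq1_le t); lra. }
  apply Rabs_le_between in H'; rewrite exp_0 in H'; simpl; lra.
Qed.

(** Half of the decay absorbs any power of [exp x]. After [exp x >= x^2 / 2] the constant comes from
    the maximum [(p - 1)^2 / c] of [(p - 1) x - c x^2 / 4]. *)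
Lemma exp_exp_dominates (p c : R) : 0 < c ->
  exists K, 0 < K /\ forall x, 0 <= x ->
    exp (p * x - c * exp x) <= K * (exp x * exp (- (c / 2) * exp x)).
Proof.
  intros Hc; exists (exp ((p - 1) ^ 2 / c)); split; [apply exp_pos|].
  intros x Hx; rewrite <- !exp_plus; apply exp_le.
  assert (H := exp_ge_sq x Hx).
  assert (c / 2 * (x ^ 2 / 2) <= c / 2 * exp x) by (apply Rmult_le_compat_l; lra).
  assert ((p - 1) ^ 2 / c + c / 4 * x ^ 2 - (p - 1) * x = (p - 1 - c / 2 * x) ^ 2 / c) by (field;
    lra).
  assert (0 <= (p - 1 - c / 2 * x) ^ 2 / c)
    by (apply Rmult_le_pos; [apply pow2_ge_0 | left; now apply Rinv_0_lt_compat]).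
  lra.
Qed.

Lemma ex_RInt_hankel b x y1 y2 : y1 <= y2 -> ex_RInt (fun y => fst (hankel b x y)) y1 y2.
Proof.
  intros H; apply (ex_RInt_2d (fun x y => fst (hankel b x y))); [easy|].
  intros y _; apply (hol_cu _ _ _ _ (hol_hankel b x y)).
Qed.

Lemma is_derive_arc phi b x : 0 <= phi ->
  is_derive (arc phi b) x (/ (2 * PI) * (snd (hankel b x phi) - snd (hankel b x (- phi)))).
Proof.
  intros Hp; unfold arc.
  apply (is_derive_scal (fun x => RInt (fun y => fst (hankel b x y)) (- phi) phi)).
  apply cauchy_vertical with (f' := hankel' b) (d := mkposreal 1 Rlt_0_1); [lra|].
  apply filter_forall; intros; apply hol_hankel.
Qed.

Lemma PI2_pos : 0 < / (2 * PI).
Proof. apply Rinv_0_lt_compat; generalize PI_RGT_0; lra. Qed.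

Lemma inv_2PI_le_1 : 2 * / (2 * PI) <= 1.
Proof.
  assert (H := PI2_1); rewrite <- (Rinv_r (2 * PI)) by lra.
  apply Rmult_le_compat_r; [left; apply PI2_pos | lra].
Qed.

Lemma arc_derive_bound phi b x :
  Rabs (/ (2 * PI) * (snd (hankel b x phi) - snd (hankel b x (- phi))))
   <= exp ((1 - b) * x - - cos phi * exp x).
Proof.
  rewrite Rabs_mult, (Rabs_pos_eq (/ _)) by (left; apply PI2_pos).
  assert (H1 := Rabs_snd_le_Cmod (hankel b x phi)).
  assert (H2 := Rabs_snd_le_Cmod (hankel b x (- phi))).
  rewrite Cmod_hankel in H1, H2; rewrite cos_neg in H2.
  replace ((1 - b) * x - - cos phi * exp x) with (exp x * cos phi + (1 - b) * x) by ring.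
  set (e := exp _) in *; assert (0 < e) by apply exp_pos.
  apply Rle_trans with (/ (2 * PI) * (2 * e)).
  - apply Rmult_le_compat_l; [left; apply PI2_pos|].
    eapply Rle_trans; [apply Rabs_triang|]; rewrite Rabs_Ropp; lra.
  - generalize inv_2PI_le_1; nra.
Qed.

Lemma cos_neg_of (phi : R) : PI / 2 < phi <= PI -> 0 < - cos phi.
Proof. intros [H1 H2]; assert (cos phi < 0) by (apply cos_lt_0; lra); lra. Qed.

(** It turns out not to depend on [phi] in [(PI / 2, PI]]: for each such [phi] it is
    [1 / Gamma (b)], see [rgamma_hankel]. *)
Definition hankel_lim (phi b : R) : R := real (Lim (arc phi b) p_infty).

Lemma is_lim_arc phi b : PI / 2 < phi <= PI -> is_lim (arc phi b) p_infty (hankel_lim phi b).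
Proof.
  intros Hp; assert (Hc := cos_neg_of phi Hp); generalize PI_RGT_0; intros Hpi.
  destruct (exp_exp_dominates (1 - b) (- cos phi) Hc) as (K & HK & HKx).
  destruct (exp_exp_tail (arc phi b) (fun x => / (2 * PI) * (snd (hankel b x phi) - snd (hankel b x
    (- phi)))) K (- cos phi / 2) 0) as [l Hl].
  - lra.
  - intros x _; apply is_derive_arc; lra.
  - intros x Hx; eapply Rle_trans; [apply arc_derive_bound | apply HKx, Hx].
  - unfold hankel_lim; now rewrite (is_lim_unique _ _ _ Hl).
Qed.

(** One constant serves all [b' >= b], and the factor [exp (- (b' - b) L)] makes the error summable
    when [b'] runs through [b + nu k]. It appears because [exp (- (b' - b) x)] is largest at the
    start [x = L] of the tail. *)
Lemma hankel_lim_arc phi b : PI / 2 < phi <= PI ->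
  exists K, 0 < K /\ forall b' L, b <= b' -> 0 <= L ->
   Rabs (hankel_lim phi b' - arc phi b' L)
     <= exp (- (b' - b) * L) * (K * exp (cos phi / 2 * exp L)).
Proof.
  intros Hp; assert (Hc := cos_neg_of phi Hp); generalize PI_RGT_0; intros Hpi.
  destruct (exp_exp_dominates (1 - b) (- cos phi) Hc) as (K & HK & HKx).
  exists (K / (- cos phi / 2)); split; [apply Rdiv_lt_0_compat; lra|].
  intros b' L Hb HL.
  assert (H := exp_exp_tail_le (arc phi b') (fun x => / (2 * PI) * (snd (hankel b' x phi) - snd
    (hankel b' x (- phi)))) (exp (- (b' - b) * L) * K) (- cos phi / 2) L (hankel_lim phi b')).
  eapply Rle_trans; [apply H|].
  - lra.
  - intros x _; apply is_derive_arc; lra.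
  - intros x Hx; eapply Rle_trans; [apply arc_derive_bound|].
    rewrite Rmult_assoc; eapply Rle_trans; [|apply Rmult_le_compat_l; [left; apply exp_pos | apply
      HKx; lra]].
    rewrite <- exp_plus; apply exp_le. nra.
  - now apply is_lim_arc.
  - right; replace (- (- cos phi / 2) * exp L) with (cos phi / 2 * exp L) by field. field; lra.
Qed.

(** Integration by parts along the arc: [fst (hankel' b)] is the [y]-derivative of [snd (hankel b)].
    Thus the functional equation of [1 / Gamma] holds up to end values. *)
Lemma arc_rec phi b x : 0 <= phi ->
  arc phi (b - 1) x + (1 - b) * arc phi b x
   = / (2 * PI) * (snd (hankel b x phi) - snd (hankel b x (- phi))).
Proof.
  intros Hp; unfold arc.
  replace (/ (2 * PI) * RInt (fun y => fst (hankel (b - 1) x y)) (- phi) phi +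
    (1 - b) * (/ (2 * PI) * RInt (fun y => fst (hankel b x y)) (- phi) phi)) with
   (/ (2 * PI) * (RInt (fun y => fst (hankel (b - 1) x y)) (- phi) phi +
      (1 - b) * RInt (fun y => fst (hankel b x y)) (- phi) phi)) by ring.
  f_equal.
  rewrite <- (RInt_scal (V := R_CompleteNormedModule) (fun y => fst (hankel b x y)))
    by (apply ex_RInt_hankel; lra).
  rewrite <- (RInt_plus (V := R_CompleteNormedModule) (fun y => fst (hankel (b - 1) x y)));
    [|apply ex_RInt_hankel; lra
     |apply @ex_RInt_scal, ex_RInt_hankel; lra].
  apply is_RInt_unique.
  apply (is_RInt_ext (fun y => fst (hankel' b x y))).
  { intros y _; unfold hankel', plus, scal; simpl; unfold mult; simpl; ring. }
  apply (is_RInt_derive (fun t => snd (hankel b x t))); intros t _.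
  - apply (hol_vy _ _ _ _ (hol_hankel b x t)).
  - apply (continuity_2d_pt_snd (fun x t => fst (hankel' b x t))), (hol_cu' _ _ _ _ (hol_hankel b x
    t)).
Qed.

Lemma is_lim_squeeze0 (f g : R -> R) : is_lim g p_infty 0 ->
  Rbar_locally' p_infty (fun x => Rabs (f x) <= g x) -> is_lim f p_infty 0.
Proof.
  intros Hg H.
  apply (is_lim_le_le_loc (fun x => - g x) g); auto.
  - revert H; apply filter_imp; intros x Hx; apply Rabs_le_between in Hx; lra.
  - replace (Finite 0) with (Rbar_opp 0) by (simpl; f_equal; ring).
    now apply is_lim_opp.
Qed.

Lemma hankel_lim_rec phi b : PI / 2 < phi <= PI ->
  hankel_lim phi (b - 1) = (b - 1) * hankel_lim phi b.
Proof.
  intros Hp; assert (Hc := cos_neg_of phi Hp); generalize PI_RGT_0; intros Hpi.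
  destruct (exp_exp_dominates (1 - b) (- cos phi) Hc) as (K & HK & HKx).
  assert (H0 : is_lim (fun x => arc phi (b - 1) x + (1 - b) * arc phi b x) p_infty 0).
  (* The exponent is [2 - b] instead of [1 - b] because the dominating expression carries a factor
     [exp x], which is divided out below. *)
  { destruct (exp_exp_dominates (2 - b) (- cos phi) Hc) as (K2 & HK2 & HKx2).
    apply is_lim_squeeze0 with (fun x => K2 * exp (- (- cos phi / 2) * exp x));
      [apply is_lim_exp_exp; lra|].
    exists 0; intros x Hx; rewrite arc_rec by lra.
    eapply Rle_trans; [apply arc_derive_bound|].
    apply (Rmult_le_reg_l (exp x)); [apply exp_pos|].
    rewrite <- exp_plus.
    replace (x + ((1 - b) * x - - cos phi * exp x)) with ((2 - b) * x - - cos phi * exp x) by ring.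
    generalize (HKx2 x (Rlt_le _ _ Hx)); nra. }
  assert (H1 := is_lim_plus' _ _ _ _ _ (is_lim_arc phi (b - 1) Hp)
     (is_lim_scal_l _ (1 - b) _ _ (is_lim_arc phi b Hp))).
  assert (H2 := is_lim_unique _ _ _ H0); rewrite (is_lim_unique _ _ _ H1) in H2.
  injection H2; lra.
Qed.

(** For [b = 1] the integrand [e^w] is single valued and real on the negative axis, so the end
    values vanish and circles of all radii give the same value. *)
Lemma arc_PI_1 x : arc PI 1 x = 1.
Proof.
  assert (Hpi := PI_RGT_0).
  assert (Hd : forall x, is_derive (arc PI 1) x 0).
  { intros z; eapply is_derive_eq; [apply is_derive_arc; lra|].
    unfold hankel, cexp; simpl; rewrite sin_neg, cos_neg, sin_PI, cos_PI.
    replace (exp z * - 0 + ((1 - 1) * - PI + 0 * z)) with 0 by ring.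
    replace (exp z * 0 + ((1 - 1) * PI + 0 * z)) with 0 by ring.
    rewrite sin_0; ring. }
  assert (Hc : forall a b, a <= b -> arc PI 1 b = arc PI 1 a).
  { intros a b Hab.
    assert (H := Rabs_increment_le (arc PI 1) (fun _ => 0) (fun _ => 0) (fun _ => 0) a b Hab
     (fun x _ => Hd x) (fun x _ => is_derive_const (V := R_NormedModule) 0 x)).
    assert (Hz : Rabs (arc PI 1 b - arc PI 1 a) <= 0).
    { replace 0 with (0 - 0) at 1 by ring; apply H; intros; rewrite Rabs_R0; lra. }
    destruct (Req_dec (arc PI 1 b - arc PI 1 a) 0) as [E|E]; [lra|].
    apply Rabs_pos_lt in E; lra. }
  (* let the radius [exp x] tend to [0] *)
  assert (Hb : forall x, x <= 0 -> Rabs (arc PI 1 x - 1) <= 5 * exp x).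
  { intros z Hz.
    replace (arc PI 1 z - 1) with (/ (2 * PI) * RInt (fun y => fst (hankel 1 z y) - 1) (- PI) PI).
    - rewrite Rabs_mult, (Rabs_pos_eq (/ _)) by (left; apply PI2_pos).
      apply Rle_trans with (/ (2 * PI) * ((PI - - PI) * (5 * exp z))); [|right; field; lra].
      apply Rmult_le_compat_l; [left; apply PI2_pos|].
      apply abs_RInt_le_const; [lra| |].
      { apply (ex_RInt_minus (V := R_NormedModule) (fun y => fst (hankel 1 z y)) (fun _ => 1));
          [apply ex_RInt_hankel; lra | apply ex_RInt_const]. }
      intros t _; unfold hankel, cexp; simpl.
      set (r := exp z); assert (Hr : 0 < r <= 1)
        by (split; [apply exp_pos | rewrite <- exp_0; now apply exp_le]).
      replace (r * cos t + ((1 - 1) * z - 0 * t)) with (r * cos t) by ring.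
      replace (r * sin t + ((1 - 1) * t + 0 * z)) with (r * sin t) by ring.
      assert (Hu : Rabs (r * cos t) <= r)
        by (apply Rabs_le; generalize (COS_bound t); nra).
      assert (Hv : Rabs (r * sin t) <= r)
        by (apply Rabs_le; generalize (SIN_bound t); nra).
      revert Hu Hv; generalize (r * cos t) (r * sin t); intros u v Hu Hv.
      assert (H3 : exp (Rabs u) <= 3)
        by (eapply Rle_trans; [apply exp_le; apply Rle_trans with (2 := proj2 Hr); easy | apply
          exp_le_3]).
      assert (H4 : exp u <= 3)
        by (eapply Rle_trans; [apply exp_le, Rle_abs | easy]).
      replace (exp u * cos v - 1) with ((exp u - 1) - exp u * (1 - cos v)) by ring.
      eapply Rle_trans; [apply Rabs_triang|].
      rewrite Rabs_Ropp, Rabs_mult, (Rabs_pos_eq (exp u)) by (left; apply exp_pos).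
      rewrite (Rabs_pos_eq (1 - cos v)) by apply one_minus_cos_le.
      assert (H5 := Rabs_exp_minus1_le u); assert (H6 := one_minus_cos_le v).
      assert (Rabs u * exp (Rabs u) <= r * 3)
        by (apply Rmult_le_compat; try easy; [apply Rabs_pos | left; apply exp_pos]).
      assert (H7 : v ^ 2 <= r * r)
        by (rewrite <- pow2_abs; generalize (Rabs_pos v); simpl; nra).
      assert (exp u * (1 - cos v) <= 3 * (r * r / 2))
        by (apply Rmult_le_compat; try lra; left; apply exp_pos).
      nra.
    - rewrite (RInt_minus (V := R_CompleteNormedModule) (fun y => fst (hankel 1 z y)) (fun _ => 1));
        [|apply ex_RInt_hankel; lra | apply ex_RInt_const].
      rewrite RInt_const; unfold arc, minus, plus, opp, scal; simpl; unfold mult; simpl. field;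
        lra. }
  destruct (Req_dec (arc PI 1 x) 1) as [E|E]; [easy|exfalso].
  assert (Hpos : 0 < Rabs (arc PI 1 x - 1)) by (apply Rabs_pos_lt; lra).
  set (d := Rabs (arc PI 1 x - 1)) in *.
  (* With [exp z <= d / 10] the bound [5 exp z] is at most [d / 2], which contradicts that the
     distance [d] is the same at [z] and at [x]. *)
  set (z := Rmin (Rmin x 0) (ln (d / 10))).
  assert (Hz1 : z <= Rmin x 0) by apply Rmin_l.
  assert (Hz2 : z <= ln (d / 10)) by apply Rmin_r.
  generalize (Rmin_l x 0), (Rmin_r x 0); intros.
  assert (exp z <= d / 10) by (rewrite <- (exp_ln (d / 10)) by lra; now apply exp_le).
  generalize (Hb z ltac:(lra)); rewrite <- (Hc z x) by lra; fold d; lra.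
Qed.

(** The arc of opening [phi] differs from the full circle by two pieces on which
    [cos y <= cos phi < 0]; their contribution vanishes as the radius grows. *)
Lemma hankel_lim_1 phi : PI / 2 < phi <= PI -> hankel_lim phi 1 = 1.
Proof.
  intros Hp; assert (Hc := cos_neg_of phi Hp); generalize PI_RGT_0; intros Hpi.
  assert (Hs : forall x y1 y2, y1 <= y2 ->
    (forall y, y1 <= y <= y2 -> cos y <= cos phi) ->
    Rabs (RInt (fun y => fst (hankel 1 x y)) y1 y2) <= (y2 - y1) * exp (exp x * cos phi)).
  { intros x y1 y2 Hy Hcos; apply abs_RInt_le_const; [easy | now apply ex_RInt_hankel|].
    intros t Ht; eapply Rle_trans; [apply Rabs_fst_le_Cmod|].
    rewrite Cmod_hankel; apply exp_le.
    replace (exp x * cos t + (1 - 1) * x) with (exp x * cos t) by ring.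
    apply Rmult_le_compat_l; [left; apply exp_pos | auto]. }
  assert (H0 : is_lim (fun x => arc phi 1 x - 1) p_infty 0).
  { apply is_lim_squeeze0 with (fun x => 1 * exp (- (- cos phi) * exp x));
      [apply is_lim_exp_exp; lra|].
    exists 0; intros x _; assert (E := arc_PI_1 x).
    replace (arc phi 1 x - 1) with (- (/ (2 * PI) *
      (RInt (fun y => fst (hankel 1 x y)) (- PI) (- phi)
        + RInt (fun y => fst (hankel 1 x y)) phi PI))).
    - rewrite Rabs_Ropp, Rabs_mult, (Rabs_pos_eq (/ _)) by (left; apply PI2_pos).
      replace (1 * exp (- - cos phi * exp x)) with (/ (2 * PI) * (2 * PI * exp (exp x * cos phi)))
        by (rewrite Ropp_involutive, (Rmult_comm (cos phi)); field; lra).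
      apply Rmult_le_compat_l; [left; apply PI2_pos|].
      eapply Rle_trans; [apply Rabs_triang|].
      assert (H1 := Hs x (- PI) (- phi) ltac:(lra)).
      assert (H2 := Hs x phi PI ltac:(lra)).
      assert (He := exp_pos (exp x * cos phi)).
      assert (H3 : forall y, phi <= y <= PI -> cos y <= cos phi).
      { intros y Hy; destruct (Req_dec y phi) as [->|]; [lra|].
        left; apply cos_decreasing_1; lra. }
      specialize (H2 H3).
      assert (H4 : forall y, - PI <= y <= - phi -> cos y <= cos phi).
      { intros y Hy; rewrite <- (cos_neg y); apply H3; lra. }
      specialize (H1 H4). nra.
    - transitivity (arc phi 1 x - arc PI 1 x); [clear E | now rewrite E].
      unfold arc.
      rewrite <- (RInt_Chasles (V := R_CompleteNormedModule) _ (- PI) (- phi) PI)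
        by (apply ex_RInt_hankel; lra).
      rewrite <- (RInt_Chasles (V := R_CompleteNormedModule) _ (- phi) phi PI)
        by (apply ex_RInt_hankel; lra).
      unfold plus; simpl; ring. }
  assert (H1 := is_lim_minus' _ _ _ _ _ (is_lim_arc phi 1 Hp) (is_lim_const 1 p_infty)).
  assert (H2 := is_lim_unique _ _ _ H0); rewrite (is_lim_unique _ _ _ H1) in H2.
  injection H2; lra.
Qed.

Lemma hankel_lim_fact phi n : PI / 2 < phi <= PI ->
  hankel_lim phi (INR n + 1) = / INR (fact n).
Proof.
  intros Hp; induction n as [|n IH].
  - simpl; rewrite Rplus_0_l, hankel_lim_1 by easy; now rewrite Rinv_1.
  - assert (H := hankel_lim_rec phi (INR (S n) + 1) Hp).
    replace (INR (S n) + 1 - 1) with (INR n + 1) in H by (rewrite S_INR; ring).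
    rewrite IH in H. change (fact (S n)) with ((S n) * fact n)%nat.
    rewrite mult_INR, S_INR in *.
    assert (0 < INR n + 1) by (generalize (pos_INR n); lra).
    assert (Hf := INR_fact_neq_0 n).
    apply (Rmult_eq_reg_l (INR n + 1)); [|lra].
    rewrite <- H; field; lra.
Qed.

Lemma sin_ge_quarter (s : R) : 0 <= s <= PI / 2 -> s / 4 <= sin s.
Proof.
  intros Hs; assert (Hpi := PI_RGT_0); assert (H4 := PI_4).
  destruct (Rle_lt_dec s (PI / 3)) as [H|H].
  - assert (Hi : Rabs (s / 4 - 0 / 4) <= sin s - sin 0).
    { apply (Rabs_increment_le (fun s => s / 4) (fun _ => / 4) sin cos); [lra| | |].
      - intros; auto_derive; [easy|field].
      - intros; apply is_derive_sin.
      - intros t Ht; rewrite Rabs_pos_eq by lra.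
        apply Rle_trans with (cos (PI / 3)); [rewrite cos_PI3; lra|].
        apply cos_decr_1; lra. }
    rewrite sin_0 in Hi; apply Rabs_le_between in Hi; lra.
  - apply Rle_trans with (sin (PI / 6)); [rewrite sin_PI6; lra|].
    apply sin_incr_1; lra.
Qed.

(** The constant is [2 * (1/8)^2], from [sin (y / 2) >= y / 8]. *)
Lemma one_minus_cos_ge (y : R) : - PI <= y <= PI -> y ^ 2 / 32 <= 1 - cos y.
Proof.
  intros Hy; rewrite one_minus_cos.
  assert (H : forall y, 0 <= y <= PI -> y ^ 2 / 32 <= 2 * sin (y / 2) ^ 2).
  { intros z Hz; generalize (sin_ge_quarter (z / 2) ltac:(lra)); intros; simpl; nra. }
  destruct (Rle_lt_dec 0 y) as [H0|H0]; [apply H; lra|].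
  generalize (H (- y) ltac:(lra)).
  replace (- y / 2) with (- (y / 2)) by field; rewrite sin_neg; simpl; lra.
Qed.

Lemma Cmod_cexp_imag_minus1 (s : R) : Cmod (cexp (0, s) - 1)%C <= Rabs s.
Proof.
  assert (H := Cmod2_alt (cexp (0, s) - 1)%C); simpl in H.
  rewrite exp_0 in H.
  apply Rsqr_incr_0_var; [|apply Rabs_pos]; rewrite <- Rsqr_abs; unfold Rsqr.
  generalize (one_minus_cos_le s) (sin2_cos2 s); unfold Rsqr; simpl; nra.
Qed.

(** Raising [b] by [x] multiplies the integrand by [w^{-x}]. Replacing that factor by its value at
    [y = 0] costs [|x y|], and [1 - cos y >= y^2 / 32] turns the modulus into a Gaussian of width
    about [exp (- L / 2)]. *)
Lemma hankel_diff_bound (x b L y : R) : - PI <= y <= PI ->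
  Rabs (fst (hankel (b + x) L y) - exp (- x * L) * fst (hankel b L y))
   <= exp (- x * L + exp L + (1 - b) * L) * (Rabs x * (Rabs y * exp (- exp L / 32 * y ^ 2))).
Proof.
  intros Hy.
  replace (hankel (b + x) L y) with (hankel (b - - x) L y) by (f_equal; ring).
  rewrite hankel_shift.
  replace (cexp ((- x * L)%R, (- x * y)%R)) with (RtoC (exp (- x * L)) * cexp (0, (- x * y)%R))%C
    by (unfold cexp; apply injective_projections; simpl; rewrite exp_0; ring).
  set (h := hankel b L y).
  replace (fst (RtoC (exp (- x * L)) * cexp (0, (- x * y)%R) * h)%C - exp (- x * L) * fst h) with
   (exp (- x * L) * fst (h * (cexp (0, (- x * y)%R) - 1))%C) by (simpl; ring).
  rewrite Rabs_mult, (Rabs_pos_eq (exp _)) by (left; apply exp_pos).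
  rewrite 2!exp_plus, 2!Rmult_assoc; apply Rmult_le_compat_l; [left; apply exp_pos|].
  eapply Rle_trans; [apply Rabs_fst_le_Cmod|]; rewrite Cmod_mult.
  unfold h; rewrite Cmod_hankel.
  assert (H1 := Cmod_cexp_imag_minus1 (- x * y)).
  rewrite Rabs_mult, Rabs_Ropp in H1.
  apply Rle_trans with (exp (exp L * cos y + (1 - b) * L) * (Rabs x * Rabs y)).
  - apply Rmult_le_compat_l; [left; apply exp_pos | easy].
  - replace (exp (exp L) * (exp ((1 - b) * L) * (Rabs x * (Rabs y * exp (- exp L / 32 * y ^ 2)))))
      with (exp (exp L + (1 - b) * L + - exp L / 32 * y ^ 2) * (Rabs x * Rabs y))
      by (rewrite !exp_plus; ring).
    apply Rmult_le_compat_r; [apply Rmult_le_pos; apply Rabs_pos|].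
    apply exp_le; assert (H2 := one_minus_cos_ge y Hy); assert (H3 := exp_pos L); nra.
Qed.

(** [|y| exp (- k y^2)] has an elementary primitive on each half line, and its integral over the
    whole line is [1 / k]. *)
Lemma RInt_gauss_moment (A k phi : R) (g : R -> R) : 0 < k -> 0 <= phi -> 0 <= A ->
  ex_RInt g (- phi) phi ->
  (forall y, - phi <= y <= phi -> Rabs (g y) <= A * (Rabs y * exp (- k * y ^ 2))) ->
  Rabs (RInt g (- phi) phi) <= A / k.
Proof.
  intros Hk Hphi HA Hex Hg.
  assert (Hex1 : ex_RInt g (- phi) 0).
  { apply (ex_RInt_Chasles_1 (V := R_CompleteNormedModule) g _ _ phi); [lra | easy]. }
  assert (Hex2 : ex_RInt g 0 phi).
  { apply (ex_RInt_Chasles_2 (V := R_CompleteNormedModule) g (- phi) _ _); [lra | easy]. }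
  rewrite <- (RInt_Chasles (V := R_CompleteNormedModule) g (- phi) 0 phi) by easy.
  eapply Rle_trans; [apply Rabs_triang|].
  set (e := exp (- k * phi ^ 2)).
  assert (He : 0 < e) by apply exp_pos.
  assert (H1 : is_RInt (fun y => A * (- y * exp (- k * y ^ 2))) (- phi) 0
    (A / (2 * k) * exp (- k * 0 ^ 2) - A / (2 * k) * exp (- k * (- phi) ^ 2))).
  { apply (is_RInt_derive (fun y => A / (2 * k) * exp (- k * y ^ 2))).
    - intros; auto_derive; [easy|]; simpl; field; lra.
    - intros; apply (ex_derive_continuous (fun y => A * (- y * exp (- k * y ^ 2)))); auto_derive;
      easy. }
  assert (H2 : is_RInt (fun y => A * (y * exp (- k * y ^ 2))) 0 phi
    (- (A / (2 * k)) * exp (- k * phi ^ 2) - - (A / (2 * k)) * exp (- k * 0 ^ 2))).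
  { apply (is_RInt_derive (fun y => - (A / (2 * k)) * exp (- k * y ^ 2))).
    - intros; auto_derive; [easy|]; simpl; field; lra.
    - intros; apply (ex_derive_continuous (fun y => A * (y * exp (- k * y ^ 2)))); auto_derive;
      easy. }
  replace (- k * 0 ^ 2) with 0 in H1, H2 by ring; rewrite exp_0 in H1, H2.
  replace ((- phi) ^ 2) with (phi ^ 2) in H1 by ring; fold e in H1, H2.
  apply Rle_trans with (A / (2 * k) + A / (2 * k)); [|right; field; lra].
  assert (HAk : 0 <= A / (2 * k)) by (apply Rdiv_le_0_compat; lra).
  apply Rplus_le_compat.
  - eapply Rle_trans; [apply abs_RInt_le; [lra | easy]|].
    eapply Rle_trans; [apply RInt_le with (g := fun y => A * (- y * exp (- k * y ^ 2)))|].
    + lra.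
    + now apply ex_RInt_norm in Hex1.
    + eexists; apply H1.
    + intros y Hy; rewrite <- (Rabs_left y) by lra; apply Hg; lra.
    + rewrite (is_RInt_unique _ _ _ _ H1); nra.
  - eapply Rle_trans; [apply abs_RInt_le; [lra | easy]|].
    eapply Rle_trans; [apply RInt_le with (g := fun y => A * (y * exp (- k * y ^ 2)))|].
    + lra.
    + now apply ex_RInt_norm in Hex2.
    + eexists; apply H2.
    + intros y Hy; rewrite <- (Rabs_pos_eq y) at 2 by lra; apply Hg; lra.
    + rewrite (is_RInt_unique _ _ _ _ H2); nra.
Qed.

Lemma arc_diff_bound (phi x b L : R) : 0 <= phi <= PI ->
  Rabs (arc phi (b + x) L - exp (- x * L) * arc phi b L)
   <= exp (- x * L + exp L + (1 - b) * L) * Rabs x * 32 * exp (- L).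
Proof.
  intros Hphi; unfold arc.
  assert (Hex : forall b, ex_RInt (fun y => fst (hankel b L y)) (- phi) phi)
    by (intros; apply ex_RInt_hankel; lra).
  assert (Hex2 : ex_RInt (fun y => exp (- x * L) * fst (hankel b L y)) (- phi) phi)
    by (apply (ex_RInt_scal (V := R_NormedModule) (fun y => fst (hankel b L y))), Hex).
  replace (/ (2 * PI) * RInt (fun y => fst (hankel (b + x) L y)) (- phi) phi -
     exp (- x * L) * (/ (2 * PI) * RInt (fun y => fst (hankel b L y)) (- phi) phi))
  with (/ (2 * PI) * RInt (fun y => fst (hankel (b + x) L y) - exp (- x * L) * fst (hankel b L y))
    (- phi) phi).
  - rewrite Rabs_mult, (Rabs_pos_eq (/ _)) by (left; apply PI2_pos).
    set (A := exp (- x * L + exp L + (1 - b) * L) * Rabs x).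
    assert (HA : 0 <= A) by (apply Rmult_le_pos; [left; apply exp_pos | apply Rabs_pos]).
    assert (HL := exp_pos L).
    assert (Hb : Rabs (RInt (fun y => fst (hankel (b + x) L y) - exp (- x * L) * fst (hankel b L
      y)) (- phi) phi)
      <= A / (exp L / 32)).
    { apply RInt_gauss_moment; try lra.
      - apply (ex_RInt_minus (V := R_NormedModule) (fun y => fst (hankel (b + x) L y))); easy.
      - intros y Hy; eapply Rle_trans; [apply hankel_diff_bound; lra|].
        right; unfold A. replace (- (exp L / 32)) with (- exp L / 32) by field. ring. }
    replace (A / (exp L / 32)) with (A * 32 * exp (- L)) in Hb by (rewrite exp_Ropp; field; lra).
    apply Rle_trans with (1 * (A * 32 * exp (- L))); [|lra].
    apply Rmult_le_compat; [left; apply PI2_pos | apply Rabs_pos | | easy].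
    generalize inv_2PI_le_1, PI2_pos; lra.
  - rewrite (RInt_minus (V := R_CompleteNormedModule) (fun y => fst (hankel (b + x) L y))) by easy.
    rewrite (RInt_scal (V := R_CompleteNormedModule) (fun y => fst (hankel b L y))) by easy.
    unfold minus, plus, opp, scal; simpl; unfold mult; simpl; ring.
Qed.

Lemma fact_le_stirling n : (0 < n)%nat ->
  INR (fact n) <= stirling_seq 1 * (sqrt (INR n) * exp (INR n * ln (INR n) - INR n)).
Proof.
  intros Hn0; assert (Hn : 0 < INR n) by now apply lt_0_INR.
  assert (H := stirling_seq_ub n Hn0); unfold stirling_seq at 1 in H.
  rewrite <- Rpower_pow in H by easy; unfold Rpower in H.
  set (Y := exp (INR n * ln (INR n)) * sqrt (INR n)) in H.
  assert (HY : 0 < Y) by (apply Rmult_lt_0_compat; [apply exp_pos | now apply sqrt_lt_R0]).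
  assert (HE := exp_pos (INR n)).
  apply (Rmult_le_reg_r (exp (INR n))); [easy|].
  replace (INR (fact n) * exp (INR n)) with (INR (fact n) * exp (INR n) / Y * Y) by (field; lra).
  eapply Rle_trans; [apply Rmult_le_compat_r; [lra | exact H]|]; right.
  unfold Y, Rminus; rewrite exp_plus, exp_Ropp; field; lra.
Qed.

(* Laplace's method in its crudest form: the two integrals are compared on the circle of radius
   [n], where an error [O (|y|)] in the integrand already yields the relative error [n^{-1/2}]. *)
Lemma hankel_lim_ratio (phi x : R) : PI / 2 < phi <= PI ->
  is_lim_seq (fun n => INR (fact n) * Rpower (INR n) x * hankel_lim phi (INR n + 1 + x)) 1.
Proof.
  intros Hp; assert (Hc := cos_neg_of phi Hp); generalize PI_RGT_0; intros Hpi.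
  destruct (hankel_lim_arc phi 0 Hp) as (K & HK & Harc).
  set (S := stirling_seq 1); assert (HS : 0 < S) by (apply stirling_seq_pos; lia).
  set (D := S * (2 * K + 32 * Rabs x)).
  cut (is_lim_seq (fun n => INR (fact n) * Rpower (INR n) x * hankel_lim phi (INR n + 1 + x) - 1)
    0).
  { intros H; apply is_lim_seq_ext with (fun n => (INR (fact n) * Rpower (INR n) x * hankel_lim phi
    (INR n + 1 + x) - 1) + 1); [intros; ring|].
    replace (Finite 1) with (Finite (0 + 1)) by (f_equal; ring).
    apply is_lim_seq_plus'; [easy | apply is_lim_seq_const]. }
  apply is_lim_seq_abs_0.
  apply is_lim_seq_le_le_loc with (fun _ => 0) (fun n => D * / sqrt (INR n)).
  - destruct (nfloor_ex (Rabs x) (Rabs_pos x)) as [N HN].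
    (* Beyond [|x|] the parameter [n + 1 + x] is nonnegative, which is the range covered by
       [Harc]. *)
    exists (N + 1)%nat; intros n Hn0; split; [apply Rabs_pos|].
    assert (Hn0' : (0 < n)%nat) by lia.
    assert (Hn : 1 <= INR n) by (apply (le_INR 1); lia).
    assert (Hnx : 0 <= INR n + x).
    { apply le_INR in Hn0; rewrite plus_INR in Hn0; simpl in Hn0.
      generalize (Rabs_maj2 x); lra. }
    set (L := ln (INR n)).
    assert (HL : 0 <= L) by (unfold L; rewrite <- ln_1; apply ln_le; lra).
    assert (EL : exp L = INR n) by (apply exp_ln; lra).
    assert (Hf := fact_le_stirling n Hn0'); fold S L in Hf.
    assert (Hf0 := INR_fact_lt_0 n).
    assert (Hsq : 0 < sqrt (INR n)) by (apply sqrt_lt_R0; lra).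
    assert (Hsq2 : sqrt (INR n) * sqrt (INR n) = INR n) by (apply sqrt_sqrt; lra).
    assert (H1 := Harc (INR n + 1 + x) L ltac:(lra) HL).
    assert (H2 := Harc (INR n + 1) L ltac:(lra) HL).
    assert (H3 := arc_diff_bound phi x (INR n + 1) L ltac:(lra)).
    rewrite EL in H1, H2, H3.
    assert (H0 := hankel_lim_fact phi n Hp).
    unfold Rpower; fold L.
    set (h1 := hankel_lim phi (INR n + 1 + x)) in *.
    set (h0 := hankel_lim phi (INR n + 1)) in *.
    set (a1 := arc phi (INR n + 1 + x) L) in *.
    set (a0' := arc phi (INR n + 1) L) in *.
    assert (Exp : exp (x * L) * exp (- x * L) = 1)
      by (rewrite <- exp_plus; replace (x * L + - x * L) with 0 by ring; apply exp_0).
    assert (Hpx := exp_pos (x * L)).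
    (* Since [h0 = 1 / n!], the number 1 is written as [n! h0], and the two limits are compared
       through their arcs at the same radius. *)
    replace (INR (fact n) * exp (x * L) * h1 - 1)
      with (INR (fact n) * (exp (x * L) * (h1 - a1) - (h0 - a0') + exp (x * L) * (a1 - exp (- x *
        L) * a0'))).
    2:{ transitivity (INR (fact n) * exp (x * L) * h1 - INR (fact n) * h0
          + INR (fact n) * a0' * (1 - exp (x * L) * exp (- x * L))); [ring|].
        rewrite Exp, H0; field; lra. }
    rewrite Rabs_mult, (Rabs_pos_eq (INR (fact n))) by lra.
    set (E := exp (- (INR n + 1) * L)).
    assert (HE : 0 < E) by apply exp_pos.
    assert (Hdec : exp (cos phi / 2 * INR n) <= exp (INR n)) by (apply exp_le; nra).
    assert (H1' : exp (x * L) * Rabs (h1 - a1) <= E * (K * exp (INR n))).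
    { apply Rle_trans with (exp (x * L) * (exp (- (INR n + 1 + x - 0) * L) * (K * exp (INR n)))).
      - apply Rmult_le_compat_l; [lra|]. eapply Rle_trans; [apply H1|].
        apply Rmult_le_compat_l; [left; apply exp_pos|]. apply Rmult_le_compat_l; lra.
      - right; rewrite <- Rmult_assoc, <- exp_plus; unfold E; do 2 f_equal; ring. }
    assert (H2' : Rabs (h0 - a0') <= E * (K * exp (INR n))).
    { eapply Rle_trans; [apply H2|].
      unfold E; replace (- (INR n + 1 - 0) * L) with (- (INR n + 1) * L) by ring.
      apply Rmult_le_compat_l; [left; apply exp_pos|]. apply Rmult_le_compat_l; lra. }
    assert (H3' : exp (x * L) * Rabs (a1 - exp (- x * L) * a0') <= E * (32 * Rabs x * exp (INR n))).
    { eapply Rle_trans; [apply Rmult_le_compat_l; [lra | apply H3]|].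
      right; unfold E.
      replace (- (INR n + 1) * L) with (- L + - INR n * L) by ring.
      replace (- x * L + INR n + (1 - (INR n + 1)) * L) with (- x * L + INR n + - INR n * L) by
        ring.
      rewrite !exp_plus.
      transitivity (exp (x * L) * exp (- x * L) * (exp (INR n) * exp (- INR n * L) * Rabs x * 32 *
        exp (- L))); [ring|].
      rewrite Exp; ring. }
    apply Rle_trans with (INR (fact n) * (E * exp (INR n) * (2 * K + 32 * Rabs x))).
    { apply Rmult_le_compat_l; [lra|].
      eapply Rle_trans; [apply Rabs_triang|].
      eapply Rle_trans; [apply Rplus_le_compat_r, Rabs_triang|].
      rewrite Rabs_Ropp, !Rabs_mult, (Rabs_pos_eq (exp (x * L))) by lra. lra. }
    (* Stirling's [n^n e^{-n}] meets [e^n n^{-n-1}] and leaves [1/n]; the factor [sqrt n] of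
       Stirling's formula reduces the rate to [n^{-1/2}]. *)
    assert (HEE : exp (INR n * L - INR n) * (E * exp (INR n)) = / INR n).
    { unfold E; rewrite <- !exp_plus. rewrite <- EL at 5. rewrite <- exp_Ropp; f_equal; ring. }
    assert (Hpos : 0 <= E * exp (INR n) * (2 * K + 32 * Rabs x)).
    { generalize (Rabs_pos x), (exp_pos (INR n)); intros.
      apply Rmult_le_pos; [apply Rmult_le_pos; lra | lra]. }
    eapply Rle_trans; [apply Rmult_le_compat_r; [exact Hpos | exact Hf]|].
    right; unfold D.
    transitivity (S * (2 * K + 32 * Rabs x) * (sqrt (INR n) * (exp (INR n * L - INR n) * (E * exp
      (INR n))))); [ring|].
    rewrite HEE; rewrite <- Hsq2 at 2; field; lra.
  - apply is_lim_seq_const.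
  - replace (Finite 0) with (Rbar_mult D 0) by (simpl; f_equal; ring).
    apply is_lim_seq_scal_l.
    apply (is_lim_seq_inv (fun n => sqrt (INR n)) p_infty); [|easy].
    apply is_lim_seq_spec; intros M.
    destruct (nfloor_ex (Rabs M ^ 2) (pow2_ge_0 _)) as [N HN].
    exists (N + 1)%nat; intros n Hn; apply le_INR in Hn; rewrite plus_INR in Hn; simpl in Hn.
    apply Rle_lt_trans with (Rabs M); [apply Rle_abs|].
    rewrite <- (sqrt_Rsqr (Rabs M)) by apply Rabs_pos.
    apply sqrt_lt_1_alt; split; [apply Rle_0_sqr|]. unfold Rsqr; simpl in HN; lra.
Qed.

Lemma hankel_lim_prod phi x n : PI / 2 < phi <= PI ->
  hankel_lim phi x = prod_f_R0 (fun j => x + INR j) n * hankel_lim phi (INR n + 1 + x).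
Proof.
  intros Hp; induction n as [|n IH].
  - simpl; rewrite Rplus_0_r, Rplus_0_l.
    assert (H := hankel_lim_rec phi (1 + x) Hp).
    replace (1 + x - 1) with x in H by ring; exact H.
  - rewrite IH; change (prod_f_R0 (fun j => x + INR j) (S n))
      with (prod_f_R0 (fun j => x + INR j) n * (x + INR (S n))); rewrite S_INR.
    assert (H := hankel_lim_rec phi (INR n + 1 + 1 + x) Hp).
    replace (INR n + 1 + 1 + x - 1) with (INR n + 1 + x) in H by ring.
    rewrite H; ring.
Qed.

(** Iterating the recursion, Gauss' finite product equals [hankel_lim phi x] divided exactly by the
    sequence of [hankel_lim_ratio], which tends to 1. *)
Lemma rgamma_hankel phi x : PI / 2 < phi <= PI -> rgamma x = hankel_lim phi x.
Proof.
  intros Hp; unfold rgamma.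
  set (r := fun n => INR (fact n) * Rpower (INR n) x * hankel_lim phi (INR n + 1 + x)).
  assert (Hr : is_lim_seq r 1) by now apply hankel_lim_ratio.
  assert (H : is_lim_seq (fun n => prod_f_R0 (fun j => x + INR j) n / (INR (fact n) * Rpower (INR
    n) x))
    (hankel_lim phi x)).
  { replace (Finite (hankel_lim phi x)) with (Rbar_mult (hankel_lim phi x) (/ 1))
      by (simpl; f_equal; field).
    apply is_lim_seq_ext_loc with (fun n => hankel_lim phi x * / r n).
    - apply is_lim_seq_spec in Hr.
      destruct (Hr (mkposreal (/ 2) ltac:(lra))) as [N HN].
      exists N; intros n Hn; specialize (HN n Hn); simpl in HN.
      apply Rabs_lt_between in HN.
      rewrite (hankel_lim_prod phi x n Hp).
      assert (Hf := INR_fact_lt_0 n).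
      assert (Hx : 0 < Rpower (INR n) x) by apply exp_pos.
      unfold r in *.
      assert (hankel_lim phi (INR n + 1 + x) <> 0).
      { intros E; rewrite E in HN; lra. }
      field; repeat split; lra.
    - apply is_lim_seq_scal_l.
      apply (is_lim_seq_inv r 1); [easy|]. intros E; injection E; lra. }
  now rewrite (is_lim_seq_unique _ _ H).
Qed.

Lemma PI_itv : PI / 2 < PI <= PI.
Proof. generalize PI_RGT_0; lra. Qed.

Lemma rgamma_rec x : rgamma x = x * rgamma (x + 1).
Proof.
  rewrite !(rgamma_hankel PI) by apply PI_itv.
  assert (H := hankel_lim_rec PI (x + 1) PI_itv).
  replace (x + 1 - 1) with x in H by ring; exact H.
Qed.

Lemma rgamma_fact n : rgamma (INR n + 1) = / INR (fact n).
Proof. rewrite (rgamma_hankel PI) by apply PI_itv. apply hankel_lim_fact, PI_itv. Qed.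

Lemma rgamma_ratio x :
  is_lim_seq (fun n => INR (fact n) * Rpower (INR n) x * rgamma (INR n + 1 + x)) 1.
Proof.
  apply is_lim_seq_ext with (2 := hankel_lim_ratio PI x PI_itv).
  intros n; now rewrite (rgamma_hankel PI) by apply PI_itv.
Qed.

Lemma rgamma_arc phi b : PI / 2 < phi <= PI ->
  exists K, 0 < K /\ forall b' L, b <= b' -> 0 <= L ->
   Rabs (rgamma b' - arc phi b' L)
     <= exp (- (b' - b) * L) * (K * exp (cos phi / 2 * exp L)).
Proof.
  intros Hp; destruct (hankel_lim_arc phi b Hp) as (K & HK & H).
  exists K; split; [easy|]; intros; rewrite (rgamma_hankel phi) by easy; now apply H.
Qed.

Lemma arc_abs_le phi b x : 0 <= phi <= PI ->
  Rabs (arc phi b x) <= exp (exp x + (1 - b) * x).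
Proof.
  intros Hp; unfold arc; assert (Hpi := PI_RGT_0).
  rewrite Rabs_mult, (Rabs_pos_eq (/ _)) by (left; apply PI2_pos).
  assert (He := exp_pos (exp x + (1 - b) * x)).
  apply Rle_trans with (/ (2 * PI) * ((phi - - phi) * exp (exp x + (1 - b) * x))).
  - apply Rmult_le_compat_l; [left; apply PI2_pos|].
    apply abs_RInt_le_const; [lra | apply ex_RInt_hankel; lra|].
    intros t _; eapply Rle_trans; [apply Rabs_fst_le_Cmod|].
    rewrite Cmod_hankel; apply exp_le; generalize (COS_bound t), (exp_pos x); nra.
  - rewrite <- Rmult_assoc; rewrite <- (Rmult_1_l (exp _)) at 2.
    apply Rmult_le_compat_r; [lra|].
    apply Rle_trans with (/ (2 * PI) * (2 * PI)); [|right; field; lra].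
    apply Rmult_le_compat_l; [left; apply PI2_pos | lra].
Qed.

(** Estimating the arc at radius [exp L] trivially gives decay at the rate [L]. As [L] is free, the
    decay in [b'] is faster than any exponential. *)
Lemma rgamma_bound b L : 0 <= L ->
  exists C, 0 < C /\ forall b', b <= b' -> Rabs (rgamma b') <= C * exp (- (b' * L)).
Proof.
  intros HL; destruct (rgamma_arc PI b PI_itv) as (K & HK & H).
  exists (exp (exp L + L) + K * exp (b * L)).
  assert (H1 := exp_pos (exp L + L)); assert (H2 := exp_pos (b * L)).
  split; [nra|].
  intros b' Hb; specialize (H b' L Hb HL).
  assert (Hpi := PI_RGT_0).
  assert (H3 := arc_abs_le PI b' L ltac:(lra)).
  replace (rgamma b') with ((rgamma b' - arc PI b' L) + arc PI b' L) by ring.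
  eapply Rle_trans; [apply Rabs_triang|].
  rewrite Rmult_plus_distr_r, Rplus_comm; apply Rplus_le_compat.
  - eapply Rle_trans; [apply H3|]; rewrite <- exp_plus; apply exp_le; right; ring.
  - eapply Rle_trans; [apply H|].
    replace (K * exp (b * L) * exp (- (b' * L))) with (exp (- (b' - b) * L) * (K * 1)).
    + apply Rmult_le_compat_l; [left; apply exp_pos|].
      apply Rmult_le_compat_l; [lra|]. rewrite <- exp_0; apply exp_le.
      rewrite cos_PI; generalize (exp_pos L); lra.
    + replace (- (b' - b) * L) with (b * L + - (b' * L)) by ring; rewrite exp_plus; ring.
Qed.

Lemma exp_INR_mult (k : nat) (x : R) : exp (INR k * x) = exp x ^ k.
Proof.
  induction k as [|k IH]; [simpl; rewrite Rmult_0_l; apply exp_0|].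
  rewrite S_INR; simpl; rewrite <- IH, <- exp_plus; f_equal; ring.
Qed.

Definition entire (c : nat -> R) : Prop := forall t, 0 <= t -> ex_series (fun k => Rabs (c k) * t ^
  k).

Lemma ex_series_half_pow (C : R) (u : nat -> R) :
  (forall k, Rabs (u k) <= C * (/ 2) ^ k) -> ex_series u.
Proof.
  intros H.
  apply (ex_series_le (K := R_AbsRing) (V := R_CompleteNormedModule) u (fun k => C * (/ 2) ^ k));
    [exact H|].
  apply (ex_series_scal (V := R_NormedModule) C (fun k => (/ 2) ^ k)).
  apply ex_series_geom; rewrite Rabs_pos_eq; lra.
Qed.

Lemma entire_rgamma a b : 0 < a -> entire (fun k => rgamma (a * INR k + b)).
Proof.
  intros Ha t Ht.
  (* This makes [exp (a L) >= 2 t + 1], so consecutive terms of the majorant have ratio at most 1/2;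
     the maximum with 0 meets the hypothesis of [rgamma_bound]. *)
  set (L := Rmax 0 (ln (2 * t + 1) / a)).
  assert (HL : 0 <= L) by apply Rmax_l.
  assert (HL2 : ln (2 * t + 1) / a <= L) by apply Rmax_r.
  destruct (rgamma_bound b L HL) as (C & HC & H).
  apply ex_series_half_pow with (C * exp (- (b * L))).
  intros k; assert (Hk := pos_INR k).
  rewrite Rabs_mult, Rabs_Rabsolu, (Rabs_pos_eq (t ^ k)) by now apply pow_le.
  specialize (H (a * INR k + b) ltac:(nra)).
  apply Rle_trans with (C * exp (- ((a * INR k + b) * L)) * t ^ k).
  { apply Rmult_le_compat_r; [now apply pow_le | easy]. }
  replace (- ((a * INR k + b) * L)) with (- (b * L) + INR k * - (a * L)) by ring.
  rewrite exp_plus, Rmult_assoc, Rmult_assoc, (Rmult_assoc C).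
  apply Rmult_le_compat_l; [lra|]. apply Rmult_le_compat_l; [left; apply exp_pos|].
  rewrite exp_INR_mult, <- Rpow_mult_distr.
  apply pow_incr; split; [apply Rmult_le_pos; [left; apply exp_pos | easy]|].
  assert (H1 : ln (2 * t + 1) <= a * L).
  { replace (ln (2 * t + 1)) with (a * (ln (2 * t + 1) / a)) by (field; lra).
    apply Rmult_le_compat_l; lra. }
  apply exp_le in H1; rewrite exp_ln in H1 by lra.
  assert (He := exp_pos (a * L)).
  rewrite exp_Ropp; apply (Rmult_le_reg_l (exp (a * L))); [easy|].
  rewrite <- Rmult_assoc, Rinv_r by lra; lra.
Qed.

(** * The Mittag-Leffler kernel *)

Section Modulus.

Variables u s : R.
Let w := (1 - cexp (u, s))%C.

Lemma Cmod2_one_minus_cexp : Cmod w ^ 2 = 1 - 2 * exp u * cos s + exp u ^ 2.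
Proof.
  unfold w; rewrite Cmod2_alt; simpl.
  assert (H := sin2_cos2 s); unfold Rsqr in H.
  replace (exp u * (exp u * 1)) with (exp u * exp u * (sin s * sin s + cos s * cos s))
    by (rewrite H; ring). ring.
Qed.

Lemma Cmod_ge (r : R) : r ^ 2 <= Cmod w ^ 2 -> r <= Cmod w.
Proof.
  intros H; destruct (Rle_lt_dec r 0) as [Hr|Hr]; [generalize (Cmod_ge_0 w); lra|].
  apply Rsqr_incr_0_var; [unfold Rsqr; simpl in H; lra | apply Cmod_ge_0].
Qed.

(** Outside the cone around the positive axis, [1 - q] is bounded below both absolutely and relative
    to [|q|]. The relative bound supplies the decay of the kernel where [|q|] is large. *)
Lemma one_minus_cexp_sector (kap : R) : 0 <= kap < 1 -> cos s <= kap ->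
  1 - kap <= Cmod w /\ (1 - kap) * exp u <= Cmod w.
Proof.
  intros Hk Hs; assert (He := exp_pos u).
  assert (Hsk : exp u * cos s <= exp u * kap) by (apply Rmult_le_compat_l; lra).
  assert (Hkk : kap * kap <= kap) by nra.
  split; apply Cmod_ge; rewrite Cmod2_one_minus_cexp.
  - assert (H := pow2_ge_0 (exp u - kap)); simpl in *; lra.
  - assert (H := pow2_ge_0 (1 - kap * exp u)).
    assert (H2 : (kap * kap) * (exp u * exp u) <= kap * (exp u * exp u))
      by (apply Rmult_le_compat_r; nra).
    simpl in *; lra.
Qed.

Lemma one_minus_cexp_radius : Rabs (1 - exp u) <= Cmod w.
Proof.
  apply Cmod_ge; rewrite pow2_abs, Cmod2_one_minus_cexp.
  generalize (COS_bound s), (exp_pos u); simpl; nra.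
Qed.

End Modulus.

(** This is [z w^{-nu}] for [z = exp (nu (x0 + i y0))] and [w = exp (x + i y)], so the pole
    [w0 = z^{1/nu}] of the kernel sits at [(x0, y0)]. *)
Definition ratio (nu x0 y0 x y : R) : C := cexp (- nu * (x - x0), - nu * (y - y0)).

Definition kernel (nu x0 y0 x y : R) : C := (/ (1 - ratio nu x0 y0 x y))%C.

(** The derivative is left existential but is the same function at all points; Cauchy's theorem uses
    only its existence and continuity. *)
Lemma hol_kernel nu x0 y0 : exists f', forall x y, (1 - ratio nu x0 y0 x y)%C <> 0%C ->
  hol (kernel nu x0 y0) f' x y.
Proof.
  eexists; intros x y Hn.
  apply hol_ext with (f := fun s t => (/ (1 + RtoC (- 1) *
     cexp (RtoC (- nu) * ((s, t) + (- x0, - y0)%R))))%C).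
  { intros s t; unfold kernel, ratio; f_equal.
    replace (RtoC (- nu) * ((s, t) + ((- x0)%R, (- y0)%R)))%C
      with ((- nu * (s - x0))%R, (- nu * (t - y0))%R)
      by (apply injective_projections; simpl; ring).
    apply injective_projections; simpl; ring. }
  eapply hol_inv.
  - apply hol_plus; [apply hol_const|].
    apply hol_mult; [apply hol_const|].
    apply hol_cexp, hol_mult; [apply hol_const|].
    apply hol_plus; [apply hol_id | apply hol_const].
  - intros E; apply Hn; rewrite <- E; unfold ratio.
    replace (RtoC (- nu) * ((x, y) + ((- x0)%R, (- y0)%R)))%C
      with ((- nu * (x - x0))%R, (- nu * (y - y0))%R)
      by (apply injective_projections; simpl; ring).
    apply injective_projections; simpl; ring.
Qed.

(** A constant factor of modulus 1. The kernel subtracted at the common pole needs it to carry the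
    argument of [w0^{1-b}]. *)
Definition phase (psi : R) : C := cexp (0, psi).

Lemma Cmod_phase psi : Cmod (phase psi) = 1.
Proof. unfold phase; rewrite Cmod_cexp; apply exp_0. Qed.

Definition integrand (psi nu b x0 y0 x y : R) : C :=
  (phase psi * hankel b x y * kernel nu x0 y0 x y)%C.

Lemma hol_integrand psi nu b x0 y0 : exists f', forall x y,
  (1 - ratio nu x0 y0 x y)%C <> 0%C -> hol (integrand psi nu b x0 y0) f' x y.
Proof.
  destruct (hol_kernel nu x0 y0) as [k' Hk].
  eexists; intros x y Hn.
  apply hol_mult; [apply hol_mult; [apply hol_const | apply hol_hankel] | now apply Hk].
Qed.

Lemma is_RInt_hankel_im b x phi : 0 <= phi ->
  is_RInt (fun y => snd (hankel b x y)) (- phi) phi 0.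
Proof.
  intros Hp.
  assert (Hex : ex_RInt (fun y => snd (hankel b x y)) (- phi) phi).
  { apply (ex_RInt_2d (fun x y => snd (hankel b x y))); [lra|].
    intros y _; apply (hol_cv _ _ _ _ (hol_hankel b x y)). }
  destruct Hex as [l Hl].
  assert (Hl2 : is_RInt (fun y => snd (hankel b x y)) phi (- phi) l).
  { apply is_RInt_ext with (fun y => opp (snd (hankel b x (- y)))).
    - intros y _; unfold hankel, cexp, opp; simpl.
      rewrite cos_neg, sin_neg.
      replace (exp x * - sin y + ((1 - b) * - y + 0 * x)) with (- (exp x * sin y + ((1 - b) * y + 0
        * x))) by ring.
      rewrite sin_neg; replace (0 * - y) with (0 * y) by ring; ring.
    - apply (is_RInt_comp_opp (fun y => snd (hankel b x y))).
      now rewrite Ropp_involutive. }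
  assert (E : l = opp l).
  { assert (H1 := is_RInt_unique (V := R_CompleteNormedModule) _ _ _ _ (is_RInt_swap _ _ _ _ Hl2)).
    assert (H2 := is_RInt_unique (V := R_CompleteNormedModule) _ _ _ _ Hl).
    congruence. }
  unfold opp in E; simpl in E.
  now replace 0 with l by lra.
Qed.

Lemma is_RInt_arc b x phi : 0 <= phi ->
  is_RInt (fun y => fst (hankel b x y)) (- phi) phi (2 * PI * arc phi b x).
Proof.
  intros Hp; unfold arc; assert (Hpi := PI_RGT_0).
  rewrite <- Rmult_assoc, Rinv_r, Rmult_1_l by lra.
  apply (RInt_correct (V := R_CompleteNormedModule)), ex_RInt_hankel; lra.
Qed.

Definition arc_kernel (phi psi nu b x0 y0 x : R) : R :=
  / (2 * PI) * RInt (fun y => fst (integrand psi nu b x0 y0 x y)) (- phi) phi.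

(** The [k]-th term of the geometric series of the kernel is again a Hankel integrand, for
    [b + nu k], times the constant [e^{i psi} z^k]. This is the interchange behind Hankel summation,
    term by term. *)
Lemma hankel_ratio (psi nu b x0 y0 x y : R) (k : nat) :
  (cexp ((nu * INR k * x0)%R, (nu * INR k * y0 + psi)%R) * hankel (b + nu * INR k)%R x y
    = phase psi * hankel b x y * ratio nu x0 y0 x y ^ k)%C.
Proof.
  induction k as [|k IH].
  - simpl; rewrite !Rmult_0_r, !Rmult_0_l, Rplus_0_l, Rplus_0_r; unfold phase; ring.
  - rewrite S_INR.
    replace (b + nu * (INR k + 1)) with (b + nu * INR k - - nu) by ring.
    rewrite hankel_shift.
    replace (cexp ((nu * (INR k + 1) * x0)%R, (nu * (INR k + 1) * y0 + psi)%R)) with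
      (cexp ((nu * INR k * x0)%R, (nu * INR k * y0 + psi)%R) * cexp ((nu * x0)%R, (nu * y0)%R))%C
      by (rewrite <- cexp_plus; f_equal; apply injective_projections; simpl; ring).
    change (ratio nu x0 y0 x y ^ S k)%C with (ratio nu x0 y0 x y * ratio nu x0 y0 x y ^ k)%C.
    replace (ratio nu x0 y0 x y) with (cexp ((nu * x0)%R, (nu * y0)%R) * cexp ((- nu * x)%R, (- nu
      * y)%R))%C at 1
      by (unfold ratio; rewrite <- cexp_plus; f_equal; apply injective_projections; simpl; ring).
    set (A := cexp ((nu * x0)%R, (nu * y0)%R)) in *.
    set (B := cexp ((- nu * x)%R, (- nu * y)%R)) in *.
    set (D := cexp ((nu * INR k * x0)%R, (nu * INR k * y0 + psi)%R)) in *.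
    transitivity (A * B * (D * hankel (b + nu * INR k)%R x y))%C; [ring|].
    rewrite IH; ring.
Qed.

Lemma is_RInt_term phi psi nu b x0 y0 x k : 0 <= phi ->
  is_RInt (fun y => fst (phase psi * hankel b x y * ratio nu x0 y0 x y ^ k)%C) (- phi) phi
    (2 * PI * (exp (nu * INR k * x0) * cos (nu * INR k * y0 + psi) * arc phi (b + nu * INR k) x)).
Proof.
  intros Hp.
  set (e := exp (nu * INR k * x0)); set (th := nu * INR k * y0 + psi).
  replace (2 * PI * (e * cos th * arc phi (b + nu * INR k) x)) with
   (minus (scal (e * cos th) (2 * PI * arc phi (b + nu * INR k) x)) (scal (e * sin th) 0))
   by (unfold minus, plus, opp, scal; simpl; unfold mult; simpl; ring).
  apply is_RInt_ext with (fun y => minus (scal (e * cos th) (fst (hankel (b + nu * INR k) x y)))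
     (scal (e * sin th) (snd (hankel (b + nu * INR k) x y)))).
  - intros y _; rewrite <- hankel_ratio; fold th.
    unfold cexp; simpl; fold e; unfold minus, plus, opp, scal; simpl; unfold mult; simpl; ring.
  - apply (is_RInt_minus (V := R_NormedModule)); apply (is_RInt_scal (V := R_NormedModule)).
    + now apply is_RInt_arc.
    + now apply is_RInt_hankel_im.
Qed.

Lemma kernel_remainder psi nu b x0 y0 x y n : (1 - ratio nu x0 y0 x y)%C <> 0%C ->
  fst (integrand psi nu b x0 y0 x y)
   - sum_n (fun k => fst (phase psi * hankel b x y * ratio nu x0 y0 x y ^ k)%C) n
  = fst (phase psi * hankel b x y * (ratio nu x0 y0 x y ^ S n * kernel nu x0 y0 x y))%C.
Proof.
  intros Hn; unfold integrand.
  set (q := ratio nu x0 y0 x y) in *; set (h := (phase psi * hankel b x y)%C).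
  set (g := kernel nu x0 y0 x y).
  assert (Hg : (g = 1 + q * g)%C).
  { unfold g, kernel; fold q; field; exact Hn. }
  induction n as [|n IH].
  - rewrite sum_O.
    replace (h * (q ^ 1 * g))%C with (h * g - h * q ^ 0)%C; [simpl; ring|].
    rewrite Hg at 1; simpl; ring.
  - rewrite sum_Sn; unfold plus; simpl plus.
    transitivity (fst (h * (q ^ S n * g))%C - fst (h * q ^ S n)%C).
    + rewrite <- IH; simpl; ring.
    + replace (h * (q ^ S (S n) * g))%C with (h * (q ^ S n * g) - h * q ^ S n)%C; [simpl; ring|].
      rewrite Hg at 1; simpl; ring.
Qed.

Lemma Cmod_neq0 (z : C) : 0 < Cmod z -> z <> 0%C.
Proof. intros H E; rewrite E, Cmod_0 in H; lra. Qed.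

Lemma Cmod_kernel_le nu x0 y0 x y r : 0 < r -> r <= Cmod (1 - ratio nu x0 y0 x y)%C ->
  (1 - ratio nu x0 y0 x y)%C <> 0%C /\ Cmod (kernel nu x0 y0 x y) <= / r.
Proof.
  intros Hr H.
  assert (Hn : (1 - ratio nu x0 y0 x y)%C <> 0%C) by (apply Cmod_neq0; lra).
  split; [easy|]; unfold kernel; rewrite Cmod_inv by easy.
  now apply Rinv_le_contravar.
Qed.

Lemma Cmod_ratio nu x0 y0 x y : Cmod (ratio nu x0 y0 x y) = exp (- nu * (x - x0)).
Proof. unfold ratio; now rewrite Cmod_cexp. Qed.

Lemma exp_m1_le_half : exp (- 1) <= / 2.
Proof.
  assert (H := exp_ineq1_le 1); replace (exp (- 1)) with (/ exp 1) by (rewrite <- exp_Ropp;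
    f_equal; ring).
  apply Rinv_le_contravar; lra.
Qed.

Lemma kernel_far nu x0 y0 x y : 1 <= nu * (x - x0) ->
  (1 - ratio nu x0 y0 x y)%C <> 0%C /\ Cmod (kernel nu x0 y0 x y) <= 2.
Proof.
  intros H.
  assert (He : exp (- nu * (x - x0)) <= / 2).
  { eapply Rle_trans; [|apply exp_m1_le_half]; apply exp_le; lra. }
  replace 2 with (/ / 2) by field; apply Cmod_kernel_le; [lra|].
  eapply Rle_trans; [|apply one_minus_cexp_radius].
  rewrite Rabs_pos_eq; lra.
Qed.

Lemma ex_RInt_integrand psi nu b x0 y0 x y1 y2 : y1 <= y2 ->
  (forall y, y1 <= y <= y2 -> (1 - ratio nu x0 y0 x y)%C <> 0%C) ->
  ex_RInt (fun y => fst (integrand psi nu b x0 y0 x y)) y1 y2.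
Proof.
  intros Hy Hn; destruct (hol_integrand psi nu b x0 y0) as [f' Hf].
  apply (ex_RInt_2d (fun x y => fst (integrand psi nu b x0 y0 x y))); [easy|].
  intros y Hyy; apply (hol_cu _ _ _ _ (Hf x y (Hn y Hyy))).
Qed.

Lemma is_RInt_sum_n (F : nat -> R -> R) (l : nat -> R) (a b : R) n :
  (forall k, is_RInt (F k) a b (l k)) ->
  is_RInt (fun y => sum_n (fun k => F k y) n) a b (sum_n l n).
Proof.
  intros H; induction n as [|n IH].
  - apply is_RInt_ext with (F 0%nat); [intros; now rewrite sum_O | rewrite sum_O; apply H].
  - rewrite sum_Sn.
    apply is_RInt_ext with (fun y => plus (sum_n (fun k => F k y) n) (F (S n) y)).
    + intros; now rewrite sum_Sn.
    + apply (is_RInt_plus (V := R_NormedModule)); auto.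
Qed.

Lemma is_RInt_abs_le_const (f : R -> R) (a b M l : R) : a <= b -> is_RInt f a b l ->
  (forall y, a <= y <= b -> Rabs (f y) <= M) -> Rabs l <= (b - a) * M.
Proof.
  intros Hab Hl Hf.
  rewrite <- (is_RInt_unique (V := R_CompleteNormedModule) _ _ _ _ Hl).
  apply abs_RInt_le_const; [easy | now exists l | easy].
Qed.

(** On an arc this far out [|ratio| <= exp (- 1) <= 1/2], so the geometric series converges
    uniformly in [y] and may be integrated termwise. *)
Lemma arc_kernel_series phi psi nu b x0 y0 L : 0 < nu -> 0 <= phi <= PI -> 1 <= nu * (L - x0) ->
  is_series (fun k => exp (nu * INR k * x0) * cos (nu * INR k * y0 + psi) * arc phi (b + nu * INR
    k) L)
    (arc_kernel phi psi nu b x0 y0 L).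
Proof.
  intros Hnu Hphi HL; assert (Hpi := PI_RGT_0).
  set (u := fun k => exp (nu * INR k * x0) * cos (nu * INR k * y0 + psi) * arc phi (b + nu * INR k)
    L).
  set (E := exp (exp L + (1 - b) * L)).
  assert (HE : 0 < E) by apply exp_pos.
  assert (Hex := ex_RInt_integrand psi nu b x0 y0 L (- phi) phi ltac:(lra)
    (fun y _ => proj1 (kernel_far nu x0 y0 L y HL))).
  assert (Hrem : forall n, Rabs (arc_kernel phi psi nu b x0 y0 L - sum_n u n) <= E * (/ 2) ^ n).
  { intros n.
    assert (Hs := is_RInt_sum_n (fun k y => fst (phase psi * hankel b L y * ratio nu x0 y0 L y ^
      k)%C)
      (fun k => 2 * PI * u k) (- phi) phi n (fun k => is_RInt_term phi psi nu b x0 y0 L k (proj1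
        Hphi))).
    assert (Hi := RInt_correct (V := R_CompleteNormedModule) _ _ _ Hex).
    assert (Hd := is_RInt_minus (V := R_NormedModule) _ _ _ _ _ _ Hi Hs).
    apply (is_RInt_ext (V := R_NormedModule) _ (fun y => fst (phase psi * hankel b L y *
      (ratio nu x0 y0 L y ^ S n * kernel nu x0 y0 L y))%C)) in Hd.
    2:{ intros y _; apply kernel_remainder, kernel_far, HL. }
    set (I := RInt (fun y => fst (integrand psi nu b x0 y0 L y)) (- phi) phi) in *.
    assert (Hb : Rabs (I - sum_n (fun k => 2 * PI * u k) n) <= (phi - - phi) * (E * (/ 2) ^ n)).
    { apply (is_RInt_abs_le_const _ (- phi) phi _ _ ltac:(lra) Hd).
      intros y _; eapply Rle_trans; [apply Rabs_fst_le_Cmod|].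
      rewrite !Cmod_mult, Cmod_phase, Rmult_1_l, Cmod_hankel.
      assert (Hq : Cmod (ratio nu x0 y0 L y ^ S n) <= (/ 2) ^ S n).
      { rewrite Cmod_pow, Cmod_ratio; apply pow_incr; split; [left; apply exp_pos|].
        eapply Rle_trans; [|apply exp_m1_le_half]; apply exp_le; lra. }
      assert (Hk := proj2 (kernel_far nu x0 y0 L y HL)).
      apply Rmult_le_compat.
      - left; apply exp_pos.
      - apply Rmult_le_pos; apply Cmod_ge_0.
      - apply exp_le; generalize (COS_bound y), (exp_pos L); nra.
      - apply Rle_trans with ((/ 2) ^ S n * 2); [|simpl; lra].
        apply Rmult_le_compat; auto; apply Cmod_ge_0. }
    replace (sum_n (fun k => 2 * PI * u k) n) with (2 * PI * sum_n u n) in Hb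
      by (symmetry; apply (sum_n_mult_l (K := R_AbsRing))).
    unfold arc_kernel; fold I.
    replace (/ (2 * PI) * I - sum_n u n) with (/ (2 * PI) * (I - 2 * PI * sum_n u n)).
    2:{ unfold Rminus; rewrite Rmult_plus_distr_l; f_equal.
        generalize (sum_n u n); intros s; change (s : R) with (s : R); field; lra. }
    rewrite Rabs_mult, (Rabs_pos_eq (/ _)) by (left; apply PI2_pos).
    assert (0 < (/ 2) ^ n) by (apply pow_lt; lra).
    apply Rle_trans with (/ (2 * PI) * (2 * PI * (E * (/ 2) ^ n))); [|right; field; lra].
    apply Rmult_le_compat_l; [left; apply PI2_pos|].
    eapply Rle_trans; [exact Hb|]. apply Rmult_le_compat_r; [nra|lra]. }
  cut (is_lim_seq (sum_n u) (arc_kernel phi psi nu b x0 y0 L)); [easy|].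
  apply is_lim_seq_ext with (fun n => arc_kernel phi psi nu b x0 y0 L - (arc_kernel phi psi nu b x0
    y0 L - sum_n u n)).
  { intros; ring. }
  replace (Finite (arc_kernel phi psi nu b x0 y0 L)) with (Finite (arc_kernel phi psi nu b x0 y0 L
    - 0))
    by (f_equal; ring).
  apply is_lim_seq_minus'; [apply is_lim_seq_const|].
  apply is_lim_seq_abs_0, is_lim_seq_le_le with (fun _ => 0) (fun n => E * (/ 2) ^ n).
  - intros n; split; [apply Rabs_pos | apply Hrem].
  - apply is_lim_seq_const.
  - replace (Finite 0) with (Rbar_mult E 0) by (simpl; f_equal; ring).
    apply is_lim_seq_scal_l, is_lim_seq_geom; rewrite Rabs_pos_eq; lra.
Qed.

(** Real part of [e^{i psi} z^k / Gamma (b + nu k)] with [z = exp (nu (x0 + i y0))]. *)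
Definition ml_term (psi nu b x0 y0 : R) (k : nat) : R :=
  exp (nu * INR k * x0) * cos (nu * INR k * y0 + psi) * rgamma (b + nu * INR k).

Lemma ex_series_ml psi nu b x0 y0 : 0 < nu -> ex_series (ml_term psi nu b x0 y0).
Proof.
  intros Hnu.
  apply (ex_series_le (K := R_AbsRing) (V := R_CompleteNormedModule) _
    (fun k => Rabs (rgamma (nu * INR k + b)) * exp (nu * x0) ^ k)).
  - intros k; unfold ml_term; change norm with Rabs; simpl.
    rewrite !Rabs_mult, (Rabs_pos_eq (exp _)) by (left; apply exp_pos).
    replace (nu * INR k * x0) with (INR k * (nu * x0)) by ring.
    rewrite exp_INR_mult, Rplus_comm, (Rplus_comm b).
    rewrite Rmult_comm; apply Rmult_le_compat_l; [apply Rabs_pos|].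
    rewrite <- (Rmult_1_r (exp _ ^ k)) at 2.
    apply Rmult_le_compat_l; [left; apply pow_lt, exp_pos|].
    apply Rabs_le, COS_bound.
  - apply entire_rgamma; [easy | left; apply exp_pos].
Qed.

(** Replacing each arc by [1 / Gamma (b + nu k)] costs a common doubly exponentially small factor
    times [exp (- nu k (L - x0))], a convergent geometric series once [L >= x0 + 1 / nu]. *)
Lemma is_lim_arc_kernel phi psi nu b x0 y0 : 0 < nu -> PI / 2 < phi <= PI ->
  is_lim (arc_kernel phi psi nu b x0 y0) p_infty (Series (ml_term psi nu b x0 y0)).
Proof.
  intros Hnu Hphi; assert (Hc := cos_neg_of phi Hphi); assert (Hpi := PI_RGT_0).
  destruct (rgamma_arc phi b Hphi) as (K & HK & Harc).
  set (l := Series (ml_term psi nu b x0 y0)).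
  cut (is_lim (fun L => l - arc_kernel phi psi nu b x0 y0 L) p_infty 0).
  { intros H.
    apply is_lim_ext with (fun L => l - (l - arc_kernel phi psi nu b x0 y0 L)); [intros; ring|].
    replace (Finite l) with (Finite (l - 0)) by (f_equal; ring).
    apply is_lim_minus'; [apply is_lim_const | easy]. }
  apply is_lim_squeeze0 with (fun L => 2 * K * exp (- (- cos phi / 2) * exp L)); [apply
    is_lim_exp_exp; lra|].
  exists (Rmax 0 (x0 + / nu)); intros L HL.
  generalize (Rmax_l 0 (x0 + / nu)), (Rmax_r 0 (x0 + / nu)); intros Hm1 Hm2.
  assert (HL1 : 1 <= nu * (L - x0)).
  { rewrite <- (Rinv_r nu) by lra. apply Rmult_le_compat_l; lra. }
  assert (Hs := arc_kernel_series phi psi nu b x0 y0 L Hnu ltac:(lra) HL1).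
  set (v := fun k => exp (nu * INR k * x0) * cos (nu * INR k * y0 + psi) * arc phi (b + nu * INR k)
    L) in *.
  rewrite <- (is_series_unique _ _ Hs); unfold l.
  rewrite <- Series_minus; [|now apply ex_series_ml | eexists; exact Hs].
  set (eps := K * exp (cos phi / 2 * exp L)).
  assert (He : 0 < eps) by (apply Rmult_lt_0_compat; [easy | apply exp_pos]).
  assert (Hterm : forall k, Rabs (ml_term psi nu b x0 y0 k - v k) <= eps * (/ 2) ^ k).
  { intros k; unfold ml_term, v; assert (Hk := pos_INR k).
    rewrite <- Rmult_minus_distr_l, !Rabs_mult, (Rabs_pos_eq (exp _)) by (left; apply exp_pos).
    assert (H := Harc (b + nu * INR k) L ltac:(nra) ltac:(lra)); fold eps in H.
    apply Rle_trans with (exp (nu * INR k * x0) * 1 * (exp (- (b + nu * INR k - b) * L) * eps)).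
    - apply Rmult_le_compat; [|apply Rabs_pos| |easy].
      + apply Rmult_le_pos; [left; apply exp_pos | apply Rabs_pos].
      + apply Rmult_le_compat_l; [left; apply exp_pos | apply Rabs_le, COS_bound].
    - rewrite Rmult_1_r, <- Rmult_assoc, <- exp_plus, Rmult_comm.
      apply Rmult_le_compat_l; [lra|].
      replace (nu * INR k * x0 + - (b + nu * INR k - b) * L) with (INR k * - (nu * (L - x0))) by
        ring.
      rewrite exp_INR_mult; apply pow_incr; split; [left; apply exp_pos|].
      eapply Rle_trans; [|apply exp_m1_le_half]; apply exp_le; lra. }
  assert (Hg : is_series (fun k => eps * (/ 2) ^ k) (2 * eps)).
  { replace (2 * eps) with (scal eps (/ (1 - / 2))) by (unfold scal; simpl; unfold mult; simpl;
    field).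
    apply (is_series_scal (V := R_NormedModule) eps (fun k => (/ 2) ^ k)).
    apply is_series_geom; rewrite Rabs_pos_eq; lra. }
  apply Rle_trans with (2 * eps); [|unfold eps; right; replace (- (- cos phi / 2)) with (cos phi /
    2) by field; ring].
  rewrite <- (is_series_unique _ _ Hg).
  eapply Rle_trans; [apply Series_Rabs|].
  - apply (ex_series_le (K := R_AbsRing) (V := R_CompleteNormedModule) _ (fun k => eps * (/ 2) ^
    k)); [|eexists; exact Hg].
    intros k; change norm with Rabs; simpl. rewrite Rabs_Rabsolu; apply Hterm.
  - apply Series_le; [|eexists; exact Hg].
    intros k; split; [apply Rabs_pos | apply Hterm].
Qed.

(** * Mittag-Leffler sums outside and inside the exponential sector *)

Lemma cos_le_sector (d s : R) : 0 < d <= PI -> d <= s <= 2 * PI - d -> cos s <= cos d.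
Proof.
  intros Hd Hs.
  destruct (Rle_lt_dec s PI) as [H|H].
  - destruct (Req_dec s d) as [->|Hn]; [lra|].
    left; apply cos_decreasing_1; lra.
  - replace (cos s) with (cos (2 * PI - s))
      by (rewrite cos_minus, cos_2PI, sin_2PI; ring).
    destruct (Req_dec (2 * PI - s) d) as [->|Hn]; [lra|].
    left; apply cos_decreasing_1; lra.
Qed.

Lemma kernel_sector nu x0 y0 x y kap : 0 <= kap < 1 -> cos (nu * (y0 - y)) <= kap ->
  (1 - ratio nu x0 y0 x y)%C <> 0%C /\ Cmod (kernel nu x0 y0 x y) <= / (1 - kap) /\
  Cmod (kernel nu x0 y0 x y) <= / (1 - kap) * exp (nu * (x - x0)).
Proof.
  intros Hk Hc.
  destruct (one_minus_cexp_sector (- nu * (x - x0)) (- nu * (y - y0)) kap Hk) as [H1 H2].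
  { now replace (- nu * (y - y0)) with (nu * (y0 - y)) by ring. }
  destruct (Cmod_kernel_le nu x0 y0 x y (1 - kap) ltac:(lra) H1) as [Hn Hb].
  split; [easy | split; [easy|]].
  assert (He := exp_pos (- nu * (x - x0))).
  destruct (Cmod_kernel_le nu x0 y0 x y ((1 - kap) * exp (- nu * (x - x0)))) as [_ Hb2];
    [apply Rmult_lt_0_compat; lra | easy|].
  rewrite Rinv_mult in Hb2; rewrite <- exp_Ropp in Hb2.
  now replace (- (- nu * (x - x0))) with (nu * (x - x0)) in Hb2 by ring.
Qed.

Lemma Cmod_integrand psi nu b x0 y0 x y :
  Cmod (integrand psi nu b x0 y0 x y)
   = exp (exp x * cos y + (1 - b) * x) * Cmod (kernel nu x0 y0 x y).
Proof. unfold integrand; now rewrite !Cmod_mult, Cmod_phase, Rmult_1_l, Cmod_hankel. Qed.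

Lemma is_derive_arc_kernel phi psi nu b x0 y0 x (d : posreal) : 0 <= phi ->
  locally x (fun x => forall y, - phi - d <= y <= phi + d -> (1 - ratio nu x0 y0 x y)%C <> 0%C) ->
  is_derive (arc_kernel phi psi nu b x0 y0) x
    (/ (2 * PI) * (snd (integrand psi nu b x0 y0 x phi) - snd (integrand psi nu b x0 y0 x (-
      phi)))).
Proof.
  intros Hp H; destruct (hol_integrand psi nu b x0 y0) as [f' Hf]; unfold arc_kernel.
  apply (is_derive_scal (fun x => RInt (fun y => fst (integrand psi nu b x0 y0 x y)) (- phi) phi)).
  apply cauchy_vertical with (f' := f') (d := d); [lra|].
  revert H; apply filter_imp; intros s Hs y Hy; apply Hf, Hs, Hy.
Qed.

Lemma arc_kernel_abs_le phi psi nu b x0 y0 x r : 0 <= phi <= PI ->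
  (forall y, - phi <= y <= phi ->
     (1 - ratio nu x0 y0 x y)%C <> 0%C /\ Cmod (kernel nu x0 y0 x y) <= r) ->
  Rabs (arc_kernel phi psi nu b x0 y0 x) <= exp (exp x + (1 - b) * x) * r.
Proof.
  intros Hp Hr; assert (Hpi := PI_RGT_0); unfold arc_kernel.
  assert (Hr0 : 0 <= r).
  { eapply Rle_trans; [apply Cmod_ge_0 | apply (Hr 0); lra]. }
  rewrite Rabs_mult, (Rabs_pos_eq (/ _)) by (left; apply PI2_pos).
  assert (He := exp_pos (exp x + (1 - b) * x)).
  apply Rle_trans with (/ (2 * PI) * ((phi - - phi) * (exp (exp x + (1 - b) * x) * r))).
  - apply Rmult_le_compat_l; [left; apply PI2_pos|].
    apply abs_RInt_le_const; [lra | apply ex_RInt_integrand; [lra | intros; now apply Hr]|].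
    intros t Ht; eapply Rle_trans; [apply Rabs_fst_le_Cmod|].
    rewrite Cmod_integrand; apply Rmult_le_compat; [left; apply exp_pos | apply Cmod_ge_0 | | now
      apply Hr].
    apply exp_le; generalize (COS_bound t), (exp_pos x); nra.
  - rewrite <- Rmult_assoc; rewrite <- (Rmult_1_l (exp _ * r)) at 2.
    apply Rmult_le_compat_r; [nra|].
    apply Rle_trans with (/ (2 * PI) * (2 * PI)); [|right; field; lra].
    apply Rmult_le_compat_l; [left; apply PI2_pos | lra].
Qed.

Lemma Rabs_ends_le (u v B : R) : Rabs u <= B -> Rabs v <= B -> Rabs (/ (2 * PI) * (u - v)) <= B.
Proof.
  intros Hu Hv; rewrite Rabs_mult, (Rabs_pos_eq (/ _)) by (left; apply PI2_pos).
  assert (H : Rabs (u - v) <= 2 * B)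
    by (eapply Rle_trans; [apply Rabs_triang|]; rewrite Rabs_Ropp; lra).
  assert (HB : 0 <= B) by (generalize (Rabs_pos u); lra).
  generalize inv_2PI_le_1, PI2_pos; nra.
Qed.

(** An opening [phi] strictly between [PI / 2] and [min (y0, PI)] leaves the pole outside the sector
    while the end values still decay, so the arc shrinks to radius 1 without crossing anything. The
    kernel is bounded on the sector uniformly in [x0]. *)
Lemma ml_bounded psi nu b y0 : 0 < nu < 1 -> PI / 2 < y0 <= PI / nu ->
  exists C, forall x0, Rabs (Series (ml_term psi nu b x0 y0)) <= C.
Proof.
  intros Hnu Hy0; assert (Hpi := PI_RGT_0).
  set (m := Rmin y0 PI); assert (Hm1 : m <= y0) by apply Rmin_l; assert (Hm2 : m <= PI) by apply
    Rmin_r.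
  assert (Hm3 : PI / 2 < m) by (apply Rmin_glb_lt; lra).
  set (phi := (PI / 2 + m) / 2).
  assert (Hd0 : 0 < (m - phi) / 2) by (unfold phi; lra).
  set (d := mkposreal _ Hd0).
  assert (Hphi : PI / 2 < phi <= PI) by (unfold phi; lra).
  assert (Hc := cos_neg_of phi Hphi).
  (* Distance of the angle [nu (y0 - y)] from [0] and from [2 PI]: the first is smallest at
     [y = phi + d], the second uses [nu y0 <= PI] and [|y| <= PI]. *)
  set (del := Rmin (nu * (y0 - (phi + d))) (PI - nu * PI)).
  assert (Hdel1 : del <= nu * (y0 - (phi + d))) by apply Rmin_l.
  assert (Hdel2 : del <= PI - nu * PI) by apply Rmin_r.
  assert (Hphid : phi + d < m) by (simpl; lra).
  assert (Hdel : 0 < del).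
  { apply Rmin_pos; [apply Rmult_lt_0_compat; lra | nra]. }
  assert (HdelLe : del <= PI) by nra.
  set (kap := Rmax 0 (cos del)).
  assert (Hkap : 0 <= kap < 1).
  { split; [apply Rmax_l | apply Rmax_lub_lt; [lra|]].
    rewrite <- cos_0; apply cos_decreasing_1; lra. }
  assert (Hsec : forall y, - phi - d <= y <= phi + d -> cos (nu * (y0 - y)) <= kap).
  { intros y Hy; eapply Rle_trans; [apply (cos_le_sector del); [lra|] | apply Rmax_r].
    assert (Hy1 : nu * y0 <= PI).
    { apply Rle_trans with (nu * (PI / nu)); [apply Rmult_le_compat_l; lra | right; field; lra]. }
    split; [eapply Rle_trans; [exact Hdel1|]; apply Rmult_le_compat_l; lra|].
    assert (nu * - y <= nu * PI) by (apply Rmult_le_compat_l; lra). lra. }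
  destruct (exp_exp_dominates (1 - b) (- cos phi) Hc) as (K & HK & HKx).
  exists (/ (1 - kap) * K / (- cos phi / 2) + exp 1 * / (1 - kap)).
  intros x0.
  assert (Hik : 0 < / (1 - kap)) by (apply Rinv_0_lt_compat; lra).
  assert (Hder : forall x, is_derive (arc_kernel phi psi nu b x0 y0) x
    (/ (2 * PI) * (snd (integrand psi nu b x0 y0 x phi) - snd (integrand psi nu b x0 y0 x (-
      phi))))).
  { intros x; apply is_derive_arc_kernel with d; [lra|].
    apply filter_forall; intros s y Hy; apply kernel_sector with kap; auto. }
  assert (Hd' : 0 < d) by apply cond_pos.
  assert (Hend : forall x y, cos y = cos phi -> - phi <= y <= phi ->
     Rabs (snd (integrand psi nu b x0 y0 x y)) <= / (1 - kap) * exp ((1 - b) * x - - cos phi * exp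
       x)).
  { intros x y Hcy Hy; eapply Rle_trans; [apply Rabs_snd_le_Cmod|].
    rewrite Cmod_integrand, Hcy, Rmult_comm.
    replace (exp x * cos phi + (1 - b) * x) with ((1 - b) * x - - cos phi * exp x) by ring.
    apply Rmult_le_compat_r; [left; apply exp_pos|].
    apply kernel_sector; [easy | apply Hsec; lra]. }
  assert (H := exp_exp_tail_le (arc_kernel phi psi nu b x0 y0)
    (fun x => / (2 * PI) * (snd (integrand psi nu b x0 y0 x phi) - snd (integrand psi nu b x0 y0 x
      (- phi))))
    (/ (1 - kap) * K) (- cos phi / 2) 0 (Series (ml_term psi nu b x0 y0)) ltac:(lra) (fun x _ =>
      Hder x)).
  assert (H0 : Rabs (arc_kernel phi psi nu b x0 y0 0) <= exp 1 * / (1 - kap)).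
  { replace 1 with (exp 0 + (1 - b) * 0) at 1 by (rewrite exp_0; ring).
    apply arc_kernel_abs_le; [lra|].
    intros y Hy; destruct (kernel_sector nu x0 y0 0 y kap Hkap (Hsec y ltac:(lra))) as (? & ? & _);
      now split. }
  replace (Series (ml_term psi nu b x0 y0)) with
    ((Series (ml_term psi nu b x0 y0) - arc_kernel phi psi nu b x0 y0 0) + arc_kernel phi psi nu b
      x0 y0 0) by ring.
  eapply Rle_trans; [apply Rabs_triang|]; apply Rplus_le_compat; [|exact H0].
  eapply Rle_trans; [apply H|].
  - intros x Hx; apply Rabs_ends_le.
    + eapply Rle_trans; [apply Hend; [easy | lra]|].
      rewrite Rmult_assoc; apply Rmult_le_compat_l; [lra | now apply HKx].
    + eapply Rle_trans; [apply Hend; [apply cos_neg | lra]|].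
      rewrite Rmult_assoc; apply Rmult_le_compat_l; [lra | now apply HKx].
  - now apply is_lim_arc_kernel.
  - rewrite <- Rmult_1_r; apply Rmult_le_compat_l.
    + apply Rdiv_le_0_compat; [nra | lra].
    + rewrite <- exp_0; apply exp_le. rewrite exp_0; lra.
Qed.

(** * Cancellation of two simple poles *)

Lemma Cmod_le_Rabs_plus (z : C) : Cmod z <= Rabs (fst z) + Rabs (snd z).
Proof.
  apply Rsqr_incr_0_var; [|generalize (Rabs_pos (fst z)), (Rabs_pos (snd z)); lra].
  assert (H := Cmod2_alt z); unfold Rsqr; simpl in H.
  rewrite Rmult_1_r in H; rewrite H.
  change (Re z) with (fst z); change (Im z) with (snd z).
  assert (H1 := pow2_abs (fst z)); assert (H2 := pow2_abs (snd z)).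
  generalize (Rabs_pos (fst z)), (Rabs_pos (snd z)); simpl in *; nra.
Qed.

Lemma Cmod_exp_remainder (u s : R) :
  Cmod (cexp (u, s) - 1 - (u, s))%C <= 3 * exp (Rabs u) * (u ^ 2 + s ^ 2).
Proof.
  eapply Rle_trans; [apply Cmod_le_Rabs_plus|]; simpl.
  assert (H1 := Rabs_exp_minus1_minus_le u); assert (H2 := Rabs_exp_minus1_le u).
  assert (H3 := one_minus_cos_le s); assert (H4 := Rabs_sin_minus_le s).
  assert (He : exp u <= exp (Rabs u)) by apply exp_le, Rle_abs.
  assert (Hp := exp_pos u).
  set (E := exp (Rabs u)) in *.
  assert (HR : Rabs (exp u * cos s + - (1) + - u) <= u ^ 2 * E + E * (s ^ 2 / 2)).
  { replace (exp u * cos s + - (1) + - u) with ((exp u - 1 - u) - exp u * (1 - cos s)) by ring.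
    eapply Rle_trans; [apply Rabs_triang|].
    rewrite Rabs_Ropp, Rabs_mult, (Rabs_pos_eq (exp u)), (Rabs_pos_eq (1 - cos s)) by lra.
    apply Rplus_le_compat; [lra|]. apply Rmult_le_compat; lra. }
  assert (HI : Rabs (exp u * sin s + - 0 + - s) <= E * s ^ 2 + Rabs u * E * Rabs s).
  { replace (exp u * sin s + - 0 + - s) with (exp u * (sin s - s) + (exp u - 1) * s) by ring.
    eapply Rle_trans; [apply Rabs_triang|].
    rewrite !Rabs_mult, (Rabs_pos_eq (exp u)) by lra.
    apply Rplus_le_compat; apply Rmult_le_compat; try lra; try apply Rabs_pos. }
  assert (Hus : Rabs u * Rabs s <= (u ^ 2 + s ^ 2) / 2).
  { rewrite <- (pow2_abs u), <- (pow2_abs s).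
    generalize (pow2_ge_0 (Rabs u - Rabs s)); simpl; lra. }
  assert (HE : 0 < E) by apply exp_pos.
  assert (E * (Rabs u * Rabs s) <= E * ((u ^ 2 + s ^ 2) / 2)) by (apply Rmult_le_compat_l; lra).
  assert (0 <= E * u ^ 2) by (apply Rmult_le_pos; [lra | apply pow2_ge_0]).
  assert (0 <= E * s ^ 2) by (apply Rmult_le_pos; [lra | apply pow2_ge_0]).
  lra.
Qed.

(** The range covers [|y - y0|] for [|y| <= 3 PI / 4] and [0 <= y0 <= PI / 2] with room to spare.
    The constant is [2 / 24^2]; at the end of the range both sides of the estimate
    [z / 24 <= (PI - z / 2) / 4] equal [PI / 16]. *)
Lemma one_minus_cos_ge_wide (s : R) : Rabs s <= 3 * PI / 2 -> s ^ 2 / 288 <= 1 - cos s.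
Proof.
  assert (Hpi := PI_RGT_0).
  assert (H : forall s, 0 <= s <= 3 * PI / 2 -> s ^ 2 / 288 <= 1 - cos s).
  { intros z Hz; rewrite one_minus_cos.
    assert (z / 24 <= sin (z / 2)).
    { destruct (Rle_lt_dec (z / 2) (PI / 2)) as [H|H].
      - generalize (sin_ge_quarter (z / 2)); lra.
      - rewrite <- sin_PI_x; generalize (sin_ge_quarter (PI - z / 2)); lra. }
    simpl; nra. }
  intros Hs; destruct (Rle_lt_dec 0 s) as [H0|H0].
  - rewrite Rabs_pos_eq in Hs by easy; apply H; lra.
  - rewrite Rabs_left in Hs by easy; generalize (H (- s) ltac:(lra)); rewrite cos_neg; simpl; lra.
Qed.

(** [(1 - e^u)^2 >= u^2 / 9] and [2 e^u (1 - cos s) >= s^2 / 432]; the constant 441 just lies above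
    both denominators. *)
Lemma one_minus_cexp_ge (u s : R) : Rabs u <= 1 -> Rabs s <= 3 * PI / 2 ->
  (u ^ 2 + s ^ 2) / 441 <= Cmod (1 - cexp (u, s))%C ^ 2.
Proof.
  intros Hu Hs; rewrite Cmod2_one_minus_cexp.
  assert (H1 := one_minus_cos_ge_wide s Hs).
  assert (Hu' := Hu); apply Rabs_le_between in Hu'.
  assert (He3 := exp_le_3).
  assert (He : / 3 <= exp u).
  { apply Rle_trans with (exp (- 1)).
    - replace (exp (- 1)) with (/ exp 1) by (rewrite <- exp_Ropp; f_equal; ring).
      apply Rinv_le_contravar; [apply exp_pos | easy].
    - apply exp_le; lra. }
  assert (Hue : u ^ 2 / 9 <= (1 - exp u) ^ 2).
  { destruct (Rle_lt_dec 0 u) as [H|H].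
    - assert (H2 := exp_ineq1_le u); simpl; nra.
    - assert (H2 := exp_ineq1_le (- u)); rewrite exp_Ropp in H2.
      assert (H3 : exp u * (1 - u) <= 1).
      { apply Rle_trans with (exp u * / exp u); [apply Rmult_le_compat_l; lra | right; field; lra].
        }
      assert (- u / 3 <= 1 - exp u) by nra. simpl; nra. }
  assert (/ 3 * (s ^ 2 / 288) <= exp u * (1 - cos s)).
  { apply Rmult_le_compat; try lra. apply Rdiv_le_0_compat; [apply pow2_ge_0 | lra]. }
  assert (0 <= u ^ 2) by apply pow2_ge_0. assert (0 <= s ^ 2) by apply pow2_ge_0.
  replace (1 - 2 * exp u * cos s + exp u ^ 2) with ((1 - exp u) ^ 2 + 2 * (exp u * (1 - cos s))) by
    ring.
  lra.
Qed.

(* Both terms have a simple pole at [z = 0], with the same residue [1/nu]. *)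
Lemma kernel_diff_bound (p nu : R) : 0 < nu < 1 ->
  exists C, forall u s, Rabs u <= 1 -> Rabs s <= 3 * PI / 2 -> (u, s) <> (0, 0) ->
    (1 - cexp ((- nu * u)%R, (- nu * s)%R))%C <> 0%C /\ (1 - cexp ((- 1 * u)%R, (- 1 * s)%R))%C <>
      0%C /\
    Cmod (cexp ((p * u)%R, (p * s)%R) / (1 - cexp ((- nu * u)%R, (- nu * s)%R))
       - RtoC (/ nu) / (1 - cexp ((- 1 * u)%R, (- 1 * s)%R)))%C <= C.
Proof.
  intros Hnu.
  assert (Hinu : 0 < / nu) by (apply Rinv_0_lt_compat; lra).
  set (A := fun l : R => 3 * exp (Rabs l) * l ^ 2).
  set (S := nu * A p + nu * A (p - 1) + A (- nu)).
  assert (HA : forall l, 0 <= A l).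
  { intros l; unfold A; apply Rmult_le_pos; [generalize (exp_pos (Rabs l)); lra | apply pow2_ge_0].
    }
  assert (HS : 0 <= S).
  { unfold S; generalize (HA p), (HA (p - 1)), (HA (- nu)); intros; nra. }
  exists (441 * / nu * / nu * S).
  intros u s Hu Hs Hz.
  assert (Hq : 0 < u ^ 2 + s ^ 2).
  { destruct (Rle_lt_dec (u ^ 2 + s ^ 2) 0); [|easy]; exfalso; apply Hz.
    generalize (pow2_ge_0 u), (pow2_ge_0 s); intros.
    assert (u ^ 2 = 0) by lra; assert (s ^ 2 = 0) by lra.
    replace u with 0 by (simpl in *; nra); replace s with 0 by (simpl in *; nra); easy. }
  set (Q := u ^ 2 + s ^ 2) in *.
  assert (Hr : forall l, Cmod (cexp ((l * u)%R, (l * s)%R) - 1 - ((l * u)%R, (l * s)%R))%C <= A l *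
    Q).
  { intros l; eapply Rle_trans; [apply Cmod_exp_remainder|].
    replace ((l * u) ^ 2 + (l * s) ^ 2) with (l ^ 2 * Q) by (unfold Q; ring).
    unfold A; rewrite <- Rmult_assoc; apply Rmult_le_compat_r; [lra|].
    apply Rmult_le_compat_r; [apply pow2_ge_0|].
    apply Rmult_le_compat_l; [lra|]. apply exp_le; rewrite Rabs_mult.
    generalize (Rabs_pos l), (Rabs_pos u); nra. }
  assert (Hlow : forall l, 0 < l <= 1 ->
    l ^ 2 * Q / 441 <= Cmod (1 - cexp ((- l * u)%R, (- l * s)%R))%C ^ 2).
  { intros l Hl.
    replace (l ^ 2 * Q) with ((- l * u) ^ 2 + (- l * s) ^ 2) by (unfold Q; ring).
    apply one_minus_cexp_ge; rewrite Rabs_mult, Rabs_Ropp, (Rabs_pos_eq l) by lra;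
      generalize (Rabs_pos u), (Rabs_pos s); nra. }
  assert (Hn : forall l, 0 < l <= 1 -> 0 < Cmod (1 - cexp ((- l * u)%R, (- l * s)%R))%C).
  { intros l Hl; specialize (Hlow l Hl).
    destruct (Cmod_ge_0 (1 - cexp ((- l * u)%R, (- l * s)%R))%C) as [H|H]; [easy|].
    rewrite <- H in Hlow; exfalso.
    assert (0 < l ^ 2 * Q / 441) by (apply Rdiv_lt_0_compat; [apply Rmult_lt_0_compat; [apply
      pow_lt|]|]; lra).
    simpl in *; lra. }
  assert (H1 := Hlow nu ltac:(lra)); assert (H2 := Hlow 1 ltac:(lra)).
  assert (N1 := Hn nu ltac:(lra)); assert (N2 := Hn 1 ltac:(lra)).
  replace (- (1) * u) with (- 1 * u) in * by ring; replace (- (1) * s) with (- 1 * s) in * by ring.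
  set (d1 := (1 - cexp ((- nu * u)%R, (- nu * s)%R))%C) in *.
  set (d2 := (1 - cexp ((- 1 * u)%R, (- 1 * s)%R))%C) in *.
  assert (Z1 := Cmod_neq0 _ N1); assert (Z2 := Cmod_neq0 _ N2).
  split; [easy | split; [easy|]].
  set (rp := (cexp ((p * u)%R, (p * s)%R) - 1 - ((p * u)%R, (p * s)%R))%C) in *.
  assert (Hrp := Hr p); assert (Hrp1 := Hr (p - 1)); assert (Hrn := Hr (- nu)).
  (* Over the common denominator the numerator is [nu e^{pz} (1 - e^{-z}) - (1 - e^{-nu z})]. The
     constant and linear parts cancel, so it can be written with second-order remainders only,
     matching the double zero of [d1 d2]. *)
  replace (cexp ((p * u)%R, (p * s)%R) / d1 - RtoC (/ nu) / d2)%C with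
   ((RtoC nu * (cexp ((p * u)%R, (p * s)%R) - 1 - ((p * u)%R, (p * s)%R))
     - RtoC nu * (cexp (((p - 1) * u)%R, ((p - 1) * s)%R) - 1 - (((p - 1) * u)%R, ((p - 1) * s)%R))
     + (cexp ((- nu * u)%R, (- nu * s)%R) - 1 - ((- nu * u)%R, (- nu * s)%R)))
     / (RtoC nu * d1 * d2))%C.
  - assert (Znu : RtoC nu <> 0%C) by (intros E; apply RtoC_inj in E; lra).
    unfold Cdiv at 1; rewrite Cmod_mult, Cmod_inv, !Cmod_mult by (repeat apply Cmult_neq_0; easy).
    rewrite Cmod_R, (Rabs_pos_eq nu) by lra.
    assert (Hnum : Cmod (RtoC nu * (cexp ((p * u)%R, (p * s)%R) - 1 - ((p * u)%R, (p * s)%R))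
     - RtoC nu * (cexp (((p - 1) * u)%R, ((p - 1) * s)%R) - 1 - (((p - 1) * u)%R, ((p - 1) * s)%R))
     + (cexp ((- nu * u)%R, (- nu * s)%R) - 1 - ((- nu * u)%R, (- nu * s)%R)))%C <= S * Q).
    { eapply Rle_trans; [apply Cmod_triangle|].
      eapply Rle_trans; [apply Rplus_le_compat_r, Cmod_triangle|].
      rewrite Cmod_opp, !Cmod_mult, Cmod_R, (Rabs_pos_eq nu) by lra.
      unfold S.
      assert (nu * Cmod (cexp ((p * u)%R, (p * s)%R) - 1 - ((p * u)%R, (p * s)%R))%C <= nu * (A p *
        Q)) by (apply Rmult_le_compat_l; lra).
      assert (nu * Cmod (cexp (((p - 1) * u)%R, ((p - 1) * s)%R) - 1 - (((p - 1) * u)%R, ((p - 1) *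
        s)%R))%C <= nu * (A (p - 1) * Q)) by (apply Rmult_le_compat_l; lra).
      lra. }
    set (X := Cmod d1) in *; set (Y := Cmod d2) in *.
    assert (Hprod : nu * Q / 441 <= X * Y).
    { apply Rsqr_incr_0_var; [|apply Rmult_le_pos; lra]; unfold Rsqr.
      assert (P1 : 0 <= nu ^ 2 * Q / 441) by (apply Rdiv_le_0_compat; [apply Rmult_le_pos; [apply
        pow2_ge_0|]|]; lra).
      assert (P2 : 0 <= 1 ^ 2 * Q / 441) by (simpl; lra).
      assert (HH := Rmult_le_compat _ _ _ _ P1 P2 H1 H2).
      simpl in HH; lra. }
    apply Rle_trans with (S * Q * / (nu * (nu * Q / 441))).
    + apply Rmult_le_compat; [apply Cmod_ge_0 | | easy|].
      * left; apply Rinv_0_lt_compat; repeat apply Rmult_lt_0_compat; lra.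
      * apply Rinv_le_contravar.
        -- apply Rmult_lt_0_compat; [lra|]. apply Rdiv_lt_0_compat; [apply Rmult_lt_0_compat; lra |
          lra].
        -- rewrite Rmult_assoc; apply Rmult_le_compat_l; lra.
    + right; field; lra.
  - assert (Znu : RtoC nu <> 0%C) by (intros E; apply RtoC_inj in E; lra).
    rewrite RtoC_inv by lra.
    replace (cexp (((p - 1) * u)%R, ((p - 1) * s)%R)) with
      (cexp ((p * u)%R, (p * s)%R) * (1 - d2))%C.
    2:{ unfold d2; replace (1 - (1 - cexp ((- 1 * u)%R, (- 1 * s)%R)))%C with (cexp ((- 1 * u)%R,
      (- 1 * s)%R)) by ring.
        rewrite <- cexp_plus; f_equal; apply injective_projections; simpl; ring. }
    replace (cexp ((- nu * u)%R, (- nu * s)%R)) with (1 - d1)%C by (unfold d1; ring).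
    replace ((p * u)%R, (p * s)%R) with (RtoC p * (u, s))%C by (apply injective_projections; simpl;
      ring).
    replace (((p - 1) * u)%R, ((p - 1) * s)%R) with ((RtoC p - 1) * (u, s))%C by (apply
      injective_projections; simpl; ring).
    replace ((- nu * u)%R, (- nu * s)%R) with (- RtoC nu * (u, s))%C by (apply
      injective_projections; simpl; ring).
    field; auto.
Qed.

Lemma ratio_neq_1 nu x0 y0 x y : 0 < nu <= 1 ->
  x <> x0 \/ (y <> y0 /\ Rabs (y - y0) <= 3 * PI / 2) ->
  (1 - ratio nu x0 y0 x y)%C <> 0%C.
Proof.
  intros Hnu H; apply Cmod_neq0; unfold ratio.
  set (u := - nu * (x - x0)); set (s := - nu * (y - y0)).
  assert (H2 := Cmod2_one_minus_cexp u s).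
  destruct (Cmod_ge_0 (1 - cexp (u, s))%C) as [Hp|Hz]; [easy|exfalso].
  rewrite <- Hz in H2.
  assert (He := exp_pos u); assert (Hc := COS_bound s).
  assert (H3 : (1 - exp u) ^ 2 + 2 * (exp u * (1 - cos s)) = 0) by (simpl in *; lra).
  assert (H4 : 0 <= exp u * (1 - cos s)) by (apply Rmult_le_pos; lra).
  assert (H5 := pow2_ge_0 (1 - exp u)).
  destruct H as [Hx | [Hy Hys]].
  - assert (E : 1 - exp u = 0) by (simpl in *; nra).
    assert (exp u = exp 0) by (rewrite exp_0; lra).
    apply exp_inv in H; unfold u in H; apply Hx.
    apply Rmult_integral in H; lra.
  - assert (E : exp u * (1 - cos s) = 0) by lra.
    apply Rmult_integral in E; destruct E as [E|E]; [lra|].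
    assert (Hs : Rabs s <= 3 * PI / 2).
    { unfold s; rewrite Rabs_mult, Rabs_Ropp, (Rabs_pos_eq nu) by lra.
      generalize (Rabs_pos (y - y0)); nra. }
    assert (H6 := one_minus_cos_ge_wide s Hs).
    assert (Hs0 : s <> 0).
    { unfold s; apply Rmult_integral_contrapositive_currified; lra. }
    assert (0 < s ^ 2) by (rewrite <- Rsqr_pow2; now apply Rsqr_pos_lt). lra.
Qed.

Section CommonPole.

Variables nu b x0 y0 : R.
Hypothesis Hnu : 0 < nu < 1.
Hypothesis Hy0 : 0 <= y0 <= PI / 2.

Let phi := 3 * PI / 4.
(** Ratio of the residues of the two integrands at [w0]: [w0^{1-b} / nu]. Its modulus is [c], and
    its argument [(1 - b) y0] is put into the phase of the second integrand. *)
Let c := exp ((1 - b) * x0) * / nu.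

Definition pole_diff (x y : R) : C :=
  (integrand 0 nu b x0 y0 x y - RtoC c * integrand ((1 - b) * y0)%R 1 1 x0 y0 x y)%C.

Definition arc_diff (x : R) : R :=
  arc_kernel phi 0 nu b x0 y0 x - c * arc_kernel phi ((1 - b) * y0) 1 1 x0 y0 x.

Lemma pole_diff_bound : exists C, forall x y, Rabs (x - x0) <= 1 -> Rabs (y - y0) <= 3 * PI / 2 ->
  (x <> x0 \/ y <> y0) -> Cmod (pole_diff x y) <= C.
Proof.
  destruct (kernel_diff_bound (1 - b) nu Hnu) as [C HC].
  exists (exp (exp (x0 + 1)) * exp ((1 - b) * x0) * C).
  intros x y Hx Hy Hxy.
  destruct (HC (x - x0) (y - y0) Hx Hy) as (Z1 & Z2 & HB).
  { intros E; injection E; lra. }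
  assert (HC0 : 0 <= C) by (eapply Rle_trans; [apply Cmod_ge_0 | exact HB]).
  replace (pole_diff x y) with (hankel 1 x y * cexp (((1 - b) * x0)%R, ((1 - b) * y0)%R) *
    (cexp (((1 - b) * (x - x0))%R, ((1 - b) * (y - y0))%R) / (1 - cexp ((- nu * (x - x0))%R, (- nu
      * (y - y0))%R))
       - RtoC (/ nu) / (1 - cexp ((- 1 * (x - x0))%R, (- 1 * (y - y0))%R))))%C.
  - rewrite !Cmod_mult, Cmod_hankel, Cmod_cexp; simpl fst.
    apply Rmult_le_compat; [apply Rmult_le_pos; left; apply exp_pos | apply Cmod_ge_0 | | easy].
    apply Rmult_le_compat_r; [left; apply exp_pos|]; apply exp_le.
    apply Rle_trans with (exp x).
    + generalize (COS_bound y), (exp_pos x); nra.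
    + apply exp_le; apply Rabs_le_between in Hx; lra.
  - unfold pole_diff, integrand, kernel.
    assert (Hh : hankel b x y = (cexp (((1 - b) * x0)%R, ((1 - b) * y0)%R) *
      cexp (((1 - b) * (x - x0))%R, ((1 - b) * (y - y0))%R) * hankel 1 x y)%C).
    { rewrite <- cexp_plus.
      replace (hankel b x y) with (hankel (1 - (1 - b)) x y) by (f_equal; ring).
      rewrite hankel_shift; f_equal; apply f_equal, injective_projections; simpl; ring. }
    assert (Hc : (RtoC c * phase ((1 - b) * y0))%C = (RtoC (/ nu) * cexp (((1 - b) * x0)%R, ((1 -
      b) * y0)%R))%C).
    { unfold phase, cexp, c; apply injective_projections; simpl; rewrite exp_0; ring. }
    assert (H0 : phase 0 = 1%C) by apply cexp_0.
    assert (H1 : ratio 1 x0 y0 x y = cexp ((- 1 * (x - x0))%R, (- 1 * (y - y0))%R))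
      by (unfold ratio; apply f_equal, injective_projections; simpl; ring).
    rewrite Hh, H0, H1; unfold ratio.
    set (d1 := (1 - cexp ((- nu * (x - x0))%R, (- nu * (y - y0))%R))%C) in *.
    set (d2 := (1 - cexp ((- 1 * (x - x0))%R, (- 1 * (y - y0))%R))%C) in *.
    transitivity (cexp (((1 - b) * x0)%R, ((1 - b) * y0)%R) *
      cexp (((1 - b) * (x - x0))%R, ((1 - b) * (y - y0))%R) * hankel 1 x y * / d1
      - (RtoC (/ nu) * cexp (((1 - b) * x0)%R, ((1 - b) * y0)%R)) * (hankel 1 x y * / d2))%C.
    + unfold Cdiv; ring.
    + rewrite <- Hc; ring.
Qed.

Lemma hol_pole_diff : exists f', forall x y,
  x <> x0 \/ (y <> y0 /\ Rabs (y - y0) <= 3 * PI / 2) -> hol pole_diff f' x y.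
Proof.
  destruct (hol_integrand 0 nu b x0 y0) as [f1 H1].
  destruct (hol_integrand ((1 - b) * y0) 1 1 x0 y0) as [f2 H2].
  eexists; intros x y H.
  apply hol_ext with (f := fun s t => (integrand 0 nu b x0 y0 s t +
    RtoC (- c) * integrand ((1 - b) * y0)%R 1 1 x0 y0 s t)%C).
  { intros; unfold pole_diff; rewrite RtoC_opp; ring. }
  apply hol_plus; [apply H1, ratio_neq_1; [lra | easy]|].
  apply hol_mult; [apply hol_const | apply H2, ratio_neq_1; [lra | easy]].
Qed.

Lemma arc_diff_RInt x : x <> x0 ->
  arc_diff x = / (2 * PI) * RInt (fun y => fst (pole_diff x y)) (- phi) phi.
Proof.
  intros Hx; unfold arc_diff, arc_kernel; assert (Hpi := PI_RGT_0).
  assert (Hex1 : ex_RInt (fun y => fst (integrand 0 nu b x0 y0 x y)) (- phi) phi).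
  { apply ex_RInt_integrand; [unfold phi; lra|]; intros; apply ratio_neq_1; [lra | now left]. }
  assert (Hex2 : ex_RInt (fun y => fst (integrand ((1 - b) * y0) 1 1 x0 y0 x y)) (- phi) phi).
  { apply ex_RInt_integrand; [unfold phi; lra|]; intros; apply ratio_neq_1; [lra | now left]. }
  rewrite (RInt_ext (fun y => fst (pole_diff x y)) (fun y => minus (fst (integrand 0 nu b x0 y0 x
    y))
     (scal c (fst (integrand ((1 - b) * y0) 1 1 x0 y0 x y))))).
  2:{ intros y _; unfold pole_diff.
      generalize (integrand 0 nu b x0 y0 x y) (integrand ((1 - b) * y0) 1 1 x0 y0 x y); intros A B.
      unfold minus, plus, opp, scal; simpl; unfold mult; simpl. ring. }
  rewrite (RInt_minus (V := R_CompleteNormedModule) (fun y => fst (integrand 0 nu b x0 y0 x y)));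
    [|easy | now apply (ex_RInt_scal (V := R_NormedModule) (fun y => fst (integrand ((1 - b) * y0)
      1 1 x0 y0 x y)))].
  rewrite (RInt_scal (V := R_CompleteNormedModule) (fun y => fst (integrand ((1 - b) * y0) 1 1 x0
    y0 x y))) by easy.
  generalize (RInt (fun y => fst (integrand 0 nu b x0 y0 x y)) (- phi) phi)
    (RInt (fun y => fst (integrand ((1 - b) * y0) 1 1 x0 y0 x y)) (- phi) phi); intros I1 I2.
  change (/ (2 * PI) * I1 - c * (/ (2 * PI) * I2) = / (2 * PI) * ((I1 : R) - c * I2)); ring.
Qed.

(* Crossing the common pole costs nothing: the boundary of a square of side [2 eta] around a
   bounded singularity has length [O (eta)]. *)
Lemma arc_diff_jump : exists C, forall eta, 0 < eta <= / 8 ->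
  Rabs (arc_diff (x0 + eta) - arc_diff (x0 - eta)) <= C * eta.
Proof.
  destruct pole_diff_bound as [C HC]; destruct hol_pole_diff as [f' Hf].
  assert (Hpi := PI2_1).
  (* Two horizontal parts contribute [4 C eta] each and two vertical ones [2 C eta] each; the factor
     [1 / (2 PI)] is at most 1/2. *)
  exists (6 * C); intros eta Heta.
  assert (Hex : forall x, x <> x0 -> forall y1 y2, y1 <= y2 -> ex_RInt (fun y => fst (pole_diff x
    y)) y1 y2).
  { intros x Hx y1 y2 Hy; apply (ex_RInt_2d (fun x y => fst (pole_diff x y))); [easy|].
    intros y _; apply (hol_cu _ _ _ _ (Hf x y (or_introl Hx))). }
  set (J := fun y1 y2 x => RInt (fun y => fst (pole_diff x y)) y1 y2).
  assert (Hspl : forall x, x <> x0 -> arc_diff x = / (2 * PI) *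
     (J (- phi) (y0 - eta) x + (J (y0 - eta) (y0 + eta) x + J (y0 + eta) phi x))).
  { intros x Hx; rewrite arc_diff_RInt by easy.
    rewrite <- (RInt_Chasles (V := R_CompleteNormedModule) _ (- phi) (y0 - eta) phi)
      by (apply Hex; [easy | unfold phi; lra]).
    rewrite <- (RInt_Chasles (V := R_CompleteNormedModule) _ (y0 - eta) (y0 + eta) phi)
      by (apply Hex; [easy | unfold phi; lra]).
    easy. }
  (* Above and below the pole the strip is free of singularities, so the increment is governed by
     the end values, which are bounded by [C]. *)
  assert (Hside : forall y1 y2, - phi <= y1 <= y2 -> y2 <= phi ->
     y2 <= y0 - eta \/ y0 + eta <= y1 -> Rabs (J y1 y2 (x0 + eta) - J y1 y2 (x0 - eta)) <= 4 * C *
       eta).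
  { intros y1 y2 Hy1 Hy2 Hsep.
    assert (Hd0 : 0 < eta / 2) by lra.
    replace (4 * C * eta) with (2 * C * (x0 + eta) - 2 * C * (x0 - eta)) by ring.
    apply (Rabs_increment_le (J y1 y2) (fun x => snd (pole_diff x y2) - snd (pole_diff x y1))
      (fun x => 2 * C * x) (fun _ => 2 * C)); [lra| | |].
    - intros x Hx.
      apply cauchy_vertical with (f' := f') (d := mkposreal _ Hd0); [lra|].
      apply filter_forall; intros s y Hy; simpl in Hy.
      apply Hf; right; split; [lra|]. apply Rabs_le; unfold phi in *; lra.
    - intros x Hx; auto_derive; [easy|ring].
    - intros x Hx.
      assert (Hb : forall y, y = y1 \/ y = y2 -> Rabs (snd (pole_diff x y)) <= C).
      { intros y Hy; eapply Rle_trans; [apply Rabs_snd_le_Cmod|].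
        apply HC; [apply Rabs_le; lra | apply Rabs_le; unfold phi in *; lra | right; lra]. }
      eapply Rle_trans; [apply Rabs_triang|]; rewrite Rabs_Ropp.
      generalize (Hb y1 (or_introl eq_refl)), (Hb y2 (or_intror eq_refl)); lra. }
  assert (Hmid : forall x, x <> x0 -> Rabs (x - x0) <= 1 -> Rabs (J (y0 - eta) (y0 + eta) x) <= 2 *
    C * eta).
  { intros x Hx Hx1; replace (2 * C * eta) with ((y0 + eta - (y0 - eta)) * C) by ring.
    apply abs_RInt_le_const; [lra | apply Hex; [easy | lra]|].
    intros y Hy; eapply Rle_trans; [apply Rabs_fst_le_Cmod|].
    apply HC; [easy | apply Rabs_le; lra | now left]. }
  assert (S1 := Hside (- phi) (y0 - eta) ltac:(unfold phi; lra) ltac:(unfold phi; lra) ltac:(lra)).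
  assert (S2 := Hside (y0 + eta) phi ltac:(unfold phi; lra) ltac:(unfold phi; lra) ltac:(lra)).
  assert (M1 := Hmid (x0 + eta) ltac:(lra) ltac:(apply Rabs_le; lra)).
  assert (M2 := Hmid (x0 - eta) ltac:(lra) ltac:(apply Rabs_le; lra)).
  rewrite !Hspl by lra.
  rewrite <- Rmult_minus_distr_l, Rabs_mult, (Rabs_pos_eq (/ _)) by (left; apply PI2_pos).
  apply Rle_trans with (/ (2 * PI) * (12 * C * eta)).
  - apply Rmult_le_compat_l; [left; apply PI2_pos|].
    apply Rabs_le_between in S1; apply Rabs_le_between in S2.
    apply Rabs_le_between in M1; apply Rabs_le_between in M2.
    apply Rabs_le; lra.
  - assert (HCe : 0 <= C * eta) by (generalize (Rabs_pos (J (y0 - eta) (y0 + eta) (x0 + eta)));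
    lra).
    generalize inv_2PI_le_1; nra.
Qed.

End CommonPole.

(** * Entire power series and the exponential series *)

Lemma entire_CV_radius (c : nat -> R) : entire c -> CV_radius c = p_infty.
Proof.
  intros Hc; destruct (CV_radius c) as [r| |] eqn:E; [exfalso| easy | exfalso].
  - assert (Hr : 0 <= r) by (generalize (CV_radius_ge_0 c); rewrite E; easy).
    apply (CV_disk_outside c (r + 1)).
    + rewrite E; simpl; rewrite Rabs_pos_eq; lra.
    + apply ex_series_lim_0, ex_series_Rabs.
      apply ex_series_ext with (2 := Hc (r + 1) ltac:(lra)).
      intros n; rewrite Rabs_mult, (Rabs_pos_eq (_ ^ n)); [easy | apply pow_le; lra].
  - generalize (CV_radius_ge_0 c); rewrite E; easy.
Qed.

Lemma entire_is_derive (c : nat -> R) x : entire c -> is_derive (PSeries c) x (PSeries (PS_derive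
  c) x).
Proof. intros Hc; apply is_derive_PSeries; now rewrite entire_CV_radius. Qed.

Lemma entire_ex_pseries (c : nat -> R) x : entire c -> ex_series (fun k => c k * x ^ k).
Proof.
  intros Hc; apply ex_series_Rabs.
  apply ex_series_ext with (2 := Hc (Rabs x) (Rabs_pos x)).
  intros n; now rewrite Rabs_mult, RPow_abs.
Qed.

Lemma entire_exp_coef (g : nat -> R) : (forall k, Rabs (g k) <= 1) -> entire (fun k => g k / INR
  (fact k)).
Proof.
  intros Hg t Ht.
  apply (ex_series_le (K := R_AbsRing) (V := R_CompleteNormedModule) _ (fun k => / INR (fact k) * t
    ^ k)).
  - intros k; change norm with Rabs; simpl.
    assert (Hf := INR_fact_lt_0 k); assert (0 < / INR (fact k)) by now apply Rinv_0_lt_compat.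
    assert (0 <= t ^ k) by now apply pow_le.
    unfold Rdiv; rewrite Rabs_mult, Rabs_Rabsolu, (Rabs_pos_eq (t ^ k)), Rabs_mult, (Rabs_pos_eq (/
      _)) by lra.
    apply Rmult_le_compat_r; [easy|]. specialize (Hg k); nra.
  - apply ex_series_ext with (2 := ex_intro _ _ (is_exp_Reals t)).
    intros; simpl; rewrite pow_n_pow; unfold scal; simpl; unfold mult; simpl; ring.
Qed.

(** The sum is the real part of [e^{i psi} exp (r e^{i th})]. Together with its sine companion it
    solves a linear system in [r]; [Z] and [W] undo the flow of that system and are therefore
    constant. *)
Lemma exp_cos_series (r th psi : R) :
  Series (fun k => r ^ k * cos (INR k * th + psi) / INR (fact k))
   = exp (r * cos th) * cos (r * sin th + psi).
Proof.
  set (p := fun k => cos (INR k * th + psi) / INR (fact k)).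
  set (q := fun k => sin (INR k * th + psi) / INR (fact k)).
  assert (Hp : entire p) by (apply entire_exp_coef; intros; apply Rabs_le, COS_bound).
  assert (Hq : entire q) by (apply entire_exp_coef; intros; apply Rabs_le, SIN_bound).
  assert (Hfs : forall k, INR (S k) / INR (fact (S k)) = / INR (fact k)).
  { intros k; rewrite fact_simpl, mult_INR; field; split; [apply INR_fact_neq_0 | apply not_0_INR;
    lia]. }
  assert (Dp : forall s, is_derive (PSeries p) s (cos th * PSeries p s - sin th * PSeries q s)).
  { intros s; eapply is_derive_eq; [now apply entire_is_derive|].
    unfold PSeries; rewrite <- !Series_scal_l.
    rewrite <- Series_minus by (apply (ex_series_scal (V := R_NormedModule)); now apply
      entire_ex_pseries).
    apply Series_ext; intros k; unfold PS_derive, p, q.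
    transitivity (INR (S k) / INR (fact (S k)) * cos (INR (S k) * th + psi) * s ^ k); [field; apply
      INR_fact_neq_0|].
    rewrite Hfs; replace (INR (S k) * th + psi) with ((INR k * th + psi) + th) by (rewrite S_INR;
      ring).
    rewrite cos_plus; field; apply INR_fact_neq_0. }
  assert (Dq : forall s, is_derive (PSeries q) s (sin th * PSeries p s + cos th * PSeries q s)).
  { intros s; eapply is_derive_eq; [now apply entire_is_derive|].
    unfold PSeries; rewrite <- !Series_scal_l.
    rewrite <- Series_plus by (apply (ex_series_scal (V := R_NormedModule)); now apply
      entire_ex_pseries).
    apply Series_ext; intros k; unfold PS_derive, p, q.
    transitivity (INR (S k) / INR (fact (S k)) * sin (INR (S k) * th + psi) * s ^ k); [field; apply
      INR_fact_neq_0|].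
    rewrite Hfs; replace (INR (S k) * th + psi) with ((INR k * th + psi) + th) by (rewrite S_INR;
      ring).
    rewrite sin_plus; field; apply INR_fact_neq_0. }
  set (Z := fun s => exp (- s * cos th) * (PSeries p s * cos (s * sin th) + PSeries q s * sin (s *
    sin th))).
  set (W := fun s => exp (- s * cos th) * (PSeries q s * cos (s * sin th) - PSeries p s * sin (s *
    sin th))).
  assert (Hconst : forall f : R -> R, (forall s, is_derive f s 0) -> f r = f 0).
  { intros f Hf; destruct (Rtotal_order r 0) as [H|[H|H]].
    - apply (eq_is_derive (V := R_NormedModule) f r 0); auto.
    - now rewrite H.
    - symmetry; apply (eq_is_derive (V := R_NormedModule) f 0 r); auto. }
  assert (De : forall s, is_derive (fun s => exp (- s * cos th)) s (- cos th * exp (- s * cos th)))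
    by (intros; auto_derive; [easy | ring]).
  assert (Dc : forall s, is_derive (fun s => cos (s * sin th)) s (- sin th * sin (s * sin th)))
    by (intros; auto_derive; [easy | ring]).
  assert (Ds : forall s, is_derive (fun s => sin (s * sin th)) s (sin th * cos (s * sin th)))
    by (intros; auto_derive; [easy | ring]).
  assert (HZ : Z r = Z 0).
  { apply Hconst; intros s; eapply is_derive_eq.
    - apply is_derive_Rmult; [apply De|]; apply is_derive_Rplus; apply is_derive_Rmult; auto.
    - cbv beta; ring. }
  assert (HW : W r = W 0).
  { apply Hconst; intros s; eapply is_derive_eq.
    - apply is_derive_Rmult; [apply De|]; apply is_derive_Rminus; apply is_derive_Rmult; auto.
    - cbv beta; ring. }
  assert (P0 : PSeries p 0 = cos psi) by (rewrite PSeries_0; unfold p; simpl; rewrite Rmult_0_l,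
    Rplus_0_l; field).
  assert (Q0 : PSeries q 0 = sin psi) by (rewrite PSeries_0; unfold q; simpl; rewrite Rmult_0_l,
    Rplus_0_l; field).
  unfold Z at 2 in HZ; unfold W at 2 in HW.
  rewrite P0, Q0, Ropp_0, !Rmult_0_l, exp_0, cos_0, sin_0 in HZ, HW.
  transitivity (PSeries p r).
  { apply Series_ext; intros k; unfold p, Rdiv; ring. }
  rewrite cos_plus.
  replace (cos psi) with (Z r) by lra; replace (sin psi) with (W r) by lra.
  unfold Z, W.
  assert (E : exp (r * cos th) * exp (- r * cos th) = 1)
    by (rewrite <- exp_plus; replace (r * cos th + - r * cos th) with 0 by ring; apply exp_0).
  assert (T := sin2_cos2 (r * sin th)); unfold Rsqr in T.
  transitivity (exp (r * cos th) * exp (- r * cos th) * PSeries p r *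
    (sin (r * sin th) * sin (r * sin th) + cos (r * sin th) * cos (r * sin th))); [rewrite E, T;
      ring | ring].
Qed.

Lemma ml_exp_series psi x0 y0 :
  Series (ml_term psi 1 1 x0 y0) = exp (exp x0 * cos y0) * cos (exp x0 * sin y0 + psi).
Proof.
  rewrite <- exp_cos_series; apply Series_ext; intros k; unfold ml_term.
  rewrite !Rmult_1_l, exp_INR_mult, (Rplus_comm 1), rgamma_fact; easy.
Qed.

(** The pole now lies in the sector, and the arc is brought from infinity to radius 1 across it for
    [arc_diff], whose integrand is bounded there. The subtracted series is an exponential; the error
    collects the end values on both sides of the pole and the value at radius 1. *)
Lemma ml_exponential nu b y0 : 0 < nu < 1 -> 0 <= y0 <= PI / 2 ->
  exists C, 0 <= C /\ forall x0, 1 <= nu * x0 ->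
    Rabs (Series (ml_term 0 nu b x0 y0) - exp ((1 - b) * x0) * / nu *
        (exp (exp x0 * cos y0) * cos (exp x0 * sin y0 + (1 - b) * y0)))
      <= C * (1 + exp (- b * x0)).
Proof.
  intros Hnu Hy0; assert (Hpi := PI_RGT_0).
  set (phi := 3 * PI / 4).
  assert (Hphi : PI / 2 < phi <= PI) by (unfold phi; lra).
  assert (Hc := cos_neg_of phi Hphi).
  set (kap := cos (nu * (PI / 4))).
  assert (Hnp : nu * (PI / 4) <= PI / 4) by (rewrite <- (Rmult_1_l (PI / 4)) at 2; apply
    Rmult_le_compat_r; lra).
  assert (Hnp0 : 0 < nu * (PI / 4)) by (apply Rmult_lt_0_compat; lra).
  assert (Hkap : 0 <= kap < 1).
  { split; [left; apply cos_gt_0; lra | unfold kap; rewrite <- cos_0; apply cos_decreasing_1; lra].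
    }
  (* At the ends [y = phi] and [y = - phi] the distance to [y0] lies in [[PI / 4, 5 PI / 4]], so
     after multiplication by [l] the angle stays [nu PI / 4] away from the multiples of [2 PI]. The
     choice [phi = 3 PI / 4] is made for this. *)
  assert (Hsec : forall l y, nu <= l <= 1 -> y = phi \/ y = - phi -> cos (l * (y0 - y)) <= kap).
  { intros l y Hl Hy.
    assert (Hpos : forall z, PI / 4 <= z <= 5 * PI / 4 -> cos (l * z) <= kap).
    { intros z Hz; apply cos_le_sector; [lra|].
      split; [apply Rmult_le_compat; lra|].
      assert (l * z <= 1 * (5 * PI / 4)) by (apply Rmult_le_compat; lra). lra. }
    destruct Hy as [->| ->].
    - replace (l * (y0 - phi)) with (- (l * (phi - y0))) by ring; rewrite cos_neg.
      apply Hpos; unfold phi; lra.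
    - apply Hpos; unfold phi; lra. }
  set (ik := / (1 - kap)).
  assert (Hik : 0 < ik) by (apply Rinv_0_lt_compat; lra).
  set (inu := / nu); assert (Hinu : 0 < inu) by (apply Rinv_0_lt_compat; lra).
  destruct (exp_exp_dominates (1 - b) (- cos phi) Hc) as (K1 & HK1 & HKx1).
  destruct (exp_exp_dominates 1 (- cos phi) Hc) as (K2 & HK2 & HKx2).
  set (K := ik * (K1 + inu * K2)).
  assert (HK : 0 < K) by (apply Rmult_lt_0_compat; [easy | nra]).
  set (gam := - cos phi / 2); assert (Hgam : 0 < gam) by (unfold gam; lra).
  assert (He1 := exp_pos 1).
  exists (2 * (K / gam) + exp 1 * (1 + 2 * inu)).
  assert (HKg : 0 < K / gam) by now apply Rdiv_lt_0_compat.
  split; [nra|].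
  intros x0 Hx0.
  assert (Hx0' : 1 <= x0) by nra.
  set (E := exp (- b * x0)); assert (HE : 0 < E) by apply exp_pos.
  set (c := exp ((1 - b) * x0) * / nu).
  assert (Hcpos : 0 < c) by (apply Rmult_lt_0_compat; [apply exp_pos | easy]).
  (* The second kernel brings a factor [exp (- x0)] at the ends and at radius 1, which turns the
     large weight [c] into the error scale [E]. *)
  assert (HcE : c * exp (- x0) = inu * E).
  { unfold c, E, inu; replace (- b * x0) with ((1 - b) * x0 + - x0) by ring.
    rewrite exp_plus; ring. }
  set (DM := arc_diff nu b x0 y0).
  set (dDM := fun x => / (2 * PI) * (snd (pole_diff nu b x0 y0 x phi) - snd (pole_diff nu b x0 y0 x
    (- phi)))).
  assert (Hder : forall x, x <> x0 -> is_derive DM x (dDM x)).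
  { intros x Hx.
    assert (Hloc : forall l : R, 0 < l <= 1 -> locally x (fun s => forall y, - phi - mkposreal 1
      Rlt_0_1 <= y <= phi + mkposreal 1 Rlt_0_1 -> (1 - ratio l x0 y0 s y)%C <> 0%C)).
    { intros l Hl.
      assert (Hd : 0 < Rabs (x - x0)) by (apply Rabs_pos_lt; lra).
      exists (mkposreal _ Hd); intros s Hs y _; apply ratio_neq_1; [easy|left].
      intros ->; unfold ball in Hs; simpl in Hs; unfold AbsRing_ball, abs, minus, plus, opp in Hs;
        simpl in Hs.
      replace (x0 + - x) with (- (x - x0)) in Hs by ring; rewrite Rabs_Ropp in Hs; lra. }
    unfold DM, arc_diff; eapply is_derive_eq.
    - apply is_derive_Rminus.
      + apply is_derive_arc_kernel with (mkposreal 1 Rlt_0_1); [lra | apply Hloc; lra].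
      + apply (is_derive_scal (arc_kernel phi ((1 - b) * y0) 1 1 x0 y0)).
        apply is_derive_arc_kernel with (mkposreal 1 Rlt_0_1); [lra | apply Hloc; lra].
    - unfold dDM, pole_diff; fold phi c.
      generalize (integrand 0 nu b x0 y0 x phi) (integrand 0 nu b x0 y0 x (- phi))
        (integrand ((1 - b) * y0) 1 1 x0 y0 x phi) (integrand ((1 - b) * y0) 1 1 x0 y0 x (- phi)).
      intros A B A' B'; simpl; ring. }
  assert (Hend : forall x y, 0 <= x -> y = phi \/ y = - phi ->
    Rabs (snd (pole_diff nu b x0 y0 x y)) <= K * (1 + E) * (exp x * exp (- gam * exp x))).
  { intros x y Hx Hy; eapply Rle_trans; [apply Rabs_snd_le_Cmod|]; unfold pole_diff.
    eapply Rle_trans; [apply Cmod_triangle|]; rewrite Cmod_opp, Cmod_mult, Cmod_R; fold c.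
    rewrite (Rabs_pos_eq c), !Cmod_integrand by lra.
    destruct (kernel_sector nu x0 y0 x y kap Hkap (Hsec nu y ltac:(lra) Hy)) as (_ & B1 & _).
    destruct (kernel_sector 1 x0 y0 x y kap Hkap (Hsec 1 y ltac:(lra) Hy)) as (_ & _ & B2).
    fold ik in B1, B2.
    assert (Hcy : cos y = cos phi) by (destruct Hy as [->| ->]; [easy | apply cos_neg]).
    rewrite Hcy; specialize (HKx1 x Hx); specialize (HKx2 x Hx).
    replace (- (- cos phi / 2)) with (- gam) in HKx1, HKx2 by easy.
    set (X := exp x * exp (- gam * exp x)) in *.
    assert (HX : 0 < X) by (apply Rmult_lt_0_compat; apply exp_pos). clearbody X.
    replace (exp x * cos phi + (1 - b) * x) with ((1 - b) * x - - cos phi * exp x) by ring.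
    assert (T1 : exp ((1 - b) * x - - cos phi * exp x) * Cmod (kernel nu x0 y0 x y) <= K1 * X * ik).
    { apply Rmult_le_compat; auto; [left; apply exp_pos | apply Cmod_ge_0]. }
    assert (T2 : c * (exp (exp x * cos phi + (1 - 1) * x) * Cmod (kernel 1 x0 y0 x y)) <= inu * E *
      ik * (K2 * X)).
    { apply Rle_trans with (c * (exp (exp x * cos phi + (1 - 1) * x) * (ik * exp (1 * (x - x0))))).
      - apply Rmult_le_compat_l; [lra|]. apply Rmult_le_compat_l; [left; apply exp_pos | easy].
      - replace (1 * (x - x0)) with (- x0 + x) by ring; rewrite (exp_plus (- x0) x).
        replace (c * (exp (exp x * cos phi + (1 - 1) * x) * (ik * (exp (- x0) * exp x)))) with
          (c * exp (- x0) * ik * (exp x * exp (exp x * cos phi + (1 - 1) * x))) by ring.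
        rewrite HcE, <- exp_plus.
        replace (x + (exp x * cos phi + (1 - 1) * x)) with (1 * x - - cos phi * exp x) by ring.
        apply Rmult_le_compat_l; [|easy].
        apply Rmult_le_pos; [apply Rmult_le_pos|]; lra. }
    eapply Rle_trans; [apply Rplus_le_compat; [exact T1 | exact T2]|].
    unfold K.
    assert (0 <= ik * K1 * E * X) by (clearbody ik E; repeat apply Rmult_le_pos; lra).
    assert (0 <= ik * inu * K2 * X) by (clearbody ik inu; repeat apply Rmult_le_pos; lra).
    lra. }
  assert (HdDM : forall x, 0 <= x -> Rabs (dDM x) <= K * (1 + E) * (exp x * exp (- gam * exp x))).
  { intros x Hx; apply Rabs_ends_le; apply Hend; auto. }
  set (l := Series (ml_term 0 nu b x0 y0) - c * Series (ml_term ((1 - b) * y0) 1 1 x0 y0)).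
  assert (Hlim : is_lim DM p_infty l).
  { apply is_lim_minus'; [now apply is_lim_arc_kernel|].
    apply (is_lim_scal_l _ c p_infty (Series (ml_term ((1 - b) * y0) 1 1 x0 y0))).
    apply is_lim_arc_kernel; [lra | easy]. }
  rewrite <- ml_exp_series.
  change (Rabs l <= (2 * (K / gam) + exp 1 * (1 + 2 * inu)) * (1 + E)).
  (* Because [1 <= nu * x0], the ratio at radius 1 has modulus at least 2 for both kernels, so each
     is at most twice the inverse of that modulus. *)
  assert (Hstart : Rabs (DM 0) <= exp 1 * (1 + 2 * inu) * (1 + E)).
  { unfold DM, arc_diff; eapply Rle_trans; [apply Rabs_triang|].
    fold c; rewrite Rabs_Ropp, Rabs_mult, (Rabs_pos_eq c) by lra.
    assert (Hex : forall x, 1 <= x -> 2 <= exp x) by (intros x Hx; generalize (exp_ineq1_le x);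
      lra).
    assert (Hnear : forall l y, 0 < l -> 1 <= l * x0 ->
      (1 - ratio l x0 y0 0 y)%C <> 0%C /\ Cmod (kernel l x0 y0 0 y) <= 2 * exp (- (l * x0))).
    { intros l0 y Hl0 Hl; specialize (Hex _ Hl).
      replace (2 * exp (- (l0 * x0))) with (/ (exp (l0 * x0) / 2)) by (rewrite exp_Ropp; field;
        apply Rgt_not_eq, exp_pos).
      apply Cmod_kernel_le; [lra|].
      unfold ratio; eapply Rle_trans; [|apply one_minus_cexp_radius].
      replace (- l0 * (0 - x0)) with (l0 * x0) by ring.
      rewrite Rabs_left; lra. }
    assert (A1 := arc_kernel_abs_le phi 0 nu b x0 y0 0 1 ltac:(lra)).
    assert (A2 := arc_kernel_abs_le phi ((1 - b) * y0) 1 1 x0 y0 0 (2 * exp (- x0)) ltac:(lra)).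
    replace (exp 0 + (1 - b) * 0) with 1 in A1 by (rewrite exp_0; ring).
    replace (exp 0 + (1 - 1) * 0) with 1 in A2 by (rewrite exp_0; ring).
    assert (A1' : Rabs (arc_kernel phi 0 nu b x0 y0 0) <= exp 1 * 1).
    { apply A1; intros y _; destruct (Hnear nu y ltac:(lra) ltac:(lra)) as [N B]; split; [easy|].
      eapply Rle_trans; [exact B|]. specialize (Hex _ Hx0); rewrite exp_Ropp.
      apply Rle_trans with (2 * / 2); [|lra]. apply Rmult_le_compat_l; [lra|]. apply
        Rinv_le_contravar; lra. }
    assert (A2' : Rabs (arc_kernel phi ((1 - b) * y0) 1 1 x0 y0 0) <= exp 1 * (2 * exp (- x0))).
    { apply A2; intros y _; destruct (Hnear 1 y ltac:(lra) ltac:(lra)) as [N B]; rewrite Rmult_1_l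
      in B; now split. }
    assert (A3 : c * Rabs (arc_kernel phi ((1 - b) * y0) 1 1 x0 y0 0) <= exp 1 * 2 * (inu * E)).
    { rewrite <- HcE; replace (exp 1 * 2 * (c * exp (- x0))) with (c * (exp 1 * (2 * exp (- x0))))
      by ring.
      apply Rmult_le_compat_l; lra. }
    assert (0 <= exp 1 * inu) by nra. assert (0 <= exp 1 * E) by nra. fold phi. lra. }
  destruct (arc_diff_jump nu b x0 y0 Hnu Hy0) as [CJ HJ].
  assert (Hall : forall eta, 0 < eta <= / 8 ->
     Rabs (l - DM 0) <= 2 * (K / gam) * (1 + E) + CJ * eta).
  { intros eta Heta.
    assert (T1 := exp_exp_tail_le DM dDM (K * (1 + E)) gam (x0 + eta) l Hgam
      (fun x Hx => Hder x ltac:(lra)) (fun x Hx => HdDM x ltac:(lra)) Hlim).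
    assert (T2 := HJ eta Heta); fold DM in T2.
    assert (T3 := Rabs_increment_le DM dDM (fun s => - (K * (1 + E) / gam) * exp (- gam * exp s))
      (fun x => K * (1 + E) * (exp x * exp (- gam * exp x))) 0 (x0 - eta) ltac:(lra)
      (fun x Hx => Hder x ltac:(lra)) (fun x _ => is_derive_exp_exp _ gam x Hgam)
      (fun x Hx => HdDM x ltac:(lra))).
    simpl in T3.
    assert (HG : K * (1 + E) / gam = K / gam * (1 + E)) by (field; lra).
    rewrite HG in T1, T3.
    set (G := K / gam * (1 + E)) in *.
    assert (HG0 : 0 < G) by (apply Rmult_lt_0_compat; lra).
    assert (Hle1 : forall s, exp (- gam * exp s) <= 1).
    { intros s; rewrite <- exp_0; apply exp_le; generalize (exp_pos s); nra. }
    assert (G * exp (- gam * exp (x0 + eta)) <= G * 1) by (apply Rmult_le_compat_l; [lra | apply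
      Hle1]).
    assert (G * exp (- gam * exp 0) <= G * 1) by (apply Rmult_le_compat_l; [lra | apply Hle1]).
    assert (0 <= G * exp (- gam * exp (x0 - eta))) by (apply Rmult_le_pos; [lra | left; apply
      exp_pos]).
    replace (l - DM 0) with ((l - DM (x0 + eta)) + ((DM (x0 + eta) - DM (x0 - eta)) + (DM (x0 -
      eta) - DM 0))) by ring.
    eapply Rle_trans; [apply Rabs_triang|].
    eapply Rle_trans; [apply Rplus_le_compat_l, Rabs_triang|].
    replace (2 * (K / gam) * (1 + E)) with (2 * G) by (unfold G; ring). lra. }
  (* Letting [eta] tend to 0 removes the jump across the pole; what remains is one tail bound from
     each side. *)
  assert (Hfin : Rabs (l - DM 0) <= 2 * (K / gam) * (1 + E)).
  { apply Rle_plus_epsilon; intros eps Heps.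
    set (C1 := Rabs CJ + 1); assert (HC1 : 0 < C1) by (unfold C1; generalize (Rabs_pos CJ); lra).
    set (eta := Rmin (/ 8) (eps / C1)).
    assert (Heta1 : eta <= / 8) by apply Rmin_l.
    assert (Heta2 : eta <= eps / C1) by apply Rmin_r.
    assert (Heta0 : 0 < eta) by (apply Rmin_pos; [lra | now apply Rdiv_lt_0_compat]).
    eapply Rle_trans; [apply (Hall eta); lra|]. apply Rplus_le_compat_l.
    apply Rle_trans with (C1 * eta).
    - apply Rmult_le_compat_r; [lra|]. unfold C1; generalize (Rle_abs CJ); lra.
    - apply Rle_trans with (C1 * (eps / C1)); [apply Rmult_le_compat_l; lra | right; field; lra]. }
  replace l with ((l - DM 0) + DM 0) by ring.
  eapply Rle_trans; [apply Rabs_triang|]. lra.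
Qed.

(** * Multisection *)

Lemma Series_multiples (d : nat -> R) (n : nat) : (0 < n)%nat ->
  (forall k, (k mod n <> 0)%nat -> d k = 0) -> ex_series d ->
  Series d = Series (fun j => d (n * j)%nat).
Proof.
  intros Hn Hd [l Hl].
  assert (Hr : forall J r, (r < n)%nat -> sum_n d (n * J + r) = sum_n d (n * J)).
  { intros J r; induction r as [|r IH]; intros Hr; [now rewrite Nat.add_0_r|].
    rewrite Nat.add_succ_r, sum_Sn, IH, Hd by (try lia;
      rewrite <- Nat.add_succ_r, Nat.add_comm, (Nat.mul_comm n), Nat.Div0.mod_add, Nat.mod_small;
        lia).
    apply Rplus_0_r. }
  assert (Hs : forall J, sum_n (fun j => d (n * j)%nat) J = sum_n d (n * J)).
  { induction J as [|J IH]; [now rewrite Nat.mul_0_r, !sum_O, Nat.mul_0_r|].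
    rewrite sum_Sn, IH.
    replace (n * S J)%nat with (S (n * J + (n - 1)))%nat by lia.
    rewrite sum_Sn, Hr by lia; easy. }
  rewrite (is_series_unique _ _ Hl); symmetry; apply is_series_unique.
  cut (is_lim_seq (sum_n (fun j => d (n * j)%nat)) l); [easy|].
  apply is_lim_seq_ext with (fun J => sum_n d (n * J)); [easy|].
  apply (is_lim_seq_subseq (sum_n d) l (fun J => (n * J)%nat)); [|exact Hl].
  apply eventually_subseq; intros; nia.
Qed.

Lemma cos_INR_PI_odd j h : cos (INR j * (PI * (2 * INR h + 1))) = (-1) ^ j.
Proof.
  assert (H : forall m, cos (INR m * PI) = (-1) ^ m).
  { induction m as [|m IH]; [simpl; rewrite Rmult_0_l; apply cos_0|].
    rewrite S_INR; replace ((INR m + 1) * PI) with (INR m * PI + PI) by ring.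
    rewrite neg_cos, IH; simpl; ring. }
  replace (INR j * (PI * (2 * INR h + 1))) with (INR (j * (2 * h + 1)) * PI)
    by (rewrite mult_INR, plus_INR, mult_INR; simpl; ring).
  rewrite H.
  replace (j * (2 * h + 1))%nat with (j + 2 * (j * h))%nat by lia.
  rewrite pow_add, (pow_mult _ 2).
  replace ((-1) ^ 2) with 1 by ring; rewrite pow1; ring.
Qed.

Lemma sin_INR_PI_div k n : (0 < n)%nat -> (k mod n <> 0)%nat -> sin (INR k * (PI / INR n)) <> 0.
Proof.
  intros Hn Hk; assert (Hpi := PI_RGT_0).
  assert (Hn' : 0 < INR n) by now apply lt_0_INR.
  assert (Hmod := Nat.mod_upper_bound k n ltac:(lia)).
  rewrite (Nat.div_mod_eq k n), plus_INR, mult_INR.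
  set (r := (k mod n)%nat) in *; set (q := (k / n)%nat).
  replace ((INR n * INR q + INR r) * (PI / INR n)) with (INR r * (PI / INR n) + INR q * PI) by
    (field; lra).
  assert (Hs : 0 < sin (INR r * (PI / INR n))).
  { assert (0 < INR r) by (apply lt_0_INR; lia).
    assert (INR r < INR n) by (apply lt_INR; lia).
    apply sin_gt_0.
    - apply Rmult_lt_0_compat; [easy | now apply Rdiv_lt_0_compat].
    - apply Rlt_le_trans with (INR n * (PI / INR n)); [|right; field; lra].
      apply Rmult_lt_compat_r; [now apply Rdiv_lt_0_compat | easy]. }
  assert (Hq : forall q, Rabs (sin (INR r * (PI / INR n) + INR q * PI)) = sin (INR r * (PI / INR
    n))).
  { induction q0 as [|q0 IH]; [simpl; rewrite Rmult_0_l, Rplus_0_r, Rabs_pos_eq; lra|].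
    rewrite S_INR, <- IH.
    replace (INR r * (PI / INR n) + (INR q0 + 1) * PI) with ((INR r * (PI / INR n) + INR q0 * PI) +
      PI) by ring.
    rewrite neg_sin; apply Rabs_Ropp. }
  intros E; specialize (Hq q); rewrite E, Rabs_R0 in Hq; lra.
Qed.

(** The angles are those of the [n]-th roots of [-1]. If [n] divides [k], all terms are
    [(-1)^(k/n)]; otherwise multiplication by [2 sin x], which is nonzero, telescopes the sum to
    [sin (2 n x) = 0]. *)
Lemma cos_sum_multisection k N :
  let n := S N in
  sum_n (fun h => cos (INR k * (PI * (2 * INR h + 1) / INR n))) N
  = if Nat.eqb (k mod n) 0 then INR n * (-1) ^ (k / n) else 0.
Proof.
  intros n; assert (Hn : 0 < INR n) by (apply lt_0_INR; unfold n; lia).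
  destruct (Nat.eqb_spec (k mod n) 0) as [Hk|Hk].
  - assert (E : k = (n * (k / n))%nat) by (rewrite (Nat.div_mod_eq k n) at 1; lia).
    transitivity (sum_n (fun _ => (-1) ^ (k / n)) N); [|apply sum_n_const].
    apply sum_n_ext; intros h.
    rewrite <- (cos_INR_PI_odd (k / n) h); f_equal.
    rewrite E at 1; rewrite mult_INR; field; lra.
  - assert (Hs := sin_INR_PI_div k n ltac:(unfold n; lia) Hk).
    set (x := INR k * (PI / INR n)) in *.
    assert (Ht : forall H, 2 * sin x * sum_n (fun h => cos (INR k * (PI * (2 * INR h + 1) / INR
      n))) H
        = sin (2 * INR (S H) * x)).
    { induction H as [|H IH].
      - rewrite sum_O; change (INR 0) with 0; change (INR 1) with 1.
        replace (INR k * (PI * (2 * 0 + 1) / INR n)) with x by (unfold x; field; lra).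
        replace (2 * 1 * x) with (2 * x) by ring. rewrite sin_2a. ring.
      - rewrite sum_Sn; unfold plus; simpl plus; rewrite Rmult_plus_distr_l, IH.
        replace (INR k * (PI * (2 * INR (S H) + 1) / INR n)) with (2 * INR (S H) * x + x)
          by (unfold x; field; lra).
        rewrite (S_INR (S H)).
        replace (2 * (INR (S H) + 1) * x) with ((2 * INR (S H) * x + x) + x) by ring.
        set (z := 2 * INR (S H) * x).
        rewrite (sin_plus (z + x) x).
        replace (sin z) with (sin ((z + x) - x)) by (f_equal; ring).
        rewrite sin_minus; ring. }
    specialize (Ht N); fold n in Ht.
    replace (sin (2 * INR n * x)) with 0 in Ht.
    + apply Rmult_integral in Ht; destruct Ht as [Ht|Ht]; [exfalso; lra | exact Ht].
    + unfold x; replace (2 * INR n * (INR k * (PI / INR n))) with (0 + 2 * INR k * PI) by (field;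
      lra).
      now rewrite sin_period, sin_0.
Qed.

Lemma Series_sum_n (f : nat -> nat -> R) N : (forall h, ex_series (f h)) ->
  ex_series (fun k => sum_n (fun h => f h k) N) /\
  sum_n (fun h => Series (f h)) N = Series (fun k => sum_n (fun h => f h k) N).
Proof.
  intros Hf; induction N as [|N [IH1 IH2]].
  - split.
    + apply ex_series_ext with (2 := Hf 0%nat); intros; now rewrite sum_O.
    + rewrite sum_O; apply Series_ext; intros; now rewrite sum_O.
  - split.
    + apply ex_series_ext with (fun k => plus (sum_n (fun h => f h k) N) (f (S N) k)).
      * intros; now rewrite sum_Sn.
      * now apply (ex_series_plus (V := R_NormedModule)).
    + rewrite sum_Sn, IH2; unfold plus; simpl.
      rewrite <- Series_plus by easy.
      apply Series_ext; intros; now rewrite sum_Sn.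
Qed.

Definition mittag_leffler (a b t : R) : R := Series (fun k => (- t) ^ k * rgamma (a * INR k + b)).

(** Summing the function with parameter [a / n] over the [n]-th roots of [- t] keeps only the
    exponents divisible by [n]. Here [t = exp (a x0)], and the roots have argument
    [PI (2 h + 1) / n]. *)
Lemma ml_multisection a b x0 N : 0 < a -> let n := S N in
  INR n * mittag_leffler a b (exp (a * x0))
   = sum_n (fun h => Series (ml_term 0 (a / INR n) b x0 (PI * (2 * INR h + 1) / a))) N.
Proof.
  intros Ha n; assert (Hn : 0 < INR n) by (apply lt_0_INR; unfold n; lia).
  set (nu := a / INR n); assert (Hnu : 0 < nu) by now apply Rdiv_lt_0_compat.
  destruct (Series_sum_n (fun h => ml_term 0 nu b x0 (PI * (2 * INR h + 1) / a)) N
    (fun h => ex_series_ml _ _ _ _ _ Hnu)) as [Hex ->].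
  assert (Hterm : forall k, sum_n (fun h => ml_term 0 nu b x0 (PI * (2 * INR h + 1) / a) k) N
    = exp (nu * INR k * x0) * rgamma (b + nu * INR k) *
      (if Nat.eqb (k mod n) 0 then INR n * (-1) ^ (k / n) else 0)).
  { intros k; unfold n; rewrite <- cos_sum_multisection; fold n.
    rewrite <- (sum_n_mult_l (K := R_AbsRing)).
    apply sum_n_ext; intros h; unfold ml_term; match goal with |- ?A = ?B => change (@eq R A B)
      end; change mult with Rmult.
    replace (nu * INR k * (PI * (2 * INR h + 1) / a) + 0)
      with (INR k * (PI * (2 * INR h + 1) / INR n)) by (unfold nu; field; lra). ring. }
  rewrite (Series_multiples _ n); [|unfold n; lia| |exact Hex].
  - unfold mittag_leffler; rewrite <- Series_scal_l; apply Series_ext; intros j.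
    rewrite Hterm.
    rewrite (Nat.mul_comm n j), Nat.Div0.mod_mul, Nat.div_mul by (unfold n; lia); simpl Nat.eqb;
      cbv iota.
    rewrite mult_INR.
    replace (nu * (INR j * INR n) * x0) with (INR j * (a * x0)) by (unfold nu; field; lra).
    replace (b + nu * (INR j * INR n)) with (a * INR j + b) by (unfold nu; field; lra).
    rewrite exp_INR_mult.
    replace (- exp (a * x0)) with (-1 * exp (a * x0)) by ring.
    rewrite Rpow_mult_distr; ring.
  - intros k Hk; rewrite Hterm.
    destruct (Nat.eqb_spec (k mod n) 0); [easy | ring].
Qed.

(** Switch for the exponential term. It is on at [a = 2], where that term oscillates without
    exponential growth. *)
Definition chi (a : R) : R := if Rlt_dec a 2 then 0 else 1.

Lemma chi_itv a : 0 <= chi a <= 1.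
Proof. unfold chi; destruct Rlt_dec; lra. Qed.

Lemma chi_cos_nonneg a : 0 <= chi a * cos (PI / a).
Proof.
  unfold chi; destruct Rlt_dec as [H|H]; [lra|]; rewrite Rmult_1_l.
  assert (Hpi := PI_RGT_0).
  assert (0 < PI / a) by (apply Rdiv_lt_0_compat; lra).
  assert (PI / a <= PI / 2) by (apply Rmult_le_compat_l; [lra | apply Rinv_le_contravar; lra]).
  apply cos_ge_0; lra.
Qed.

(* In the logarithmic variable [x0 = ln t / a]. *)
Definition log_main (a b x0 : R) : R :=
  chi a * (exp ((1 - b) * x0) * (exp (exp x0 * cos (PI / a))
    * cos (exp x0 * sin (PI / a) + (1 - b) * (PI / a)))).

(** The exponential part has [- b] where [log_main] has [1 - b]: it is smaller than the main term by
    the factor [exp x0 = t^{1/a}]. *)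
Definition log_weight (a b x0 : R) : R :=
  1 + chi a * (exp (- b * x0) * exp (exp x0 * cos (PI / a))).

Lemma log_weight_ge_1 a b x0 : 1 <= log_weight a b x0.
Proof.
  unfold log_weight.
  assert (0 <= chi a * (exp (- b * x0) * exp (exp x0 * cos (PI / a)))); [|lra].
  apply Rmult_le_pos; [apply chi_itv | apply Rmult_le_pos; left; apply exp_pos].
Qed.

(** The reflection replaces [z] by its conjugate, which does not change real parts. *)
Lemma ml_term_reflect nu b x0 y k : 0 < nu ->
  ml_term 0 nu b x0 (2 * PI / nu - y) k = ml_term 0 nu b x0 y k.
Proof.
  intros Hnu; unfold ml_term; do 2 f_equal.
  rewrite <- (cos_neg (nu * INR k * y + 0)).
  rewrite <- (cos_period (- (nu * INR k * y + 0)) k).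
  f_equal; field; lra.
Qed.

(** Only the conjugate roots [h = 0] and [h = N], closest to the positive axis, can contribute a
    main term. The others are either exponentially smaller or bounded. *)
Lemma ml_term_asym a b N h : 0 < a < INR (S N) -> (h <= N)%nat ->
  exists C, 0 <= C /\ forall x0, 1 <= a / INR (S N) * x0 ->
   Rabs (Series (ml_term 0 (a / INR (S N)) b x0 (PI * (2 * INR h + 1) / a))
     - (if (Nat.eqb h 0 || Nat.eqb h N)%bool then INR (S N) / a * log_main a b x0 else 0))
    <= C * log_weight a b x0.
Proof.
  intros Ha Hh; assert (Hpi := PI_RGT_0).
  set (n := INR (S N)) in *.
  set (nu := a / n).
  assert (Hnu : 0 < nu < 1).
  { split; [apply Rdiv_lt_0_compat; lra|]. apply (Rmult_lt_reg_r n); [lra|].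
    unfold nu; unfold Rdiv; rewrite Rmult_assoc, Rinv_l; lra. }
  (* Reflection gives an index with [2 h' <= N], that is [y <= PI / nu], as [ml_bounded]
     requires. *)
  assert (Hrefl : exists h', (2 * h' <= N)%nat /\
     (h' = 0%nat <-> (Nat.eqb h 0 || Nat.eqb h N)%bool = true) /\
     forall x0, Series (ml_term 0 nu b x0 (PI * (2 * INR h + 1) / a))
        = Series (ml_term 0 nu b x0 (PI * (2 * INR h' + 1) / a))).
  { destruct (Nat.le_gt_cases (2 * h) N) as [Hle|Hgt].
    - exists h; split; [easy|split; [|easy]].
      destruct (Nat.eqb_spec h 0), (Nat.eqb_spec h N); simpl; split; intros; try easy; lia.
    - exists (N - h)%nat; split; [lia | split].
      + destruct (Nat.eqb_spec h 0), (Nat.eqb_spec h N); simpl; split; intros; try easy; lia.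
      + intros x0; apply Series_ext; intros k.
        rewrite <- (ml_term_reflect nu b x0 _ k) by lra; f_equal.
        rewrite minus_INR by easy; unfold nu, n; rewrite S_INR; field.
        assert (En : n = INR N + 1) by apply S_INR. repeat split; lra. }
  destruct Hrefl as (h' & Hh' & Hz & Hs).
  set (y := PI * (2 * INR h' + 1) / a) in *.
  assert (Hh'0 := pos_INR h').
  assert (Hy1 : PI / a <= y).
  { unfold y; apply Rmult_le_compat_r; [left; apply Rinv_0_lt_compat; lra|].
    assert (0 <= PI * INR h') by (apply Rmult_le_pos; lra). lra. }
  assert (Hy2 : y <= PI / nu).
  { unfold y, nu; replace (PI / (a / n)) with (PI * n / a) by (field; lra).
    apply Rmult_le_compat_r; [left; apply Rinv_0_lt_compat; lra|].
    apply Rmult_le_compat_l; [lra|]. apply le_INR in Hh'; unfold n; rewrite mult_INR in Hh';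
      rewrite S_INR; simpl in Hh'; lra. }
  assert (Hpa : 0 < PI / a) by (apply Rdiv_lt_0_compat; lra).
  assert (Hw := log_weight_ge_1 a b).
  destruct (Rle_lt_dec y (PI / 2)) as [Hy|Hy].
  - assert (Hchi : chi a = 1).
    { unfold chi; destruct Rlt_dec as [H|H]; [exfalso|easy].
      assert (PI / 2 < PI / a); [|lra].
      apply Rmult_lt_compat_l; [lra|]. apply Rinv_lt_contravar; lra. }
    assert (Hca := chi_cos_nonneg a); rewrite Hchi, Rmult_1_l in Hca.
    destruct (ml_exponential nu b y Hnu ltac:(lra)) as (C & HC0 & HC).
    assert (Hlow : forall x0, 1 + exp (- b * x0) <= log_weight a b x0).
    { intros x0; unfold log_weight; rewrite Hchi, Rmult_1_l.
      apply Rplus_le_compat_l; rewrite <- (Rmult_1_r (exp (- b * x0))) at 1.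
      apply Rmult_le_compat_l; [left; apply exp_pos|].
      rewrite <- exp_0; apply exp_le, Rmult_le_pos; [left; apply exp_pos | easy]. }
    destruct (Nat.eq_dec h' 0) as [E|E].
    + exists C; split; [easy|]; intros x0 Hx0; rewrite Hs.
      rewrite (proj1 Hz E).
      replace (n / a * log_main a b x0) with (exp ((1 - b) * x0) * / nu *
        (exp (exp x0 * cos y) * cos (exp x0 * sin y + (1 - b) * y))).
      * eapply Rle_trans; [apply HC, Hx0|]; apply Rmult_le_compat_l; auto.
      * unfold log_main; rewrite Hchi.
        replace y with (PI / a) by (unfold y; rewrite E; simpl; field; lra).
        unfold nu; field; lra.
    (* Here [y >= 3 PI / a], so [cos y < cos (PI / a)]. The resulting gain [exp (- del * exp x0)]
       absorbs the missing factor [exp x0]. *)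
    + assert (Hh1 : 1 <= INR h') by (apply (le_INR 1); lia).
      assert (Hy3 : 3 * (PI / a) <= y).
      { unfold y; replace (3 * (PI / a)) with (PI * 3 / a) by (field; lra).
        apply Rmult_le_compat_r; [left; apply Rinv_0_lt_compat; lra|].
        apply Rmult_le_compat_l; lra. }
      assert (Hcos : cos y < cos (PI / a)) by (apply cos_decreasing_1; lra).
      set (del := cos (PI / a) - cos y).
      assert (Hdel : 0 < del) by (unfold del; lra).
      assert (Hid : 0 < / nu * / del) by (apply Rmult_lt_0_compat; apply Rinv_0_lt_compat; lra).
      exists (/ nu * / del + C); split; [lra|]; intros x0 Hx0; rewrite Hs.
      destruct (Nat.eqb h 0 || Nat.eqb h N)%bool; [exfalso; now apply E, Hz|].
      rewrite Rminus_0_r.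
      set (X := exp ((1 - b) * x0) * / nu * (exp (exp x0 * cos y) * cos (exp x0 * sin y + (1 - b) *
        y))).
      replace (Series (ml_term 0 nu b x0 y)) with (X + (Series (ml_term 0 nu b x0 y) - X)) by ring.
      eapply Rle_trans; [apply Rabs_triang|]; rewrite Rmult_plus_distr_r.
      apply Rplus_le_compat.
      * unfold X; rewrite !Rabs_mult.
        rewrite (Rabs_pos_eq (exp ((1 - b) * x0))), (Rabs_pos_eq (/ nu)), (Rabs_pos_eq (exp (exp x0
          * cos y)))
          by (left; try apply exp_pos; apply Rinv_0_lt_compat; lra).
        apply Rle_trans with (exp ((1 - b) * x0) * / nu * (exp (exp x0 * cos y) * 1)).
        { apply Rmult_le_compat_l; [apply Rmult_le_pos; left; [apply exp_pos | apply
          Rinv_0_lt_compat; lra]|].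
          apply Rmult_le_compat_l; [left; apply exp_pos | apply Rabs_le, COS_bound]. }
        apply Rle_trans with (/ nu * / del * (exp (- b * x0) * exp (exp x0 * cos (PI / a)))).
        2:{ apply Rmult_le_compat_l; [lra|]. unfold log_weight; rewrite Hchi; lra. }
        replace (exp x0 * cos (PI / a)) with (exp x0 * cos y + del * exp x0) by (unfold del; ring).
        replace ((1 - b) * x0) with (x0 + - b * x0) by ring.
        rewrite !exp_plus.
        assert (Hd : exp x0 <= / del * exp (del * exp x0)).
        { apply (Rmult_le_reg_l del); [easy|]. rewrite <- Rmult_assoc, Rinv_r, Rmult_1_l by lra.
          generalize (exp_ineq1_le (del * exp x0)); lra. }
        assert (HP : 0 <= / nu * (exp (- b * x0) * exp (exp x0 * cos y))).
        { apply Rmult_le_pos; [left; apply Rinv_0_lt_compat; lra|]. apply Rmult_le_pos; left; apply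
          exp_pos. }
        assert (H := Rmult_le_compat_l _ _ _ HP Hd). lra.
      * eapply Rle_trans; [apply HC, Hx0|]; apply Rmult_le_compat_l; auto.
  (* For the principal root, [y = PI / a > PI / 2] means [a < 2], and then [chi] makes the main term
     vanish. *)
  - destruct (ml_bounded 0 nu b y Hnu ltac:(lra)) as [C HC].
    assert (HC0 : 0 <= C) by (eapply Rle_trans; [apply Rabs_pos | apply (HC 0)]).
    exists C; split; [easy|]; intros x0 Hx0; rewrite Hs.
    replace (if (Nat.eqb h 0 || Nat.eqb h N)%bool then n / a * log_main a b x0 else 0) with 0.
    + rewrite Rminus_0_r; specialize (HC x0); specialize (Hw x0); nra.
    + destruct (Nat.eqb h 0 || Nat.eqb h N)%bool; [|easy].
      assert (E : h' = 0%nat) by now apply Hz.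
      unfold log_main, chi; destruct Rlt_dec as [H|H]; [ring|exfalso].
      assert (y = PI / a) by (unfold y; rewrite E; simpl; field; lra).
      assert (PI / a <= PI / 2) by (apply Rmult_le_compat_l; [lra | apply Rinv_le_contravar; lra]).
      lra.
Qed.

Lemma sum_n_bound {X : Type} (P : X -> Prop) (f : nat -> X -> R) (w : X -> R) N :
  (forall h, (h <= N)%nat -> exists C, 0 <= C /\ forall x, P x -> Rabs (f h x) <= C * w x) ->
  exists C, 0 <= C /\ forall x, P x -> Rabs (sum_n (fun h => f h x) N) <= C * w x.
Proof.
  induction N as [|N IH]; intros H.
  - destruct (H 0%nat (le_n _)) as (C & HC0 & HC); exists C; split; [easy|].
    intros x Hx; rewrite sum_O; now apply HC.
  - destruct IH as (C1 & HC1 & H1); [intros; apply H; lia|].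
    destruct (H (S N) (le_n _)) as (C2 & HC2 & H2).
    exists (C1 + C2); split; [lra|]; intros x Hx; rewrite sum_Sn, Rmult_plus_distr_r.
    eapply Rle_trans; [apply Rabs_triang|]; apply Rplus_le_compat; auto.
Qed.

Lemma sum_n_Rminus (f g : nat -> R) N : sum_n (fun h => f h - g h) N = sum_n f N - sum_n g N.
Proof.
  induction N as [|N IH]; [now rewrite !sum_O|].
  rewrite !sum_Sn, IH; unfold plus; simpl; ring.
Qed.

Lemma sum_n_ends (M : R) N : (1 <= N)%nat ->
  sum_n (fun h => if (Nat.eqb h 0 || Nat.eqb h N)%bool then M else 0) N = 2 * M.
Proof.
  intros HN; destruct N as [|N]; [lia|clear HN].
  rewrite sum_Sn, Nat.eqb_refl, Bool.orb_true_r.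
  assert (H : forall J, (J <= N)%nat ->
    sum_n (fun h => if (Nat.eqb h 0 || Nat.eqb h (S N))%bool then M else 0) J = M).
  { induction J as [|J IH]; intros HJ; [now rewrite sum_O|].
    rewrite sum_Sn, IH by lia.
    destruct (Nat.eqb_spec (S J) 0), (Nat.eqb_spec (S J) (S N)); simpl; try lia.
    apply Rplus_0_r. }
  rewrite H by easy; unfold plus; simpl; ring.
Qed.

Lemma mittag_leffler_log_asym a b : 0 < a ->
  exists C X, 0 <= C /\ forall x0, X <= x0 ->
   Rabs (mittag_leffler a b (exp (a * x0)) - 2 / a * log_main a b x0) <= C * log_weight a b x0.
Proof.
  intros Ha.
  destruct (nfloor_ex a (Rlt_le _ _ Ha)) as [M HM].
  (* [n = M + 2] exceeds [a], and [N >= 1] keeps the conjugate indices [0] and [N] distinct, which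
     produces the factor 2 of the main term. *)
  set (N := S M); set (n := INR (S N)).
  assert (Hn : a < n) by (unfold n, N; rewrite S_INR, S_INR; lra).
  destruct (sum_n_bound (fun x0 => 1 <= a / n * x0)
    (fun h x0 => Series (ml_term 0 (a / n) b x0 (PI * (2 * INR h + 1) / a))
      - (if (Nat.eqb h 0 || Nat.eqb h N)%bool then n / a * log_main a b x0 else 0))
    (log_weight a b) N) as (C & HC0 & HC).
  { intros h Hh; apply ml_term_asym; [split; [lra | exact Hn] | easy]. }
  exists (C / n), (n / a); split; [apply Rdiv_le_0_compat; lra|].
  intros x0 Hx0.
  assert (Hx0' : 1 <= a / n * x0).
  { apply Rle_trans with (a / n * (n / a)); [right; field; lra|].
    apply Rmult_le_compat_l; [left; apply Rdiv_lt_0_compat; lra | easy]. }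
  specialize (HC x0 Hx0').
  apply (Rmult_le_reg_l n); [lra|].
  replace (n * (C / n * log_weight a b x0)) with (C * log_weight a b x0) by (field; lra).
  rewrite <- (Rabs_pos_eq n) at 1 by lra; rewrite <- Rabs_mult, Rmult_minus_distr_l.
  unfold n at 1; rewrite ml_multisection by easy; fold n.
  replace (n * (2 / a * log_main a b x0)) with (2 * (n / a * log_main a b x0)) by (field; lra).
  rewrite <- (sum_n_ends (n / a * log_main a b x0) N) by (unfold N; lia).
  now rewrite <- sum_n_Rminus.
Qed.

(** * Weights *)

(** With [1 + t] in place of [t] the power stays harmless near 0: the bounds must hold on all of
    [(0, t)] for the averaging argument. *)
Definition weight (a b t : R) : R :=
  1 + chi a * (Rpower (1 + t) ((1 - b) / a) * exp (Rpower t (/ a) * cos (PI / a))).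

Lemma weight_ge_1 a b t : 1 <= weight a b t.
Proof.
  unfold weight; assert (0 <= chi a * (Rpower (1 + t) ((1 - b) / a) * exp (Rpower t (/ a) * cos (PI
    / a)))); [|lra].
  apply Rmult_le_pos; [apply chi_itv | apply Rmult_le_pos; left; apply exp_pos].
Qed.

Lemma ln_nonneg (x : R) : 1 <= x -> 0 <= ln x.
Proof. intros H; rewrite <- ln_1; apply ln_le; lra. Qed.

Lemma weight_mono a b b' t : 0 < a -> b <= b' -> 0 < t -> weight a b' t <= weight a b t.
Proof.
  intros Ha Hb Ht; unfold weight; apply Rplus_le_compat_l.
  apply Rmult_le_compat_l; [apply chi_itv|].
  apply Rmult_le_compat_r; [left; apply exp_pos|].
  apply exp_le, Rmult_le_compat_r; [apply ln_nonneg; lra|].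
  apply Rmult_le_compat_r; [left; now apply Rinv_0_lt_compat | lra].
Qed.

(** For [b > 1] the power of [1 + t] decreases, so the weight need not be monotone. The exponent
    measures the loss, and it is the threshold that [X] must exceed for [1 / (k + X)] to act
    boundedly. *)
Lemma weight_dilation a b s t : 0 < a -> 0 < s <= t ->
  weight a b s <= Rpower (t / s) (Rmax 0 ((b - 1) / a)) * weight a b t.
Proof.
  intros Ha Hs.
  set (q := (1 - b) / a).
  assert (Hq1 : 0 <= Rmax 0 ((b - 1) / a)) by apply Rmax_l.
  assert (Hq2 : - q <= Rmax 0 ((b - 1) / a)).
  { eapply Rle_trans; [|apply Rmax_r]; unfold q; right; field; lra. }
  set (M := Rmax 0 ((b - 1) / a)) in *.
  assert (Hts : 1 <= t / s) by (apply Rle_div_r; lra).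
  assert (HL := ln_nonneg _ Hts).
  assert (H1 : 1 <= Rpower (t / s) M).
  { unfold Rpower; rewrite <- exp_0; apply exp_le, Rmult_le_pos; easy. }
  unfold weight; rewrite Rmult_plus_distr_l; apply Rplus_le_compat; [lra|].
  rewrite (Rmult_comm (Rpower (t / s) M)), Rmult_assoc.
  assert (Hk := chi_cos_nonneg a).
  unfold chi in *; destruct Rlt_dec; [lra|]; rewrite Rmult_1_l in *; rewrite Rmult_1_l.
  fold q; change (Rpower (1 + s) q) with (exp (q * ln (1 + s))).
  change (Rpower (1 + t) q) with (exp (q * ln (1 + t))).
  change (Rpower (t / s) M) with (exp (M * ln (t / s))).
  rewrite <- !exp_plus; apply exp_le.
  assert (HR : Rpower s (/ a) <= Rpower t (/ a)).
  { apply Rle_Rpower_l; [left; now apply Rinv_0_lt_compat | easy]. }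
  assert (HR2 : Rpower s (/ a) * cos (PI / a) <= Rpower t (/ a) * cos (PI / a)) by now apply
    Rmult_le_compat_r.
  assert (Hln : 0 <= ln (1 + t) - ln (1 + s) <= ln (t / s)).
  { rewrite ln_div by lra. split.
    - assert (ln (1 + s) <= ln (1 + t)) by (apply ln_le; lra). lra.
    - assert (ln ((1 + t) * s) <= ln (t * (1 + s))) by (apply ln_le; nra).
      rewrite !ln_mult in H by lra. lra. }
  assert (q * (ln (1 + s) - ln (1 + t)) <= M * ln (t / s)) by nra.
  lra.
Qed.

Lemma Rpower_shift (q t : R) : 1 <= t -> Rpower t q <= Rpower 2 (Rabs q) * Rpower (1 + t) q.
Proof.
  intros Ht; unfold Rpower; rewrite <- exp_plus; apply exp_le.
  assert (H1 : ln t <= ln (1 + t)) by (apply ln_le; lra).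
  assert (H2 : ln (1 + t) <= ln 2 + ln t) by (rewrite <- ln_mult by lra; apply ln_le; lra).
  assert (H3 : q * (ln t - ln (1 + t)) <= Rabs q * ln 2); [|lra].
  eapply Rle_trans; [apply Rle_abs|]; rewrite Rabs_mult.
  apply Rmult_le_compat_l; [apply Rabs_pos | apply Rabs_le; lra].
Qed.

Lemma log_weight_le a b t : 0 < a -> 1 <= t ->
  log_weight a b (ln t / a) <= Rpower 2 (Rabs (- b / a)) * weight a (b + 1) t.
Proof.
  intros Ha Ht; unfold log_weight, weight.
  replace (exp (ln t / a)) with (Rpower t (/ a)) by (unfold Rpower; f_equal; field; lra).
  replace (exp (- b * (ln t / a))) with (Rpower t (- b / a)) by (unfold Rpower; f_equal; field;
    lra).
  replace ((1 - (b + 1)) / a) with (- b / a) by (field; lra).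
  assert (H := Rpower_shift (- b / a) t Ht).
  assert (H1 : 1 <= Rpower 2 (Rabs (- b / a))).
  { unfold Rpower; rewrite <- exp_0; apply exp_le, Rmult_le_pos; [apply Rabs_pos | apply ln_nonneg;
    lra]. }
  rewrite Rmult_plus_distr_l; apply Rplus_le_compat; [lra|].
  set (P := Rpower 2 (Rabs (- b / a))) in *; set (Q := Rpower (1 + t) (- b / a)) in *.
  set (X := exp (Rpower t (/ a) * cos (PI / a))).
  replace (P * (chi a * (Q * X))) with (chi a * (P * Q * X)) by ring.
  apply Rmult_le_compat_l; [apply chi_itv|].
  apply Rmult_le_compat_r; [left; apply exp_pos | easy].
Qed.

Lemma log_main_le a b t : 0 < a -> 1 <= t ->
  Rabs (log_main a b (ln t / a)) <= Rpower 2 (Rabs ((1 - b) / a)) * weight a b t.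
Proof.
  intros Ha Ht.
  assert (H := log_weight_le a (b - 1) t Ha Ht).
  replace (b - 1 + 1) with b in H by ring; replace (- (b - 1) / a) with ((1 - b) / a) in H by
    (field; lra).
  eapply Rle_trans; [|exact H].
  unfold log_main, log_weight.
  replace (- (b - 1)) with (1 - b) by ring.
  assert (Hc := chi_itv a).
  assert (HE : 0 < exp ((1 - b) * (ln t / a)) * exp (exp (ln t / a) * cos (PI / a)))
    by (apply Rmult_lt_0_compat; apply exp_pos).
  assert (HC : Rabs (cos (exp (ln t / a) * sin (PI / a) + (1 - b) * (PI / a))) <= 1) by apply
    Rabs_le, COS_bound.
  assert (HC0 := Rabs_pos (cos (exp (ln t / a) * sin (PI / a) + (1 - b) * (PI / a)))).
  set (E1 := exp ((1 - b) * (ln t / a))) in *; set (E2 := exp (exp (ln t / a) * cos (PI / a))) in *.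
  rewrite !Rabs_mult, (Rabs_pos_eq (chi a)), (Rabs_pos_eq E1), (Rabs_pos_eq E2)
    by (try lra; left; apply exp_pos).
  set (D := Rabs (cos (exp (ln t / a) * sin (PI / a) + (1 - b) * (PI / a)))) in *.
  replace (E1 * (E2 * D)) with (E1 * E2 * D) by ring.
  assert (chi a * (E1 * E2 * D) <= chi a * (E1 * E2)); [|lra].
  apply Rmult_le_compat_l; [lra|]. nra.
Qed.

Lemma mittag_leffler_asym a b : 0 < a -> exists C T, 0 <= C /\ 1 <= T /\ forall t, T <= t ->
  Rabs (mittag_leffler a b t - 2 / a * log_main a b (ln t / a)) <= C * weight a (b + 1) t.
Proof.
  intros Ha; destruct (mittag_leffler_log_asym a b Ha) as (C & X & HC0 & HC).
  exists (C * Rpower 2 (Rabs (- b / a))), (Rmax 1 (exp (a * X))); split; [|split].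
  - apply Rmult_le_pos; [easy | left; apply exp_pos].
  - apply Rmax_l.
  - intros t Ht.
    assert (Ht1 : 1 <= t) by (eapply Rle_trans; [apply Rmax_l | exact Ht]).
    assert (Ht2 : exp (a * X) <= t) by (eapply Rle_trans; [apply Rmax_r | exact Ht]).
    assert (HX : X <= ln t / a).
    { apply Rle_div_r; [easy|]. rewrite <- (ln_exp (X * a)); apply ln_le; [apply exp_pos|].
      now rewrite Rmult_comm. }
    specialize (HC _ HX).
    replace (exp (a * (ln t / a))) with t in HC
      by (replace (a * (ln t / a)) with (ln t) by (field; lra); rewrite exp_ln; lra).
    eapply Rle_trans; [exact HC|]; rewrite Rmult_assoc; apply Rmult_le_compat_l; [easy|].
    now apply log_weight_le.
Qed.

Lemma Rabs_Series_entire_le (c : nat -> R) (s t : R) : entire c -> 0 <= s <= t ->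
  Rabs (Series (fun k => (- s) ^ k * c k)) <= Series (fun k => Rabs (c k) * t ^ k).
Proof.
  intros Hc Hs.
  assert (Ht : ex_series (fun k => Rabs (c k) * t ^ k)) by (apply Hc; lra).
  assert (Hle : forall k, Rabs ((- s) ^ k * c k) <= Rabs (c k) * t ^ k).
  { intros k; rewrite Rabs_mult, <- RPow_abs, Rabs_Ropp, (Rabs_pos_eq s), Rmult_comm by lra.
    apply Rmult_le_compat_l; [apply Rabs_pos | now apply pow_incr]. }
  eapply Rle_trans; [apply Series_Rabs|].
  - apply (ex_series_le (K := R_AbsRing) (V := R_CompleteNormedModule) _ (fun k => Rabs (c k) * t ^
    k)); [|easy].
    intros k; change norm with Rabs; simpl; rewrite Rabs_Rabsolu; apply Hle.
  - apply Series_le; [|easy]; intros k; split; [apply Rabs_pos | apply Hle].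
Qed.

Definition bounded_by (W : R -> R) (c : nat -> R) (B : R) : Prop :=
  entire c /\ forall t, 0 < t -> Rabs (Series (fun k => (- t) ^ k * c k)) <= B * W t.

(** The asymptotics cover [t > T]; on [(0, T]] the series of absolute values at [T] suffices, since
    the weight is at least 1. *)
Lemma bounded_mittag_leffler a b : 0 < a ->
  exists B, bounded_by (weight a b) (fun k => rgamma (a * INR k + b)) B.
Proof.
  intros Ha; destruct (mittag_leffler_asym a b Ha) as (C & T & HC0 & HT & HC).
  assert (He := entire_rgamma a b Ha).
  set (S := Series (fun k => Rabs (rgamma (a * INR k + b)) * T ^ k)).
  assert (HS : 0 <= S).
  { eapply Rle_trans; [apply Rabs_pos | apply (Rabs_Series_entire_le _ 0 T He); lra]. }
  set (D := 2 / a * Rpower 2 (Rabs ((1 - b) / a))).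
  assert (HD : 0 < D) by (apply Rmult_lt_0_compat; [apply Rdiv_lt_0_compat; lra | apply exp_pos]).
  exists (S + D + C); split; [easy|]; intros t Ht.
  assert (Hw := weight_ge_1 a b t).
  destruct (Rle_lt_dec t T) as [H|H].
  - eapply Rle_trans; [apply (Rabs_Series_entire_le _ t T He); lra|]; fold S. nra.
  - specialize (HC t (Rlt_le _ _ H)); unfold mittag_leffler in HC.
    set (F := Series (fun k => (- t) ^ k * rgamma (a * INR k + b))) in *.
    replace F with (2 / a * log_main a b (ln t / a) + (F - 2 / a * log_main a b (ln t / a))) by
      ring.
    eapply Rle_trans; [apply Rabs_triang|].
    assert (H1 := log_main_le a b t Ha ltac:(lra)).
    assert (H2 := weight_mono a b (b + 1) t Ha ltac:(lra) Ht).
    assert (H3 : Rabs (2 / a * log_main a b (ln t / a)) <= D * weight a b t).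
    { rewrite Rabs_mult, (Rabs_pos_eq (2 / a)) by (left; apply Rdiv_lt_0_compat; lra).
      unfold D; rewrite Rmult_assoc; apply Rmult_le_compat_l; [left; apply Rdiv_lt_0_compat; lra |
        easy]. }
    assert (C * weight a (b + 1) t <= C * weight a b t) by now apply Rmult_le_compat_l.
    assert (0 <= S * weight a b t) by (apply Rmult_le_pos; lra). lra.
Qed.

(** * Coefficient multipliers *)

Lemma tannery (u : nat -> nat -> R) (v l : nat -> R) : ex_series v ->
  (forall n k, Rabs (u n k) <= v k) -> (forall k, is_lim_seq (fun n => u n k) (l k)) ->
  is_lim_seq (fun n => Series (u n)) (Series l).
Proof.
  intros Hv Hu Hl.
  assert (Hlv : forall k, Rabs (l k) <= v k).
  { intros k; apply (is_lim_seq_le (fun n => Rabs (u n k)) (fun _ => v k) (Rabs (l k)) (v k)).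
    - intros; apply Hu.
    - apply (is_lim_seq_abs _ (l k)), Hl.
    - apply is_lim_seq_const. }
  assert (Hexu : forall w : nat -> R, (forall k, Rabs (w k) <= v k) -> ex_series w).
  { intros w Hw; apply (ex_series_le (K := R_AbsRing) (V := R_CompleteNormedModule) w v); [exact Hw
    | easy]. }
  assert (Htail : forall w : nat -> R, (forall k, Rabs (w k) <= v k) -> forall N,
    Rabs (Series w - sum_n w N) <= Series v - sum_n v N).
  { intros w Hw N.
    rewrite (Series_incr_n w (S N)), (Series_incr_n v (S N)) by (try lia; auto).
    rewrite !sum_n_Reals; simpl pred.
    replace (sum_f_R0 w N + Series (fun k => w (S N + k)%nat) - sum_f_R0 w N)
      with (Series (fun k => w (S N + k)%nat)) by ring.
    replace (sum_f_R0 v N + Series (fun k => v (S N + k)%nat) - sum_f_R0 v N)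
      with (Series (fun k => v (S N + k)%nat)) by ring.
    eapply Rle_trans; [apply Series_Rabs|].
    - apply (ex_series_incr_n (V := R_NormedModule) (fun k => Rabs (w k)) (S N)), Hexu.
      intros k; rewrite Rabs_Rabsolu; apply Hw.
    - apply Series_le.
      + intros k; split; [apply Rabs_pos | apply Hw].
      + now apply (ex_series_incr_n (V := R_NormedModule) v (S N)). }
  apply is_lim_seq_spec; intros eps.
  assert (He3 : 0 < eps / 3) by (generalize (cond_pos eps); lra).
  destruct Hv as [V HV].
  assert (HVs : is_lim_seq (sum_n v) V) by exact HV.
  apply is_lim_seq_spec in HVs; destruct (HVs (mkposreal _ He3)) as [N HN].
  specialize (HN N (le_n N)); simpl in HN; rewrite <- (is_series_unique _ _ HV) in HN.
  rewrite Rabs_minus_sym in HN; assert (HN' := Rle_abs (Series v - sum_n v N)).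
  assert (Hfin : is_lim_seq (fun n => sum_n (u n) N) (sum_n l N)).
  { clear - Hl; induction N as [|N IH].
    - apply is_lim_seq_ext with (fun n => u n 0%nat); [intros; now rewrite sum_O | rewrite sum_O;
      apply Hl].
    - apply is_lim_seq_ext with (fun n => sum_n (u n) N + u n (S N)); [intros; now rewrite sum_Sn|].
      rewrite sum_Sn; now apply is_lim_seq_plus'. }
  apply is_lim_seq_spec in Hfin; destruct (Hfin (mkposreal _ He3)) as [n0 Hn0].
  exists n0; intros n Hn; specialize (Hn0 n Hn); simpl in Hn0.
  assert (H1 := Htail (u n) (Hu n) N); assert (H2 := Htail l Hlv N).
  apply Rabs_lt_between in Hn0; apply Rabs_le_between in H1; apply Rabs_le_between in H2.
  apply Rabs_lt_between; lra.
Qed.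

Lemma Series_neg_pow_PSeries (c : nat -> R) (t : R) :
  Series (fun k => (- t) ^ k * c k) = PSeries (fun k => (-1) ^ k * c k) t.
Proof.
  apply Series_ext; intros k.
  replace (- t) with (-1 * t) by ring; rewrite Rpow_mult_distr; ring.
Qed.

Lemma entire_ext (c d : nat -> R) : (forall k, c k = d k) -> entire c -> entire d.
Proof. intros H Hc t Ht; apply ex_series_ext with (2 := Hc t Ht); intros; now rewrite H. Qed.

Lemma entire_le (c d : nat -> R) (C : R) : entire c -> (forall k, Rabs (d k) <= C * Rabs (c k)) ->
  entire d.
Proof.
  intros Hc Hd t Ht.
  apply (ex_series_le (K := R_AbsRing) (V := R_CompleteNormedModule) _ (fun k => C * (Rabs (c k) *
    t ^ k))).
  - intros k; change norm with Rabs; simpl.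
    rewrite Rabs_mult, Rabs_Rabsolu, (Rabs_pos_eq (t ^ k)) by now apply pow_le.
    rewrite <- Rmult_assoc; apply Rmult_le_compat_r; [now apply pow_le | apply Hd].
  - apply (ex_series_scal (V := R_NormedModule)), Hc, Ht.
Qed.

Lemma entire_sign (c : nat -> R) : entire c -> entire (fun k => (-1) ^ k * c k).
Proof.
  intros Hc; apply entire_le with (c := c) (C := 1); [easy|].
  intros k; rewrite Rabs_mult, pow_1_abs; lra.
Qed.

Lemma entire_ex_series_neg (c : nat -> R) (t : R) : entire c -> ex_series (fun k => (- t) ^ k * c
  k).
Proof.
  intros Hc; apply ex_series_ext with (2 := entire_ex_pseries c (- t) Hc); intros; simpl; ring.
Qed.

Lemma bounded_by_plus W c d B D : bounded_by W c B -> bounded_by W d D ->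
  bounded_by W (fun k => c k + d k) (B + D).
Proof.
  intros [Hc HB] [Hd HD]; split.
  - intros t Ht.
    apply (ex_series_le (K := R_AbsRing) (V := R_CompleteNormedModule) _ (fun k => Rabs (c k) * t ^
      k + Rabs (d k) * t ^ k)).
    + intros k; change norm with Rabs; simpl.
      rewrite Rabs_mult, Rabs_Rabsolu, (Rabs_pos_eq (t ^ k)) by now apply pow_le.
      rewrite <- Rmult_plus_distr_r; apply Rmult_le_compat_r; [now apply pow_le | apply
        Rabs_triang].
    + apply (ex_series_plus (V := R_NormedModule)); auto.
  - intros t Ht.
    replace (Series (fun k => (- t) ^ k * (c k + d k))) with
      (Series (fun k => (- t) ^ k * c k) + Series (fun k => (- t) ^ k * d k)).
    + eapply Rle_trans; [apply Rabs_triang|]; rewrite Rmult_plus_distr_r.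
      apply Rplus_le_compat; auto.
    + rewrite <- Series_plus by now apply entire_ex_series_neg.
      apply Series_ext; intros; ring.
Qed.

Lemma bounded_by_ext W c d B : (forall k, c k = d k) -> bounded_by W c B -> bounded_by W d B.
Proof.
  intros H [Hc HB]; split; [now apply entire_ext with c|].
  intros t Ht; rewrite (Series_ext _ (fun k => (- t) ^ k * c k)); [now apply HB | intros; now
    rewrite H].
Qed.

Lemma bounded_by_scal W c r B : bounded_by W c B -> bounded_by W (fun k => r * c k) (Rabs r * B).
Proof.
  intros [Hc HB]; split.
  - apply entire_le with (c := c) (C := Rabs r); [easy|]; intros; rewrite Rabs_mult; lra.
  - intros t Ht.
    replace (Series (fun k => (- t) ^ k * (r * c k))) with (r * Series (fun k => (- t) ^ k * c k)).
    + rewrite Rabs_mult, Rmult_assoc; apply Rmult_le_compat_l; [apply Rabs_pos | auto].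
    + rewrite <- Series_scal_l; apply Series_ext; intros; ring.
Qed.

(** The pointwise bound by the same constant is part of the definition because it supplies the
    domination when multipliers pass to a limit. *)
Definition multiplier (W : R -> R) (f : nat -> R) (C : R) : Prop :=
  (forall k, Rabs (f k) <= C) /\
  forall c B, bounded_by W c B -> bounded_by W (fun k => f k * c k) (C * B).

Section Multipliers.

Variables (W : R -> R) (M : R).
Hypothesis W_ge_1 : forall t, 0 < t -> 1 <= W t.
Hypothesis W_dilation : forall s t, 0 < s <= t -> W s <= Rpower (t / s) M * W t.
Hypothesis M_nonneg : 0 <= M.

Lemma bounded_by_nonneg c B : bounded_by W c B -> 0 <= B.
Proof.
  intros [_ H]; specialize (H 1 Rlt_0_1).
  assert (0 <= B * W 1) by (eapply Rle_trans; [apply Rabs_pos | exact H]).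
  generalize (W_ge_1 1 Rlt_0_1); intros; nra.
Qed.

Lemma multiplier_nonneg f C : multiplier W f C -> 0 <= C.
Proof. intros [H _]; eapply Rle_trans; [apply Rabs_pos | apply (H 0%nat)]. Qed.

Lemma bounded_by_weaken c B D : B <= D -> bounded_by W c B -> bounded_by W c D.
Proof.
  intros HBD [Hc HB]; split; [easy|]; intros t Ht; eapply Rle_trans; [now apply HB|].
  apply Rmult_le_compat_r; [generalize (W_ge_1 t Ht); lra | easy].
Qed.

Lemma multiplier_weaken f C D : C <= D -> multiplier W f C -> multiplier W f D.
Proof.
  intros HCD [H1 H2]; split; [intros k; eapply Rle_trans; eauto|].
  intros c B Hc; apply bounded_by_weaken with (C * B); [|auto].
  apply Rmult_le_compat_r; [eapply bounded_by_nonneg, Hc | easy].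
Qed.

Lemma multiplier_ext f g C : (forall k, f k = g k) -> multiplier W f C -> multiplier W g C.
Proof.
  intros H [H1 H2]; split; [intros k; now rewrite <- H|].
  intros c B Hc; apply bounded_by_ext with (fun k => f k * c k); [intros; now rewrite H | auto].
Qed.

Lemma multiplier_const r : multiplier W (fun _ => r) (Rabs r).
Proof. split; [intros; lra | intros; now apply bounded_by_scal]. Qed.

Lemma multiplier_plus f g C D : multiplier W f C -> multiplier W g D ->
  multiplier W (fun k => f k + g k) (C + D).
Proof.
  intros [F1 F2] [G1 G2]; split.
  - intros k; eapply Rle_trans; [apply Rabs_triang|]; apply Rplus_le_compat; auto.
  - intros c B Hc; apply bounded_by_ext with (fun k => f k * c k + g k * c k); [intros; ring|].
    rewrite Rmult_plus_distr_r; apply bounded_by_plus; auto.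
Qed.

Lemma multiplier_mult f g C D : multiplier W f C -> multiplier W g D ->
  multiplier W (fun k => f k * g k) (C * D).
Proof.
  intros [F1 F2] [G1 G2]; split.
  - intros k; rewrite Rabs_mult; apply Rmult_le_compat; auto; apply Rabs_pos.
  - intros c B Hc; apply bounded_by_ext with (fun k => f k * (g k * c k)); [intros; ring|].
    rewrite Rmult_assoc; auto.
Qed.

(** For fixed [t] the sums converge by [tannery], dominated by [C |c_k| t^k], so the bound survives.
    This admits infinite products. *)
Lemma multiplier_lim (f : nat -> nat -> R) (g : nat -> R) C :
  (forall n, multiplier W (f n) C) -> (forall k, is_lim_seq (fun n => f n k) (g k)) ->
  multiplier W g C.
Proof.
  intros Hf Hl.
  assert (Hg : forall k, Rabs (g k) <= C).
  { intros k; apply (is_lim_seq_le (fun n => Rabs (f n k)) (fun _ => C) (Rabs (g k)) C).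
    - intros n; apply (Hf n).
    - apply (is_lim_seq_abs _ (g k)), Hl.
    - apply is_lim_seq_const. }
  assert (HC : 0 <= C) by apply (multiplier_nonneg _ _ (Hf 0%nat)).
  split; [easy|]; intros c B Hc; split.
  - apply entire_le with (c := c) (C := C); [apply Hc|].
    intros k; rewrite Rabs_mult; apply Rmult_le_compat_r; [apply Rabs_pos | easy].
  - intros t Ht.
    apply (is_lim_seq_le (fun n => Rabs (Series (fun k => (- t) ^ k * (f n k * c k)))) (fun _ => C
      * B * W t)
      (Rabs (Series (fun k => (- t) ^ k * (g k * c k)))) (C * B * W t)).
    + intros n; apply (Hf n); easy.
    + apply (is_lim_seq_abs _ (Series (fun k => (- t) ^ k * (g k * c k)))).
      apply tannery with (v := fun k => C * (Rabs (c k) * t ^ k)).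
      * apply (ex_series_scal (V := R_NormedModule)), Hc; lra.
      * intros n k; rewrite !Rabs_mult, <- RPow_abs, Rabs_Ropp, (Rabs_pos_eq t) by lra.
        replace (C * (Rabs (c k) * t ^ k)) with (t ^ k * (C * Rabs (c k))) by ring.
        apply Rmult_le_compat_l; [apply pow_le; lra|].
        apply Rmult_le_compat_r; [apply Rabs_pos | apply (Hf n)].
      * intros k; apply (is_lim_seq_scal_l _ _ (g k * c k)).
        apply (is_lim_seq_scal_r _ (c k) (g k)), Hl.
    + apply is_lim_seq_const.
Qed.

(* [f = sum c_k (-t)^k / (k + X)] solves [t f' + X f = F_c], that is [(t^X f)' = t^(X-1) F_c]. *)
Lemma multiplier_inv X : M < X -> multiplier W (fun k => / (INR k + X)) (/ (X - M)).
Proof.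
  intros HX; split.
  { intros k; assert (Hk := pos_INR k).
    rewrite Rabs_pos_eq by (left; apply Rinv_0_lt_compat; lra).
    apply Rinv_le_contravar; lra. }
  intros c B Hc.
  assert (HB := bounded_by_nonneg c B Hc); destruct Hc as [Hce HcB].
  assert (He : entire (fun k => / (INR k + X) * c k)).
  { apply entire_le with (c := c) (C := / X); [easy|].
    intros k; assert (Hk := pos_INR k); rewrite Rabs_mult.
    apply Rmult_le_compat_r; [apply Rabs_pos|].
    rewrite Rabs_pos_eq by (left; apply Rinv_0_lt_compat; lra).
    apply Rinv_le_contravar; lra. }
  split; [easy|]; intros t Ht.
  set (g := fun k => (-1) ^ k * (/ (INR k + X) * c k)).
  assert (Hg : entire g) by now apply entire_sign.
  assert (Hf : forall s, Series (fun k => (- s) ^ k * (/ (INR k + X) * c k)) = PSeries g s)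
    by (intros; apply Series_neg_pow_PSeries).
  rewrite Hf.
  assert (Hder : forall s, 0 < s -> is_derive (fun s => Rpower s X * PSeries g s) s
     (Rpower s (X - 1) * Series (fun k => (- s) ^ k * c k))).
  { intros s Hs; eapply is_derive_eq.
    - apply is_derive_Rmult; [|now apply entire_is_derive].
      apply is_derive_Reals, (derivable_pt_lim_power s X Hs).
    - cbv beta; replace (Rpower s X) with (Rpower s (X - 1) * s).
      2:{ rewrite <- (Rpower_1 s) at 2 by easy; rewrite <- Rpower_plus; f_equal; ring. }
      assert (E : s * PSeries (PS_derive g) s = Series (fun k => INR k * g k * s ^ k)).
      { rewrite Series_incr_1_aux by (simpl; ring).
        unfold PSeries; rewrite <- Series_scal_l; apply Series_ext; intros k.
        unfold PS_derive; simpl pow; ring. }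
      assert (E2 : Series (fun k => (- s) ^ k * c k) = X * PSeries g s + s * PSeries (PS_derive g)
        s).
      { rewrite E; unfold PSeries; rewrite <- Series_scal_l, <- Series_plus.
        - apply Series_ext; intros k; unfold g; assert (Hk := pos_INR k).
          replace (- s) with (-1 * s) by ring; rewrite Rpow_mult_distr; field; lra.
        - apply (ex_series_scal (V := R_NormedModule)), entire_ex_pseries, Hg.
        - apply ex_series_ext with (fun k => (- s) ^ k * c k - X * (g k * s ^ k)).
          + intros k; unfold g; assert (Hk := pos_INR k).
            replace (- s) with (-1 * s) by ring; rewrite Rpow_mult_distr; simpl; field; lra.
          + apply (ex_series_minus (V := R_NormedModule)); [now apply entire_ex_series_neg|].
            apply (ex_series_scal (V := R_NormedModule)), entire_ex_pseries, Hg. }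
      rewrite E2; ring. }
  (* Primitive of [s^{X-1}] times the bound [B (t/s)^M W t]; the integral of [s^{X-M-1}] over
     [(0, t)] is the source of the norm [1 / (X - M)]. *)
  set (V := fun s => B * W t * Rpower t M / (X - M) * Rpower s (X - M)).
  assert (HWt := W_ge_1 t Ht).
  assert (HV : forall s, 0 < s -> is_derive V s (B * W t * Rpower t M * Rpower s (X - M - 1))).
  { intros s Hs; unfold V; eapply is_derive_eq.
    - apply (is_derive_scal (fun s => Rpower s (X - M))), is_derive_Reals, (derivable_pt_lim_power
      s (X - M) Hs).
    - field; lra. }
  assert (Hle : forall s, 0 < s <= t ->
     Rabs (Rpower s (X - 1) * Series (fun k => (- s) ^ k * c k)) <= B * W t * Rpower t M * Rpower s
       (X - M - 1)).
  { intros s Hs; rewrite Rabs_mult, (Rabs_pos_eq (Rpower _ _)) by (left; apply exp_pos).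
    replace (Rpower s (X - M - 1)) with (Rpower s (X - 1) * Rpower s (- M))
      by (rewrite <- Rpower_plus; f_equal; ring).
    apply Rle_trans with (Rpower s (X - 1) * (B * (Rpower (t / s) M * W t))).
    - apply Rmult_le_compat_l; [left; apply exp_pos|].
      eapply Rle_trans; [apply HcB; lra|]. apply Rmult_le_compat_l; [easy | now apply W_dilation].
    - right; replace (Rpower (t / s) M) with (Rpower t M * Rpower s (- M)); [ring|].
      unfold Rpower; rewrite <- exp_plus; f_equal; rewrite ln_div by lra; ring. }
  set (S0 := Series (fun k => Rabs (/ (INR k + X) * c k) * t ^ k)).
  assert (HS0 : forall s, 0 <= s <= t -> Rabs (PSeries g s) <= S0).
  { intros s Hs; rewrite <- Hf; now apply (Rabs_Series_entire_le (fun k => / (INR k + X) * c k)). }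
  assert (HS0' : 0 <= S0) by (eapply Rle_trans; [apply Rabs_pos | apply (HS0 t); lra]).
  assert (Hmain : Rpower t X * Rabs (PSeries g t) <= V t).
  { apply Rle_plus_epsilon; intros eps Heps.
    (* The integration starts at [e > 0] instead of 0, with [e^X] so small that the boundary term
       [e^X f(e)] is at most [eps]. *)
    set (e := Rmin t (exp (ln (eps / (S0 + 1)) / X))).
    assert (Hes : 0 < eps / (S0 + 1)) by (apply Rdiv_lt_0_compat; lra).
    assert (He0 : 0 < e) by (apply Rmin_pos; [easy | apply exp_pos]).
    assert (He1 : e <= t) by apply Rmin_l.
    assert (He2 : Rpower e X <= eps / (S0 + 1)).
    { apply Rle_trans with (Rpower (exp (ln (eps / (S0 + 1)) / X)) X).
      - apply Rle_Rpower_l; [lra|]; split; [easy | apply Rmin_r].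
      - unfold Rpower; rewrite ln_exp; replace (X * (ln (eps / (S0 + 1)) / X)) with (ln (eps / (S0
        + 1))) by (field; lra).
        rewrite exp_ln; lra. }
    assert (Hinc := Rabs_increment_le _ _ V _ e t He1 (fun s Hs => Hder s ltac:(lra))
      (fun s Hs => HV s ltac:(lra)) (fun s Hs => Hle s ltac:(lra))).
    simpl in Hinc.
    assert (HVe : 0 <= V e).
    { unfold V; apply Rmult_le_pos; [|left; apply exp_pos].
      apply Rdiv_le_0_compat; [|lra]; apply Rmult_le_pos; [nra | left; apply exp_pos]. }
    assert (Hsm : Rabs (Rpower e X * PSeries g e) <= eps).
    { rewrite Rabs_mult, (Rabs_pos_eq (Rpower _ _)) by (left; apply exp_pos).
      apply Rle_trans with (eps / (S0 + 1) * S0).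
      - apply Rmult_le_compat; [left; apply exp_pos | apply Rabs_pos | easy | apply HS0; lra].
      - apply (Rmult_le_reg_r (S0 + 1)); [lra|].
        replace (eps / (S0 + 1) * S0 * (S0 + 1)) with (eps * S0) by (field; lra). nra. }
    rewrite <- (Rabs_pos_eq (Rpower t X)) by (left; apply exp_pos); rewrite <- Rabs_mult.
    replace (Rpower t X * PSeries g t) with
      ((Rpower t X * PSeries g t - Rpower e X * PSeries g e) + Rpower e X * PSeries g e) by ring.
    eapply Rle_trans; [apply Rabs_triang|]; lra. }
  assert (Hp : 0 < Rpower t X) by apply exp_pos.
  apply (Rmult_le_reg_l (Rpower t X)); [easy|].
  eapply Rle_trans; [exact Hmain|]; right; unfold V.
  replace (Rpower t X) with (Rpower t M * Rpower t (X - M))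
    by (rewrite <- Rpower_plus; f_equal; ring).
  field; lra.
Qed.

End Multipliers.

(** * A power of the reciprocal Gamma function as a single one *)

Fixpoint rising (w : R) (n : nat) : R :=
  match n with O => 1 | S k => rising w k * (w + INR k) end.

Lemma rising_front w n : rising w (S n) = w * rising (w + 1) n.
Proof.
  induction n as [|n IH]; [simpl; ring|].
  change (rising w (S (S n))) with (rising w (S n) * (w + INR (S n))).
  rewrite IH, S_INR; simpl rising; ring.
Qed.

Lemma rising_pos w n : 0 < w -> 0 < rising w n.
Proof.
  intros Hw; induction n as [|n IH]; simpl; [lra|].
  apply Rmult_lt_0_compat; [easy | generalize (pos_INR n); lra].
Qed.

Lemma rgamma_rising x n : rgamma x = rising x n * rgamma (x + INR n).
Proof.
  induction n as [|n IH]; [simpl; rewrite Rplus_0_r; ring|].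
  rewrite IH, (rgamma_rec (x + INR n)), S_INR; simpl rising.
  replace (x + INR n + 1) with (x + (INR n + 1)) by ring; ring.
Qed.

(** A zero at [x > 0] would propagate along the recursion to [x + n + 1] for every [n], against the
    limit 1 in [rgamma_ratio]. *)
Lemma rgamma_neq_0 x : 0 < x -> rgamma x <> 0.
Proof.
  intros Hx; assert (H := rgamma_ratio x); apply is_lim_seq_spec in H.
  destruct (H (mkposreal _ Rlt_0_1)) as [n Hn]; specialize (Hn n (le_n n)); simpl in Hn.
  intros E; rewrite (rgamma_rising x (S n)) in E.
  apply Rmult_integral in E; destruct E as [E|E]; [generalize (rising_pos x (S n) Hx); lra|].
  replace (x + INR (S n)) with (INR n + 1 + x) in E by (rewrite S_INR; ring).
  rewrite E, Rmult_0_r in Hn; rewrite Rabs_left in Hn; lra.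
Qed.

(* The product over the pairs of opposite nodes among [(i - (n-1)/2) / d], [0 <= i < n]. *)
Fixpoint pairs (F : R -> R) (d : R) (n : nat) : R :=
  match n with
  | S (S k) => F (INR (S k) / (2 * d)) * pairs F d k
  | _ => 1
  end.

Lemma nat_ind2 (P : nat -> Prop) : P 0%nat -> P 1%nat ->
  (forall n, P n -> P (S (S n))) -> forall n, P n.
Proof.
  intros H0 H1 HS n; cut (P n /\ P (S n)); [easy|].
  induction n as [|n [IH1 IH2]]; auto.
Qed.

Lemma pairs_mult F G d n : pairs (fun u => F u * G u) d n = pairs F d n * pairs G d n.
Proof.
  induction n as [| |n IH] using nat_ind2; simpl pairs; [ring | ring|]. rewrite IH; ring.
Qed.

Lemma pairs_const_1 d n : pairs (fun _ => 1) d n = 1.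
Proof. induction n as [| |n IH] using nat_ind2; simpl pairs; try easy; rewrite IH; ring. Qed.

Lemma pair_node d n : INR (S (S n)) <= d -> 0 <= INR (S n) / (2 * d) <= / 2.
Proof.
  intros H; rewrite !S_INR in *; assert (Hn := pos_INR n).
  split; [apply Rdiv_le_0_compat; lra|].
  apply (Rmult_le_reg_r (2 * d)); [lra|]. unfold Rdiv; rewrite Rmult_assoc, Rinv_l; lra.
Qed.

Lemma INR_SS_le (n : nat) (d : R) : INR (S (S n)) <= d -> INR n <= d.
Proof. rewrite !S_INR; lra. Qed.

Lemma pairs_ext F G d n : INR n <= d -> (forall u, 0 <= u <= / 2 -> F u = G u) ->
  pairs F d n = pairs G d n.
Proof.
  intros Hn H; induction n as [| |n IH] using nat_ind2; [easy | easy|].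
  simpl pairs; rewrite IH by now apply INR_SS_le.
  now rewrite H by now apply pair_node.
Qed.

Lemma pairs_neq_0 F d n : INR n <= d -> (forall u, 0 <= u <= / 2 -> F u <> 0) -> pairs F d n <> 0.
Proof.
  intros Hn H; induction n as [| |n IH] using nat_ind2; [simpl; lra | simpl; lra|].
  simpl pairs; apply Rmult_integral_contrapositive_currified.
  - now apply H, pair_node.
  - now apply IH, INR_SS_le.
Qed.

Lemma pairs_lim (F : nat -> R -> R) (G : R -> R) d n : INR n <= d ->
  (forall u, 0 <= u <= / 2 -> is_lim_seq (fun J => F J u) (G u)) ->
  is_lim_seq (fun J => pairs (F J) d n) (pairs G d n).
Proof.
  intros Hn H; induction n as [| |n IH] using nat_ind2; try apply is_lim_seq_const.
  simpl pairs; apply is_lim_seq_mult'.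
  - now apply H, pair_node.
  - now apply IH, INR_SS_le.
Qed.

(** The nodes of this rising factorial are symmetric about [d x], so opposite factors multiply to
    [d^2 (x^2 - u^2)], and for odd [n] the middle one is [d x]. *)
Lemma rising_pairs d x n : 0 < d -> INR n <= d -> 1 < x ->
  rising (d * x - (INR n - 1) / 2) n * pairs (fun u => x ^ 2 / (x ^ 2 - u ^ 2)) d n = (d * x) ^ n.
Proof.
  intros Hd; induction n as [| |n IH] using nat_ind2; intros Hn Hx.
  - simpl; ring.
  - simpl; field.
  - assert (Hu := pair_node d n Hn).
    specialize (IH (INR_SS_le n d Hn) Hx).
    change (rising (d * x - (INR (S (S n)) - 1) / 2) (S (S n))) with
      (rising (d * x - (INR (S (S n)) - 1) / 2) (S n) * (d * x - (INR (S (S n)) - 1) / 2 + INR (S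
        n))).
    change (pairs (fun u => x ^ 2 / (x ^ 2 - u ^ 2)) d (S (S n))) with
      (x ^ 2 / (x ^ 2 - (INR (S n) / (2 * d)) ^ 2) * pairs (fun u => x ^ 2 / (x ^ 2 - u ^ 2)) d n).
    rewrite rising_front.
    set (u := INR (S n) / (2 * d)) in *.
    assert (Eu : INR (S n) = u * (2 * d)) by (unfold u; field; lra).
    replace (d * x - (INR (S (S n)) - 1) / 2 + 1) with (d * x - (INR n - 1) / 2) by (rewrite
      !S_INR; field).
    replace (d * x - (INR (S (S n)) - 1) / 2) with (d * x - d * u)
      by (rewrite (S_INR (S n)), Eu; field).
    rewrite Eu.
    change ((d * x) ^ S (S n)) with (d * x * (d * x * (d * x) ^ n)); rewrite <- IH.
    field; nra.
Qed.

Definition tel (u x : R) : R := (x - (1 - u ^ 2) / 2) / (x - (1 + u ^ 2) / 2).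

Definition cubic (u x : R) : R :=
  1 - u ^ 2 * ((1 - u ^ 2) / 2) ^ 2 / ((x ^ 2 - u ^ 2) * (x ^ 2 - ((1 - u ^ 2) / 2) ^ 2)).

(* [tel] matches the [1/x] term of the infinite product, so that after extracting it the factors
   are [1 + O (x^{-4})]. *)
Lemma factor_tel u x : 0 <= u <= / 2 -> 1 < x ->
  x ^ 2 / (x ^ 2 - u ^ 2) = tel u x / tel u (x + 1) * cubic u x.
Proof.
  intros Hu Hx; unfold tel, cubic.
  assert (Hu2 : 0 <= u ^ 2 <= / 4) by (simpl; nra).
  field; repeat split; simpl in *; try lra; nra.
Qed.

Lemma tel_neq_0 u x : 0 <= u <= / 2 -> 1 < x -> tel u x <> 0.
Proof.
  intros Hu Hx; assert (Hu2 : 0 <= u ^ 2 <= / 4) by (simpl; nra).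
  unfold tel; apply Rgt_not_eq, Rdiv_lt_0_compat; lra.
Qed.

Lemma tel_lim u x : 0 <= u <= / 2 -> 1 < x -> is_lim_seq (fun J => tel u (x + INR J)) 1.
Proof.
  intros Hu Hx; assert (Hu2 : 0 <= u ^ 2 <= / 4) by (simpl; nra).
  apply is_lim_seq_ext with (fun J => 1 + u ^ 2 * / (x - (1 + u ^ 2) / 2 + INR J)).
  - intros J; assert (HJ := pos_INR J); unfold tel; field; lra.
  - replace (Finite 1) with (Finite (1 + u ^ 2 * 0)) by (f_equal; ring).
    apply is_lim_seq_plus'; [apply is_lim_seq_const|].
    apply (is_lim_seq_scal_l _ (u ^ 2) 0).
    apply is_lim_seq_le_le_loc with (fun _ => 0) (fun J => / INR J).
    + exists 1%nat; intros J HJ; assert (HJ' : 0 < INR J) by now apply lt_0_INR.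
      split; [left; apply Rinv_0_lt_compat; lra | apply Rinv_le_contravar; lra].
    + apply is_lim_seq_const.
    + apply is_lim_seq_INR_inv.
Qed.

(** Quotient of [1 / Gamma (x)^m] by its model. The shift [(m - 1) / 2] centres the nodes, so that
    the factors of the recursion in [x] have no [1/x] term and their product converges. *)
Definition gamma_quot (m : nat) (x : R) : R :=
  rgamma x ^ m / (Rpower (INR m) (INR m * x) * rgamma (INR m * x - (INR m - 1) / 2)).

Lemma gamma_quot_rec m x : (1 <= m)%nat -> 1 < x ->
  gamma_quot m x = pairs (fun u => x ^ 2 / (x ^ 2 - u ^ 2)) (INR m) m * gamma_quot m (x + 1).
Proof.
  intros Hm Hx; assert (Hm1 : 1 <= INR m) by now apply (le_INR 1).
  unfold gamma_quot.
  set (w := INR m * x - (INR m - 1) / 2).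
  assert (Hw : 0 < w) by (unfold w; nra).
  assert (Hr := rising_pairs (INR m) x m ltac:(lra) ltac:(lra) Hx); fold w in Hr.
  assert (Hrp := rising_pos w m Hw).
  assert (Hg := rgamma_neq_0 (w + INR m) ltac:(lra)).
  replace (INR m * (x + 1) - (INR m - 1) / 2) with (w + INR m) by (unfold w; ring).
  rewrite (rgamma_rising w m), (rgamma_rec x), Rpow_mult_distr.
  replace (Rpower (INR m) (INR m * (x + 1))) with (Rpower (INR m) (INR m * x) * INR m ^ m).
  2:{ rewrite <- Rpower_pow, <- Rpower_plus by lra; f_equal; ring. }
  rewrite Rpow_mult_distr in Hr.
  assert (Hmm : 0 < INR m ^ m) by (apply pow_lt; lra).
  assert (Hp : 0 < Rpower (INR m) (INR m * x)) by apply exp_pos.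
  set (P := pairs _ _ _) in *.
  replace (x ^ m) with (rising w m * P / INR m ^ m) by (rewrite Hr; field; lra).
  field; repeat split; lra.
Qed.

Fixpoint cubic_prod (u x : R) (J : nat) : R :=
  match J with O => 1 | S n => cubic_prod u x n * cubic u (x + INR n) end.

(** The [tel] factors of the [J] steps telescope to their values at [x] and [x + J]. The latter,
    which tends to 1, stays on the left to avoid a division. *)
Lemma gamma_quot_iter m x J : (1 <= m)%nat -> 1 < x ->
  gamma_quot m x * pairs (fun u => tel u (x + INR J)) (INR m) m
   = pairs (fun u => tel u x) (INR m) m * pairs (fun u => cubic_prod u x J) (INR m) m
      * gamma_quot m (x + INR J).
Proof.
  intros Hm Hx; induction J as [|J IH].
  - simpl INR; rewrite Rplus_0_r; simpl cubic_prod.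
    rewrite pairs_const_1; ring.
  - assert (HJ := pos_INR J).
    assert (HT : pairs (fun u => tel u (x + INR J)) (INR m) m <> 0).
    { apply pairs_neq_0; [lra|]; intros; apply tel_neq_0; lra. }
    apply (Rmult_eq_reg_r (pairs (fun u => tel u (x + INR J)) (INR m) m)); [|easy].
    transitivity (gamma_quot m x * pairs (fun u => tel u (x + INR J)) (INR m) m
      * pairs (fun u => tel u (x + INR (S J))) (INR m) m); [ring|].
    rewrite IH, (gamma_quot_rec m (x + INR J)) by (easy || lra).
    replace (x + INR J + 1) with (x + INR (S J)) by (rewrite S_INR; ring).
    change (pairs (fun u => cubic_prod u x (S J)) (INR m) m) with
      (pairs (fun u => cubic_prod u x J * cubic u (x + INR J)) (INR m) m).
    rewrite (pairs_mult (fun u => cubic_prod u x J)).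
    assert (E : pairs (fun u => (x + INR J) ^ 2 / ((x + INR J) ^ 2 - u ^ 2)) (INR m) m
        * pairs (fun u => tel u (x + INR (S J))) (INR m) m
      = pairs (fun u => tel u (x + INR J)) (INR m) m * pairs (fun u => cubic u (x + INR J)) (INR m)
        m).
    { rewrite <- !pairs_mult; apply pairs_ext; [lra|]; intros u Hu.
      rewrite factor_tel by (easy || lra).
      replace (x + INR J + 1) with (x + INR (S J)) by (rewrite S_INR; ring).
      field; apply tel_neq_0; [easy|]; rewrite S_INR; lra. }
    set (q := gamma_quot m (x + INR (S J))); set (P0 := pairs (fun u => cubic_prod u x J) (INR m)
      m).
    set (T0 := pairs (fun u => tel u x) (INR m) m).
    transitivity (T0 * P0 * q * (pairs (fun u => (x + INR J) ^ 2 / ((x + INR J) ^ 2 - u ^ 2)) (INR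
      m) m
        * pairs (fun u => tel u (x + INR (S J))) (INR m) m)); [ring|].
    rewrite E; ring.
Qed.

Lemma cubic_itv u x : 0 <= u <= / 2 -> 1 < x -> 0 < cubic u x <= 1.
Proof.
  intros Hu Hx; unfold cubic.
  assert (Hu2 : 0 <= u ^ 2 <= / 4) by (simpl; nra).
  set (v := (1 - u ^ 2) / 2); assert (Hv : 0 <= v <= / 2) by (unfold v; lra).
  assert (Hv2 : 0 <= v ^ 2 <= / 4) by (simpl; nra).
  assert (Hx2 : 1 < x ^ 2) by (simpl; nra).
  assert (Hd : / 2 < (x ^ 2 - u ^ 2) * (x ^ 2 - v ^ 2)) by nra.
  assert (Hn : 0 <= u ^ 2 * v ^ 2 <= / 16) by nra.
  assert (H : 0 <= u ^ 2 * v ^ 2 / ((x ^ 2 - u ^ 2) * (x ^ 2 - v ^ 2)) < 1).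
  { split; [apply Rdiv_le_0_compat; lra|].
    apply (Rmult_lt_reg_r ((x ^ 2 - u ^ 2) * (x ^ 2 - v ^ 2))); [lra|].
    unfold Rdiv; rewrite Rmult_assoc, Rinv_l; lra. }
  lra.
Qed.

Definition cubic_lim (u x : R) : R := real (Lim_seq (cubic_prod u x)).

Lemma is_lim_cubic_prod u x : 0 <= u <= / 2 -> 1 < x ->
  is_lim_seq (cubic_prod u x) (cubic_lim u x).
Proof.
  intros Hu Hx.
  assert (Hp : forall J, 0 < cubic_prod u x J).
  { induction J as [|J IH]; simpl; [lra|].
    apply Rmult_lt_0_compat; [easy|]; apply cubic_itv; [easy | generalize (pos_INR J); lra]. }
  destruct (ex_finite_lim_seq_decr (cubic_prod u x) 0) as [l Hl].
  - intros J; simpl; rewrite <- Rmult_1_r.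
    apply Rmult_le_compat_l; [left; apply Hp|]; apply cubic_itv; [easy | generalize (pos_INR J);
      lra].
  - intros J; left; apply Hp.
  - unfold cubic_lim; now rewrite (is_lim_seq_unique _ _ Hl).
Qed.

(** Stirling's constant [s = sqrt (2 PI)] enters once through [(m n)!] and [m] times through
    [(n!)^m], which gives [s / s^m]; the powers of [m] left over are [m^{-m/2}]. *)
Definition quot_const (m : nat) : R :=
  Rpower (INR m) (- INR m / 2) * Rpower (2 * PI) ((1 - INR m) / 2).

Lemma fact_stirling n : (0 < n)%nat ->
  INR (fact n) = stirling_seq n * (Rpower (INR n) (INR n + / 2) * exp (- INR n)).
Proof.
  intros Hn0; assert (Hn : 0 < INR n) by now apply lt_0_INR.
  unfold stirling_seq; rewrite Rpower_plus, Rpower_pow, Rpower_sqrt, exp_Ropp by easy.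
  assert (0 < INR n ^ n) by now apply pow_lt.
  assert (0 < sqrt (INR n)) by now apply sqrt_lt_R0.
  field; repeat split; try lra; apply Rgt_not_eq, exp_pos.
Qed.

Lemma Rpower_pow_nat (x y : R) (n : nat) : Rpower x y ^ n = Rpower x (INR n * y).
Proof. unfold Rpower; rewrite <- exp_INR_mult; f_equal; ring. Qed.

Lemma gamma_quot_lim m x : (1 <= m)%nat -> 1 < x ->
  is_lim_seq (fun J => gamma_quot m (x + INR J)) (quot_const m).
Proof.
  intros Hm Hx; assert (Hm1 : 1 <= INR m) by now apply (le_INR 1).
  assert (Hpi := PI_RGT_0).
  set (M := INR m) in *.
  (* Chosen so that the argument [M (n + 1 + x) - (M - 1) / 2] becomes [m n + 1 + X], and
     [rgamma_ratio] applies at the index [m n]. *)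
  set (X := M * x + (M - 1) / 2).
  set (r1 := fun n => INR (fact n) * Rpower (INR n) x * rgamma (INR n + 1 + x)).
  set (r2 := fun n => INR (fact n) * Rpower (INR n) X * rgamma (INR n + 1 + X)).
  assert (H1 : is_lim_seq r1 1) by apply rgamma_ratio.
  assert (Hsub : forall u l, is_lim_seq u l -> is_lim_seq (fun n => u (m * n)%nat) l).
  { intros u l Hu; apply (is_lim_seq_subseq u l (fun n => (m * n)%nat)); [|easy].
    apply eventually_subseq; intros; nia. }
  assert (H2 : is_lim_seq (fun n => r2 (m * n)%nat) 1) by apply Hsub, rgamma_ratio.
  assert (H3 := stirling_lim); assert (H4 := Hsub _ _ H3).
  set (s := sqrt (2 * PI)) in *.
  assert (Hs : 0 < s) by (apply sqrt_lt_R0; lra).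
  assert (Hpow : forall (u : nat -> R) (l : R) k, is_lim_seq u l -> is_lim_seq (fun n => u n ^ k)
    (l ^ k)).
  { intros u l k Hu; induction k as [|k IH]; simpl; [apply is_lim_seq_const | now apply
    is_lim_seq_mult']. }
  apply is_lim_seq_incr_1.
  apply is_lim_seq_ext_loc with (fun n => r1 n ^ m / r2 (m * n)%nat * (stirling_seq (m * n) /
    stirling_seq n ^ m)
     * Rpower M (- M / 2)).
  - exists 1%nat; intros n Hn0.
    assert (Hn : 0 < INR n) by now apply lt_0_INR.
    assert (Hmn : INR (m * n) = M * INR n) by apply mult_INR.
    unfold gamma_quot; fold M.
    replace (x + INR (S n)) with (INR n + 1 + x) by (rewrite S_INR; ring).
    replace (M * (INR n + 1 + x) - (M - 1) / 2) with (INR (m * n) + 1 + X) by (rewrite Hmn; unfold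
      X; field).
    set (g1 := rgamma (INR n + 1 + x)) in *.
    assert (Hg2 : rgamma (INR (m * n) + 1 + X) <> 0).
    { apply rgamma_neq_0; generalize (pos_INR (m * n)); unfold X; nra. }
    unfold r1, r2; fold g1; set (g2 := rgamma (INR (m * n) + 1 + X)) in *.
    rewrite (fact_stirling n), (fact_stirling (m * n)) by nia.
    assert (Hs1 := stirling_seq_pos n Hn0); assert (Hs2 := stirling_seq_pos (m * n) ltac:(nia)).
    rewrite Hmn.
    set (s1 := stirling_seq n) in *; set (s2 := stirling_seq (m * n)) in *.
    rewrite !Rpow_mult_distr, !Rpower_pow_nat; fold M.
    rewrite <- (exp_INR_mult m); fold M.
    replace (Rpower (M * INR n) (M * INR n + / 2)) with
      (Rpower M (M * INR n + / 2) * Rpower (INR n) (M * INR n + / 2)) by (apply Rpower_mult_distr;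
        lra).
    replace (Rpower (M * INR n) X) with (Rpower M X * Rpower (INR n) X) by (apply
      Rpower_mult_distr; lra).
    transitivity (g1 ^ m / g2 * (Rpower (INR n) (M * (INR n + / 2)) * Rpower (INR n) (M * x)
        * Rpower M (- M / 2) / (Rpower M (M * INR n + / 2) * Rpower (INR n) (M * INR n + / 2) *
          Rpower M X * Rpower (INR n) X))
        * (exp (M * - INR n) / exp (- (M * INR n)))).
    { assert (0 < s1 ^ m) by now apply pow_lt.
      field; repeat split; try lra; apply Rgt_not_eq, exp_pos. }
    replace (exp (M * - INR n) / exp (- (M * INR n))) with 1.
    2:{ replace (M * - INR n) with (- (M * INR n)) by ring; field; apply Rgt_not_eq, exp_pos. }
    unfold Rdiv at 1 4; rewrite Rmult_1_r, Rmult_assoc; f_equal.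
    rewrite (Rmult_comm (Rpower M _) g2), Rinv_mult; f_equal.
    unfold Rpower, Rdiv; rewrite <- !exp_plus, <- !exp_Ropp, <- !exp_plus; f_equal.
    unfold X; field.
  - replace (Finite (quot_const m)) with (Finite (1 ^ m / 1 * (s / s ^ m) * Rpower M (- M / 2))).
    + apply is_lim_seq_mult'; [|apply is_lim_seq_const].
      apply is_lim_seq_mult'.
      * apply is_lim_seq_div'; [now apply Hpow | easy | lra].
      * apply is_lim_seq_div'; [easy | now apply Hpow | apply pow_nonzero; lra].
    + f_equal; unfold quot_const; fold M; rewrite pow1.
      assert (E : s = Rpower (2 * PI) (/ 2)) by (symmetry; apply Rpower_sqrt; lra).
      rewrite E, Rpower_pow_nat; fold M.
      replace ((1 - M) / 2) with (/ 2 + - (M * / 2)) by field.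
      rewrite Rpower_plus, Rpower_Ropp; field; apply Rgt_not_eq, exp_pos.
Qed.

Lemma gamma_quot_eq m x : (1 <= m)%nat -> 1 < x ->
  gamma_quot m x = quot_const m * pairs (fun u => tel u x * cubic_lim u x) (INR m) m.
Proof.
  intros Hm Hx.
  assert (HL : is_lim_seq (fun J => gamma_quot m x * pairs (fun u => tel u (x + INR J)) (INR m) m)
    (gamma_quot m x * pairs (fun _ => 1) (INR m) m)).
  { apply is_lim_seq_mult'; [apply is_lim_seq_const|].
    apply (pairs_lim (fun J u => tel u (x + INR J))); [lra|]; intros; now apply tel_lim. }
  assert (HR : is_lim_seq (fun J => gamma_quot m x * pairs (fun u => tel u (x + INR J)) (INR m) m)
    (pairs (fun u => tel u x) (INR m) m * pairs (fun u => cubic_lim u x) (INR m) m * quot_const m)).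
  { apply is_lim_seq_ext with (1 := fun J => eq_sym (gamma_quot_iter m x J Hm Hx)).
    apply is_lim_seq_mult'; [apply is_lim_seq_mult'; [apply is_lim_seq_const|] | now apply
      gamma_quot_lim].
    apply (pairs_lim (fun J u => cubic_prod u x J)); [lra|]; intros; now apply is_lim_cubic_prod. }
  apply is_lim_seq_unique in HL; apply is_lim_seq_unique in HR; rewrite HL in HR.
  injection HR; rewrite pairs_const_1, pairs_mult; lra.
Qed.

(** * Infinite products of multipliers close to the identity *)

Section NearIdentity.

Variables (W : R -> R) (M alpha Y mu nu0 : R).
Hypothesis W_ge_1 : forall t, 0 < t -> 1 <= W t.
Hypothesis W_dilation : forall s t, 0 < s <= t -> W s <= Rpower (t / s) M * W t.
Hypothesis M_nonneg : 0 <= M.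
Hypothesis alpha_pos : 0 < alpha.
Hypothesis Y_large : alpha * M + 3 <= Y.

Let y (k : nat) : R := alpha * INR k + Y.
(** It will be [a k + b], the factor by which [1 / Gamma (a k + b)] exceeds
    [1 / Gamma (a k + b + 1)]. *)
Let lin (k : nat) : R := mu * (alpha * INR k) + nu0.

Lemma y_gt k : 2 < y k.
Proof. unfold y; generalize (pos_INR k); intros; nra. Qed.

(** Factoring out [alpha] reduces this to [multiplier_inv]. The 3 in [Y_large] leaves 2 after a node
    [|z| <= 1] is taken off, hence a norm at most [1 / (n + 2)]. *)
Lemma multiplier_inv_node n z : -1 <= z <= 1 ->
  multiplier W (fun k => / (y k + INR n + z)) (/ (INR n + 2)).
Proof.
  intros Hz; assert (Hn := pos_INR n).
  set (Z := Y + INR n + z).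
  assert (HZ : INR n + 2 <= Z - alpha * M) by (unfold Z; lra).
  assert (HX : M < Z / alpha) by (apply Rlt_div_r; lra).
  apply multiplier_weaken with (Rabs (/ alpha) * / (Z / alpha - M)); [easy| |].
  - rewrite Rabs_pos_eq by (left; now apply Rinv_0_lt_compat).
    replace (/ alpha * / (Z / alpha - M)) with (/ (Z - alpha * M)).
    + apply Rinv_le_contravar; lra.
    + field; repeat split; lra.
  - apply multiplier_ext with (fun k => / alpha * / (INR k + Z / alpha)).
    + intros k; unfold y, Z; assert (Hk := pos_INR k); field.
      unfold Z in HZ; repeat split; nra.
    + apply multiplier_mult; [apply multiplier_const | now apply multiplier_inv].
Qed.

Definition lin_norm : R := 2 * Rabs mu + Rabs nu0 + Rabs mu * Rabs Y.

(** Dividing with remainder gives [mu + r / (y k + n + z)]. The remainder [r] grows linearly in [n],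
    and the norm [1 / (n + 2)] compensates it, so the bound is uniform in [n]. *)
Lemma multiplier_lin_inv n z : -1 <= z <= 1 ->
  multiplier W (fun k => lin k * / (y k + INR n + z)) lin_norm.
Proof.
  intros Hz; assert (Hn := pos_INR n).
  set (r := nu0 - mu * (Y + INR n + z)).
  apply multiplier_weaken with (Rabs mu + Rabs r * / (INR n + 2)); [easy| |].
  - assert (Hr : Rabs r <= Rabs nu0 + Rabs mu * (Rabs Y + INR n + 1)).
    { unfold r; eapply Rle_trans; [apply Rabs_triang|]; apply Rplus_le_compat_l.
      rewrite Rabs_Ropp, Rabs_mult; apply Rmult_le_compat_l; [apply Rabs_pos|].
      eapply Rle_trans; [apply Rabs_triang|].
      assert (Rabs z <= 1) by (now apply Rabs_le).
      eapply Rle_trans; [apply Rplus_le_compat_r, Rabs_triang|].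
      rewrite (Rabs_pos_eq (INR n)) by easy; lra. }
    assert (H : Rabs r * / (INR n + 2) <= Rabs nu0 + Rabs mu * Rabs Y + Rabs mu).
    { apply (Rmult_le_reg_r (INR n + 2)); [lra|].
      rewrite Rmult_assoc, Rinv_l, Rmult_1_r by lra.
      eapply Rle_trans; [exact Hr|].
      generalize (Rabs_pos nu0), (Rabs_pos mu), (Rabs_pos Y); intros A B C.
      assert (0 <= Rabs mu * Rabs Y) by (apply Rmult_le_pos; easy).
      assert (0 <= Rabs nu0 * INR n) by (apply Rmult_le_pos; easy).
      assert (0 <= Rabs mu * Rabs Y * INR n) by (apply Rmult_le_pos; easy).
      assert (0 <= Rabs mu * INR n) by (apply Rmult_le_pos; easy). lra. }
    unfold lin_norm; lra.
  - apply multiplier_ext with (fun k => mu + r * / (y k + INR n + z)).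
    + intros k; generalize (y_gt k); intros; unfold lin, r.
      replace (alpha * INR k) with (y k - Y) by (unfold y; ring). field; lra.
    + apply multiplier_plus; [apply multiplier_const|].
      apply multiplier_mult; [apply multiplier_const | now apply multiplier_inv_node].
Qed.

(** Operator form of [f = 1 + O (1/k)]. *)
Definition near_one (f : nat -> R) : Prop :=
  (exists C, multiplier W f C) /\ exists C, multiplier W (fun k => lin k * (f k - 1)) C.

Lemma near_one_mult f g : near_one f -> near_one g -> near_one (fun k => f k * g k).
Proof.
  intros [[C1 F1] [C2 F2]] [[D1 G1] [D2 G2]]; split.
  - eexists; apply multiplier_mult; eassumption.
  - exists (C1 * D2 + C2).
    apply multiplier_ext with (fun k => f k * (lin k * (g k - 1)) + lin k * (f k - 1)); [intros;
      ring|].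
    apply multiplier_plus; [now apply multiplier_mult | easy].
Qed.

Lemma near_one_1 : near_one (fun _ => 1).
Proof.
  split; [eexists; apply multiplier_const|].
  eexists; apply multiplier_ext with (fun _ => 0); [intros; ring | apply multiplier_const].
Qed.

Lemma near_one_pairs (F : R -> R -> R) d n : INR n <= d ->
  (forall u, 0 <= u <= / 2 -> near_one (fun k => F u (y k))) ->
  near_one (fun k => pairs (fun u => F u (y k)) d n).
Proof.
  intros Hn H; induction n as [| |n IH] using nat_ind2; try apply near_one_1.
  apply (near_one_mult (fun k => F (INR (S n) / (2 * d)) (y k))).
  - now apply H, pair_node.
  - now apply IH, INR_SS_le.
Qed.

Lemma near_one_tel u : 0 <= u <= / 2 -> near_one (fun k => tel u (y k)).
Proof.
  intros Hu; assert (Hu2 : 0 <= u ^ 2 <= / 4) by (simpl; nra).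
  set (s := (1 + u ^ 2) / 2).
  assert (E : forall k, tel u (y k) = 1 + u ^ 2 * / (y k + INR 0 + - s)).
  { intros k; generalize (y_gt k); intros; unfold tel, s; simpl INR; field; lra. }
  split.
  - eexists; apply multiplier_ext with (1 := fun k => eq_sym (E k)).
    apply multiplier_plus; [apply multiplier_const|].
    apply multiplier_mult; [apply multiplier_const | apply multiplier_inv_node; unfold s; lra].
  - eexists; apply multiplier_ext with (fun k => u ^ 2 * (lin k * / (y k + INR 0 + - s))).
    + intros k; rewrite E; ring.
    + apply multiplier_mult; [apply multiplier_const | apply multiplier_lin_inv; unfold s; lra].
Qed.

(** The difference splits into four simple fractions, each a multiplier by [multiplier_inv_node]. *)
Lemma cubic_minus_1 u n k : 0 <= u <= / 2 ->
  let v := (1 - u ^ 2) / 2 in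
  cubic u (y k + INR n) - 1 = - (u ^ 2 * v ^ 2) * (/ (y k + INR n + u) * (/ (y k + INR n + - u) *
    (/ (y k + INR n + v) * / (y k + INR n + - v)))).
Proof.
  intros Hu v; assert (Hu2 : 0 <= u ^ 2 <= / 4) by (simpl; nra).
  assert (Hv : 0 <= v <= / 2) by (unfold v; lra).
  assert (Hy := y_gt k); assert (Hn := pos_INR n).
  unfold cubic; fold v; set (x := y k + INR n); assert (Hx : 2 < x) by (unfold x; lra).
  field; repeat split; try lra; simpl; nra.
Qed.

(** Four fractions have norm at most [(n + 2)^{-4}]; the linear factor uses up one of them and
    leaves [(n + 2)^{-3}]. Both are bounded by a telescoping difference so that the sum over [n] is
    explicit. *)
Lemma multiplier_cubic_minus_1 u n : 0 <= u <= / 2 ->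
  multiplier W (fun k => cubic u (y k + INR n) - 1) (/ (INR n + 1) - / (INR n + 2)) /\
  multiplier W (fun k => lin k * (cubic u (y k + INR n) - 1))
    (lin_norm * (/ (INR n + 1) - / (INR n + 2))).
Proof.
  intros Hu; assert (Hu2 : 0 <= u ^ 2 <= / 4) by (simpl; nra).
  set (v := (1 - u ^ 2) / 2); assert (Hv : 0 <= v <= / 2) by (unfold v; lra).
  assert (Hv2 : 0 <= v ^ 2 <= / 4) by (simpl; nra).
  assert (Hn := pos_INR n).
  set (i := / (INR n + 2)); set (j := / (INR n + 1)).
  assert (Hi : 0 < i) by (apply Rinv_0_lt_compat; lra).
  assert (Hij : i <= j) by (apply Rinv_le_contravar; lra).
  assert (Hi2 : i <= / 2) by (apply Rinv_le_contravar; lra).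
  assert (Hd : j - i = i * j) by (unfold i, j; field; lra).
  assert (Hii : i * i <= i * j) by (apply Rmult_le_compat_l; lra).
  assert (Huv : Rabs (- (u ^ 2 * v ^ 2)) <= 1) by (rewrite Rabs_Ropp, Rabs_pos_eq; nra).
  assert (Huv0 := Rabs_pos (- (u ^ 2 * v ^ 2))).
  assert (Hl : 0 <= lin_norm).
  { unfold lin_norm; generalize (Rabs_pos mu), (Rabs_pos nu0), (Rabs_pos Y); nra. }
  assert (Hi4 : i * (i * i) <= i * i) by nra.
  assert (Hi3 : 0 <= i * (i * i)) by nra.
  split.
  - apply multiplier_weaken with (Rabs (- (u ^ 2 * v ^ 2)) * (i * (i * (i * i)))); [easy| |].
    + rewrite Hd. apply Rle_trans with (1 * (i * (i * (i * i)))); [|nra].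
      apply Rmult_le_compat_r; [nra | easy].
    + apply multiplier_ext with (1 := fun k => eq_sym (cubic_minus_1 u n k Hu)).
      apply multiplier_mult; [apply multiplier_const|].
      repeat apply multiplier_mult; apply multiplier_inv_node; fold v; lra.
  - apply multiplier_weaken with (Rabs (- (u ^ 2 * v ^ 2)) * (lin_norm * (i * (i * i)))); [easy| |].
    + rewrite Hd. apply Rle_trans with (1 * (lin_norm * (i * (i * i)))).
      * apply Rmult_le_compat_r; [nra | easy].
      * rewrite Rmult_1_l; apply Rmult_le_compat_l; lra.
    + apply multiplier_ext with (fun k => - (u ^ 2 * v ^ 2) * (lin k * / (y k + INR n + u) *
        (/ (y k + INR n + - u) * (/ (y k + INR n + v) * / (y k + INR n + - v))))).
      * intros k; rewrite cubic_minus_1 by easy; fold v; ring.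
      * apply multiplier_mult; [apply multiplier_const|].
        apply multiplier_mult; [apply multiplier_lin_inv; lra|].
        repeat apply multiplier_mult; apply multiplier_inv_node; lra.
Qed.

(** The telescoping norms keep the partial products below [e]. The deviation from 1, multiplied by
    [lin], grows at each step by a partial product times [lin] times one deviation, which telescopes
    again; both bounds pass to the limit. *)
Lemma near_one_cubic u : 0 <= u <= / 2 -> near_one (fun k => cubic_lim u (y k)).
Proof.
  intros Hu.
  assert (Hl : 0 <= lin_norm).
  { unfold lin_norm; generalize (Rabs_pos mu), (Rabs_pos nu0), (Rabs_pos Y); nra. }
  assert (Hinv : forall J, 0 < / (INR J + 1) <= 1).
  { intros J; generalize (pos_INR J); intros; split; [apply Rinv_0_lt_compat; lra|].
    rewrite <- Rinv_1; apply Rinv_le_contravar; lra. }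
  assert (HS : forall J, / (INR (S J) + 1) = / (INR J + 2)) by (intros; rewrite S_INR; f_equal;
    ring).
  assert (HJ : forall J, multiplier W (fun k => cubic_prod u (y k) J) (exp (1 - / (INR J + 1)))).
  { induction J as [|J IH].
    - simpl; apply multiplier_weaken with (Rabs 1); [easy| |apply multiplier_const].
      rewrite Rabs_R1, Rplus_0_l, Rinv_1, Rminus_diag, exp_0; lra.
    - rewrite HS; set (e := / (INR J + 1) - / (INR J + 2)).
      apply multiplier_weaken with (exp (1 - / (INR J + 1)) * (Rabs 1 + e)); [easy| |].
      + rewrite Rabs_R1; replace (1 - / (INR J + 2)) with (1 - / (INR J + 1) + e) by (unfold e;
        ring).
        rewrite exp_plus; apply Rmult_le_compat_l; [left; apply exp_pos | apply exp_ineq1_le].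
      + apply (multiplier_mult W (fun k => cubic_prod u (y k) J)); [easy|].
        apply multiplier_ext with (fun k => 1 + (cubic u (y k + INR J) - 1)); [intros; ring|].
        apply multiplier_plus; [apply multiplier_const | now apply multiplier_cubic_minus_1]. }
  assert (He : forall J, exp (1 - / (INR J + 1)) <= exp 1) by (intros J; apply exp_le; generalize
    (Hinv J); lra).
  assert (He1 := exp_pos 1).
  split.
  - exists (exp 1); apply multiplier_lim with (f := fun J k => cubic_prod u (y k) J).
    + intros J; now apply multiplier_weaken with (exp (1 - / (INR J + 1))).
    + intros k; apply is_lim_cubic_prod; [easy | generalize (y_gt k); lra].
  - exists (exp 1 * lin_norm).
    apply multiplier_lim with (f := fun J k => lin k * (cubic_prod u (y k) J - 1)).
    + assert (HD : forall J, multiplier W (fun k => lin k * (cubic_prod u (y k) J - 1))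
        (exp 1 * lin_norm * (1 - / (INR J + 1)))).
      { induction J as [|J IH].
        - simpl; apply multiplier_weaken with (Rabs 0); [easy| |].
          + rewrite Rabs_R0, Rplus_0_l, Rinv_1, Rminus_diag; lra.
          + apply multiplier_ext with (fun _ => 0); [intros; ring | apply multiplier_const].
        - rewrite HS; set (e := / (INR J + 1) - / (INR J + 2)).
          assert (He0 : 0 <= e).
          { assert (/ (INR J + 2) <= / (INR J + 1)) by (apply Rinv_le_contravar; generalize
            (pos_INR J); lra).
            unfold e; lra. }
          apply multiplier_weaken with (exp 1 * lin_norm * (1 - / (INR J + 1)) + exp (1 - / (INR J
            + 1)) * (lin_norm * e)); [easy| |].
          + assert (exp (1 - / (INR J + 1)) * (lin_norm * e) <= exp 1 * (lin_norm * e)).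
            { apply Rmult_le_compat_r; [now apply Rmult_le_pos | apply He]. }
            unfold e in *; lra.
          + apply multiplier_ext with (fun k => lin k * (cubic_prod u (y k) J - 1)
              + cubic_prod u (y k) J * (lin k * (cubic u (y k + INR J) - 1))); [intros; simpl;
                ring|].
            apply multiplier_plus; [easy|].
            apply multiplier_mult; [easy | now apply multiplier_cubic_minus_1]. }
      intros J; apply multiplier_weaken with (3 := HD J); [easy|].
      apply Rle_trans with (exp 1 * lin_norm * 1); [|lra].
      apply Rmult_le_compat_l; [nra | generalize (Hinv J); lra].
    + intros k; apply (is_lim_seq_scal_l _ (lin k) (cubic_lim u (y k) - 1)).
      apply is_lim_seq_minus'; [|apply is_lim_seq_const].
      apply is_lim_cubic_prod; [easy | generalize (y_gt k); lra].
Qed.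

Lemma near_one_gamma m : near_one (fun k => pairs (fun u => tel u (y k) * cubic_lim u (y k)) (INR
  m) m).
Proof.
  apply (near_one_pairs (fun u x => tel u x * cubic_lim u x)); [lra|].
  intros u Hu; apply (near_one_mult (fun k => tel u (y k))); [now apply near_one_tel | now apply
    near_one_cubic].
Qed.

End NearIdentity.

(** * Asymptotics on the negative axis *)

(** The linear span of the sequences [1 / Gamma (a k + b + j)], [j >= 0]. All its members are
    bounded by the weight at [b], since the weight decreases in [b]; the last constructor closes it
    under pointwise equality. *)
Inductive shifts (a b : R) : (nat -> R) -> Prop :=
  | shifts_rgamma j : shifts a b (fun k => rgamma (a * INR k + (b + INR j)))
  | shifts_lin r s c d : shifts a b c -> shifts a b d -> shifts a b (fun k => r * c k + s * d k)
  | shifts_ext c d : (forall k, c k = d k) -> shifts a b c -> shifts a b d.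

(** [a k + g] differs from the argument [a k + b - 1 + j] by a constant, and multiplication by that
    argument lowers it by one in [1 / Gamma]. *)
Lemma shifts_mul a b c g : shifts a b c -> shifts a (b - 1) (fun k => (a * INR k + g) * c k).
Proof.
  intros H; induction H as [j | r s c d _ IHc _ IHd | c d E _ IH].
  - apply shifts_ext with (fun k => 1 * rgamma (a * INR k + (b - 1 + INR j))
      + (g - (b - 1 + INR j)) * rgamma (a * INR k + (b - 1 + INR (S j)))).
    + intros k; rewrite (rgamma_rec (a * INR k + (b - 1 + INR j))), S_INR.
      replace (a * INR k + (b - 1 + INR j) + 1) with (a * INR k + (b + INR j)) by ring.
      replace (a * INR k + (b - 1 + (INR j + 1))) with (a * INR k + (b + INR j)) by ring. ring.
    + apply shifts_lin; apply shifts_rgamma.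
  - apply shifts_ext with (fun k => r * ((a * INR k + g) * c k) + s * ((a * INR k + g) * d k)).
    + intros; ring.
    + now apply shifts_lin.
  - apply shifts_ext with (2 := IH); intros; now rewrite E.
Qed.

Lemma shifts_bounded a b c : 0 < a -> shifts a b c -> exists B, bounded_by (weight a b) c B.
Proof.
  intros Ha H; induction H as [j | r s c d _ [B HB] _ [D HD] | c d E _ [B HB]].
  - destruct (bounded_mittag_leffler a (b + INR j) Ha) as [B HB]; exists B.
    assert (HB0 : 0 <= B) by (eapply bounded_by_nonneg; [|exact HB]; intros; apply weight_ge_1).
    destruct HB as [He HB]; split; [easy|]; intros t Ht; eapply Rle_trans; [now apply HB|].
    apply Rmult_le_compat_l; [easy|]; apply weight_mono; try easy; generalize (pos_INR j); lra.
  - eexists; apply bounded_by_plus; apply bounded_by_scal; eassumption.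
  - exists B; now apply bounded_by_ext with c.
Qed.

(** Equality with [1 / Gamma (a k + b)] up to terms of the next order, whose sums lie below the main
    term by [t^{-1/a}]. *)
Definition leading (a b : R) (c : nat -> R) : Prop :=
  shifts a (b + 1) (fun k => c k - rgamma (a * INR k + b)).

Lemma leading_rgamma a b : leading a b (fun k => rgamma (a * INR k + b)).
Proof.
  apply shifts_ext with (fun k => 0 * rgamma (a * INR k + (b + 1 + INR 0)) + 0 * rgamma (a * INR k
    + (b + 1 + INR 0))).
  - intros; ring.
  - apply shifts_lin; apply shifts_rgamma.
Qed.

Lemma leading_ext a b c d : (forall k, c k = d k) -> leading a b c -> leading a b d.
Proof. intros E; apply shifts_ext; intros; now rewrite E. Qed.

Lemma leading_mul a b c g : leading a b c -> leading a (b - 1) (fun k => (a * INR k + g) * c k).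
Proof.
  intros H; apply (shifts_mul _ _ _ g) in H; unfold leading.
  replace (b - 1 + 1) with (b + 1 - 1) by ring.
  apply shifts_ext with (fun k => 1 * ((a * INR k + g) * (c k - rgamma (a * INR k + b)))
    + (g - b + 1) * rgamma (a * INR k + (b + 1 - 1 + INR 0))).
  - intros k; simpl INR; rewrite (rgamma_rec (a * INR k + (b - 1))).
    replace (a * INR k + (b - 1) + 1) with (a * INR k + b) by ring.
    replace (a * INR k + (b + 1 - 1 + 0)) with (a * INR k + b) by ring. ring.
  - apply shifts_lin; [easy | apply shifts_rgamma].
Qed.

Lemma leading_mul_pow a b c g n : leading a b c ->
  leading a (b - INR n) (fun k => (a * INR k + g) ^ n * c k).
Proof.
  intros H; induction n as [|n IH].
  - simpl INR; rewrite Rminus_0_r; apply leading_ext with (2 := H); intros; simpl; ring.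
  - rewrite S_INR; replace (b - (INR n + 1)) with (b - INR n - 1) by ring.
    apply leading_ext with (2 := leading_mul _ _ _ g IH); intros; simpl; ring.
Qed.

(** This undoes the shift of [beta] by [N]: the prefactor is a product of [m N] factors [a k + g],
    each of which lowers [b] by one and keeps leading coefficient 1. *)
Lemma leading_rising alpha beta m b N :
  leading (alpha * INR m) (b - INR m * INR N)
    (fun k => INR m ^ (m * N) * rising (alpha * INR k + beta) N ^ m * rgamma (alpha * INR m * INR k
      + b)).
Proof.
  induction N as [|N IH].
  - simpl INR; rewrite Rmult_0_r, Rminus_0_r.
    apply leading_ext with (2 := leading_rgamma (alpha * INR m) b).
    intros k; rewrite Nat.mul_0_r; simpl rising; rewrite pow1; simpl; ring.
  - apply (leading_mul_pow _ _ _ (INR m * (beta + INR N)) m) in IH.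
    rewrite S_INR; replace (b - INR m * (INR N + 1)) with (b - INR m * INR N - INR m) by ring.
    apply leading_ext with (2 := IH); intros k; simpl rising.
    replace (m * S N)%nat with (m + m * N)%nat by lia; rewrite pow_add.
    replace (alpha * INR m * INR k + INR m * (beta + INR N))
      with (INR m * (alpha * INR k + beta + INR N)) by ring.
    rewrite !Rpow_mult_distr; ring.
Qed.

Lemma nat_above (r : R) : exists N : nat, r <= INR N.
Proof.
  destruct (nfloor_ex (Rabs r) (Rabs_pos r)) as [n Hn].
  exists (S n); rewrite S_INR; generalize (Rle_abs r); lra.
Qed.

Lemma Fml_log_asym alpha beta m : 0 < alpha -> (1 <= m)%nat ->
  let a := alpha * INR m in let b := INR m * beta - (INR m - 1) / 2 in
  let B := Rpower (INR m) a in
  exists C T, 1 <= T /\ forall t, T <= t ->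
   Rabs (Fml alpha beta m (- t)
      - quot_const m * Rpower (INR m) (INR m * beta) * (2 / a * log_main a b (ln (B * t) / a)))
    <= C * weight a (b + 1) (B * t).
Proof.
  intros Hal Hm a b B; assert (Hm1 : 1 <= INR m) by now apply (le_INR 1).
  assert (Ha : 0 < a) by (apply Rmult_lt_0_compat; lra).
  set (W := weight a (b + 1)); set (Mx := Rmax 0 ((b + 1 - 1) / a)).
  assert (HW : forall t, 0 < t -> 1 <= W t) by (intros; apply weight_ge_1).
  assert (HWd : forall s t, 0 < s <= t -> W s <= Rpower (t / s) Mx * W t) by (intros; now apply
    weight_dilation).
  assert (HMx : 0 <= Mx) by apply Rmax_l.
  (* Moving [beta] up to [Y = beta + N] brings the arguments into the range where the norms of the
     preceding section apply. *)
  destruct (nat_above (alpha * Mx + 3 - beta)) as [N HN].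
  set (Y := beta + INR N).
  assert (HY : alpha * Mx + 3 <= Y) by (unfold Y; lra).
  set (P := fun k => pairs (fun u => tel u (alpha * INR k + Y) * cubic_lim u (alpha * INR k + Y))
    (INR m) m).
  destruct (near_one_gamma W Mx alpha Y (INR m) b HW HWd HMx Hal HY m) as [[C1 HP1] [C2 HP2]].
  change (multiplier W P C1) in HP1.
  change (multiplier W (fun k => (INR m * (alpha * INR k) + b) * (P k - 1)) C2) in HP2.
  set (b0 := b + INR m * INR N).
  set (s := fun k => INR m ^ (m * N) * rising (alpha * INR k + beta) N ^ m * rgamma (a * INR k +
    b0)).
  assert (Hs : leading a b s).
  { replace b with (b0 - INR m * INR N) by (unfold b0; ring). apply leading_rising. }
  destruct (shifts_bounded a (b + 1) _ Ha Hs) as [B1 HB1]; fold W in HB1.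
  destruct (bounded_mittag_leffler a (b + 1) Ha) as [B2 HB2]; fold W in HB2.
  (* With [g = rgamma (a k + b)], [P s - g] is split as [P (s - g) + (P - 1) g], and
     [g = (a k + b) rgamma (a k + b + 1)] moves the linear factor onto [P - 1]. Both summands are
     then controlled by the weight at [b + 1]. *)
  set (r := fun k => P k * (s k - rgamma (a * INR k + b))
     + (INR m * (alpha * INR k) + b) * (P k - 1) * rgamma (a * INR k + (b + 1))).
  assert (Hr : bounded_by W r (C1 * B1 + C2 * B2)).
  { apply bounded_by_plus; [now apply HP1 | now apply HP2]. }
  set (K0 := quot_const m * Rpower (INR m) (INR m * beta)).
  assert (HB : 1 <= B).
  { unfold B, Rpower; rewrite <- exp_0; apply exp_le, Rmult_le_pos; [lra | now apply ln_nonneg]. }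
  (* An exact identity of coefficients: [B ^ k] rescales the argument from [t] to [B t], and [r]
     carries the entire deviation from the case of a single Gamma function. *)
  assert (Hterm : forall k, rgamma (alpha * INR k + beta) ^ m = B ^ k * (K0 * (rgamma (a * INR k +
    b) + r k))).
  { intros k; assert (Hk := pos_INR k).
    set (y := alpha * INR k + Y); assert (Hy : 2 < y) by (unfold y; nra).
    assert (Hq := gamma_quot_eq m y Hm ltac:(lra)).
    change (pairs (fun u => tel u y * cubic_lim u y) (INR m) m) with (P k) in Hq.
    assert (Hw : INR m * y - (INR m - 1) / 2 = a * INR k + b0) by (unfold y, Y, a, b0, b; ring).
    assert (Hg : rgamma (a * INR k + b0) <> 0) by (rewrite <- Hw; apply rgamma_neq_0; nra).
    assert (HR : Rpower (INR m) (INR m * y) = B ^ k * (Rpower (INR m) (INR m * beta) * INR m ^ (m *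
      N))).
    { unfold B; rewrite Rpower_pow_nat, <- Rpower_pow, <- !Rpower_plus by lra; f_equal.
      rewrite mult_INR; unfold y, Y, a; ring. }
    unfold gamma_quot in Hq; rewrite Hw in Hq.
    assert (Hrp : 0 < Rpower (INR m) (INR m * y)) by apply exp_pos.
    assert (E : rgamma y ^ m = quot_const m * P k * (Rpower (INR m) (INR m * y) * rgamma (a * INR k
      + b0))).
    { rewrite <- Hq; field; split; [easy | lra]. }
    rewrite (rgamma_rising (alpha * INR k + beta) N), Rpow_mult_distr.
    replace (alpha * INR k + beta + INR N) with y by (unfold y, Y; ring).
    rewrite E, HR; unfold K0.
    replace (rgamma (a * INR k + b) + r k) with (P k * s k).
    - unfold s; ring.
    - unfold r; rewrite (rgamma_rec (a * INR k + b)).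
      replace (a * INR k + b + 1) with (a * INR k + (b + 1)) by ring.
      replace (INR m * (alpha * INR k)) with (a * INR k) by (unfold a; ring). ring. }
  destruct (mittag_leffler_asym a b Ha) as (C & T & HC0 & HT & HC).
  exists (Rabs K0 * (C + (C1 * B1 + C2 * B2))), T; split; [easy|]; intros t Ht.
  assert (Htb : T <= B * t) by nra.
  assert (EF : Fml alpha beta m (- t) = K0 * (mittag_leffler a b (B * t) + Series (fun k => (- (B *
    t)) ^ k * r k))).
  { unfold Fml, mittag_leffler; rewrite <- Series_plus.
    - rewrite <- Series_scal_l; apply Series_ext; intros k; rewrite Hterm.
      replace (- (B * t)) with (- t * B) by ring; rewrite Rpow_mult_distr; ring.
    - now apply entire_ex_series_neg, entire_rgamma.
    - apply entire_ex_series_neg, Hr. }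
  rewrite EF; fold K0.
  set (ml := mittag_leffler a b (B * t)) in *; set (lm := 2 / a * log_main a b (ln (B * t) / a)).
  replace (K0 * (ml + Series (fun k => (- (B * t)) ^ k * r k)) - K0 * lm)
    with (K0 * ((ml - lm) + Series (fun k => (- (B * t)) ^ k * r k))) by ring.
  rewrite Rabs_mult, Rmult_assoc; apply Rmult_le_compat_l; [apply Rabs_pos|].
  eapply Rle_trans; [apply Rabs_triang|]; rewrite Rmult_plus_distr_r; apply Rplus_le_compat.
  - apply HC, Htb.
  - apply Hr; lra.
Qed.

Lemma Fml_asym alpha beta m : 0 < alpha -> (1 <= m)%nat ->
  exists C T, 1 <= T /\ 0 <= C /\ forall t, T <= t ->
   Rabs (Fml alpha beta m (- t) - chi (alpha * INR m) * Gfun alpha beta m t)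
    <= C * (1 + chi (alpha * INR m) * (Rpower t (p_exp alpha beta m - / (alpha * INR m))
         * exp (INR m * Rpower t (/ (alpha * INR m)) * cos (PI / (alpha * INR m))))).
Proof.
  intros Hal Hm; destruct (Fml_log_asym alpha beta m Hal Hm) as (C & T & HT & HC).
  assert (Hm1 : 1 <= INR m) by now apply (le_INR 1).
  set (a := alpha * INR m) in *; set (b := INR m * beta - (INR m - 1) / 2) in *.
  set (B := Rpower (INR m) a) in *.
  assert (Ha : 0 < a) by (apply Rmult_lt_0_compat; lra).
  assert (Hpi := PI_RGT_0).
  assert (Hlm : 0 <= ln (INR m)) by now apply ln_nonneg.
  assert (HB : 1 <= B) by (unfold B, Rpower; rewrite <- exp_0; apply exp_le, Rmult_le_pos; lra).
  assert (Hp : p_exp alpha beta m = (1 - b) / a) by (unfold p_exp, b, a; field; lra).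
  assert (Hexp : forall t, 0 < t -> Rpower (B * t) (/ a) = INR m * Rpower t (/ a)).
  { intros t Ht; rewrite <- Rpower_mult_distr by lra; f_equal.
    unfold B; rewrite Rpower_mult, Rinv_r, Rpower_1; lra. }
  assert (HC0 : 0 <= C).
  { specialize (HC T (Rle_refl T)); assert (H := weight_ge_1 a (b + 1) (B * T)).
    assert (0 <= C * weight a (b + 1) (B * T)) by (eapply Rle_trans; [apply Rabs_pos | exact HC]).
      nra. }
  set (q := p_exp alpha beta m - / a).
  assert (Hq : q = (1 - (b + 1)) / a) by (unfold q; rewrite Hp; field; lra).
  (* For [t >= 1], [1 + B t] lies between [t] and [(1 + B) t], so [D] converts one power into the
     other for either sign of [q]. *)
  set (D := Rpower (1 + B) (Rabs q)).
  assert (HD : 1 <= D).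
  { unfold D, Rpower; rewrite <- exp_0; apply exp_le, Rmult_le_pos; [apply Rabs_pos | apply
    ln_nonneg; rewrite ?exp_0; lra]. }
  exists (C * D), T; split; [easy | split; [nra|]]; intros t Ht.
  specialize (HC t Ht).
  assert (Ht0 : 0 < t) by lra.
  replace (quot_const m * Rpower (INR m) (INR m * beta) * (2 / a * log_main a b (ln (B * t) / a)))
    with (chi a * Gfun alpha beta m t) in HC.
  - eapply Rle_trans; [exact HC|]; rewrite Rmult_assoc; apply Rmult_le_compat_l; [easy|].
    unfold weight; rewrite <- Hq, Hexp, Rmult_plus_distr_l by easy.
    apply Rplus_le_compat; [lra|].
    set (X := exp (INR m * Rpower t (/ a) * cos (PI / a))).
    replace (D * (chi a * (Rpower t q * X))) with (chi a * (D * Rpower t q * X)) by ring.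
    apply Rmult_le_compat_l; [apply chi_itv|].
    apply Rmult_le_compat_r; [left; apply exp_pos|].
    unfold D, Rpower; rewrite <- exp_plus; apply exp_le.
    assert (H1 : ln t <= ln (1 + B * t)) by (apply ln_le; nra).
    assert (H2 : ln (1 + B * t) <= ln (1 + B) + ln t) by (rewrite <- ln_mult by lra; apply ln_le;
      nra).
    assert (H3 : q * (ln (1 + B * t) - ln t) <= Rabs q * ln (1 + B)); [|lra].
    eapply Rle_trans; [apply Rle_abs|]; rewrite Rabs_mult.
    apply Rmult_le_compat_l; [apply Rabs_pos | apply Rabs_le; lra].
  - unfold Gfun, log_main; fold a.
    replace (exp (ln (B * t) / a)) with (INR m * Rpower t (/ a))
      by (rewrite <- Hexp by easy; unfold Rpower; f_equal; field; lra).
    replace ((1 - b) * (PI / a)) with (PI * p_exp alpha beta m) by (rewrite Hp; field; lra).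
    replace (exp ((1 - b) * (ln (B * t) / a))) with (Rpower (INR m) (1 - b) * Rpower t (p_exp alpha
      beta m)).
    2:{ rewrite Hp; unfold B, Rpower; rewrite ln_mult, ln_exp by (try apply exp_pos; lra).
        rewrite <- exp_plus; f_equal; field; lra. }
    rewrite (Rplus_comm (PI * p_exp alpha beta m)).
    (* The exponents of [m] add up to [- m / 2 + m beta + 1 - b = 1/2]; with the [1/m] inside
       [2 / a] this gives the [1 / sqrt m] of [a0]. *)
    assert (E : quot_const m * Rpower (INR m) (INR m * beta) * (2 / a) * Rpower (INR m) (1 - b) = 2
      * a0 alpha m).
    { unfold quot_const, a0.
      assert (E1 : Rpower (INR m) (- INR m / 2) * Rpower (INR m) (INR m * beta) * Rpower (INR m) (1
        - b) = sqrt (INR m)).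
      { rewrite <- !Rpower_plus, <- Rpower_sqrt by lra; f_equal; unfold b; field. }
      assert (Hsq : sqrt (INR m) * sqrt (INR m) = INR m) by (apply sqrt_sqrt; lra).
      assert (0 < sqrt (INR m)) by (apply sqrt_lt_R0; lra).
      transitivity (Rpower (INR m) (- INR m / 2) * Rpower (INR m) (INR m * beta) * Rpower (INR m)
        (1 - b)
         * (2 / a) * Rpower (2 * PI) ((1 - INR m) / 2)); [ring|].
      rewrite E1; unfold a; rewrite <- Hsq at 2; field; lra. }
    rewrite <- E; ring.
Qed.

(** * The algebraic expansion by shifting beta *)

Lemma entire_rgamma_pow alpha beta m : 0 < alpha -> (1 <= m)%nat ->
  entire (fun k => rgamma (alpha * INR k + beta) ^ m).
Proof.
  intros Hal Hm; destruct (rgamma_bound beta 0 (Rle_refl 0)) as (C & HC & H).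
  apply entire_le with (c := fun k => rgamma (alpha * INR k + beta)) (C := C ^ (m - 1)).
  - now apply entire_rgamma.
  - intros k; assert (Hk := pos_INR k).
    specialize (H (alpha * INR k + beta) ltac:(nra)).
    rewrite Rmult_0_r, Ropp_0, exp_0, Rmult_1_r in H.
    replace m with (S (m - 1)) at 1 by lia.
    simpl; rewrite Rabs_mult, Rmult_comm; apply Rmult_le_compat_r; [apply Rabs_pos|].
    rewrite <- RPow_abs; apply pow_incr; split; [apply Rabs_pos | easy].
Qed.

Lemma Fml_shift alpha beta m t : 0 < alpha -> (1 <= m)%nat -> 0 < t ->
  Fml alpha beta m (- t) = / t * rgamma (beta - alpha) ^ m - / t * Fml alpha (beta - alpha) m (- t).
Proof.
  intros Hal Hm Ht; unfold Fml.
  rewrite (Series_incr_1 (fun k => (- t) ^ k * rgamma (alpha * INR k + (beta - alpha)) ^ m)).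
  - rewrite (Series_ext (fun k => (- t) ^ S k * rgamma (alpha * INR (S k) + (beta - alpha)) ^ m)
      (fun k => - t * ((- t) ^ k * rgamma (alpha * INR k + beta) ^ m))).
    + rewrite Series_scal_l; simpl INR; rewrite Rmult_0_r, Rplus_0_l.
      simpl pow; field; lra.
    + intros k; rewrite S_INR.
      replace (alpha * (INR k + 1) + (beta - alpha)) with (alpha * INR k + beta) by ring. simpl;
        ring.
  - now apply (entire_ex_series_neg (fun k => rgamma (alpha * INR k + (beta - alpha)) ^ m)),
    entire_rgamma_pow.
Qed.

Lemma Hfun_S alpha beta m K t :
  Hfun alpha beta m (S K) t
   = Hfun alpha beta m K t + (-1) ^ (S K + 1) * / t ^ S K * rgamma (beta - alpha * INR (S K)) ^ m.
Proof. unfold Hfun; rewrite sum_n_Sm by lia; reflexivity. Qed.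

Lemma Fml_Hfun alpha beta m t K : 0 < alpha -> (1 <= m)%nat -> 0 < t ->
  Fml alpha beta m (- t)
   = Hfun alpha beta m K t + (-1) ^ K * / t ^ K * Fml alpha (beta - alpha * INR K) m (- t).
Proof.
  intros Hal Hm Ht; induction K as [|K IH].
  - unfold Hfun; rewrite sum_n_m_zero by lia; unfold zero; simpl.
    replace (beta - alpha * 0) with beta by ring; field.
  - rewrite IH, Hfun_S, (Fml_shift alpha (beta - alpha * INR K)), S_INR by easy.
    replace (beta - alpha * INR K - alpha) with (beta - alpha * (INR K + 1)) by ring.
    assert (t ^ K <> 0) by (apply pow_nonzero; lra).
    rewrite pow_add; simpl pow; field; lra.
Qed.

(** [p] grows by [K], which multiplies the power by [t^K] and turns the cosine by [K PI]. Hence the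
    exponential term is unchanged by the passage to [beta - alpha K], once the factor
    [(-1)^K t^{-K}] is restored. *)
Lemma Gfun_shift alpha beta m t K : 0 < alpha -> (1 <= m)%nat -> 0 < t ->
  Gfun alpha (beta - alpha * INR K) m t = (-1) ^ K * t ^ K * Gfun alpha beta m t.
Proof.
  intros Hal Hm Ht; assert (Hm1 : 1 <= INR m) by now apply (le_INR 1).
  unfold Gfun.
  assert (Hp : p_exp alpha (beta - alpha * INR K) m = p_exp alpha beta m + INR K) by (unfold p_exp;
    field; lra).
  rewrite Hp, Rpower_plus, Rpower_pow by easy.
  set (th := INR m * Rpower t (/ (alpha * INR m)) * sin (PI / (alpha * INR m))).
  replace (cos (PI * (p_exp alpha beta m + INR K) + th)) with ((-1) ^ K * cos (PI * p_exp alpha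
    beta m + th)); [ring|].
  clear Hp; induction K as [|K IH].
  - simpl; rewrite Rplus_0_r; ring.
  - rewrite S_INR.
    replace (PI * (p_exp alpha beta m + (INR K + 1)) + th) with (PI * (p_exp alpha beta m + INR K)
      + th + PI) by ring.
    rewrite neg_cos, <- IH; simpl; ring.
Qed.

Lemma Fml_Hfun_asym alpha beta m K : 0 < alpha -> (1 <= m)%nat ->
  exists C T, 1 <= T /\ 0 <= C /\ forall t, T <= t ->
   Rabs (Fml alpha beta m (- t) - chi (alpha * INR m) * Gfun alpha beta m t - Hfun alpha beta m K t)
    <= C * (Rpower t (- INR K - 1) + chi (alpha * INR m) * (Rpower t (p_exp alpha beta m - / (alpha
      * INR m))
         * exp (INR m * Rpower t (/ (alpha * INR m)) * cos (PI / (alpha * INR m))))).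
Proof.
  intros Hal Hm; assert (Hm1 : 1 <= INR m) by now apply (le_INR 1).
  (* The expansion is taken one term further than [K]; this extra term has size [t^{-K-1}] and joins
     the error with constant [g]. *)
  set (n := S K).
  destruct (Fml_asym alpha (beta - alpha * INR n) m Hal Hm) as (C & T & HT & HC0 & HC).
  set (g := Rabs (rgamma (beta - alpha * INR n) ^ m)).
  assert (Hg : 0 <= g) by apply Rabs_pos.
  exists (C + g), T; split; [easy | split; [lra|]]; intros t Ht; specialize (HC t Ht).
  assert (Ht0 : 0 < t) by lra; assert (Htn : 0 < t ^ n) by now apply pow_lt.
  set (X := exp (INR m * Rpower t (/ (alpha * INR m)) * cos (PI / (alpha * INR m)))) in *.
  assert (HX : 0 < X) by apply exp_pos.
  set (c := chi (alpha * INR m)) in *; assert (Hc : 0 <= c <= 1) by apply chi_itv.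
  set (q := p_exp alpha beta m - / (alpha * INR m)).
  assert (HQ : Rpower t (p_exp alpha (beta - alpha * INR n) m - / (alpha * INR m)) = t ^ n * Rpower
    t q).
  { rewrite <- Rpower_pow, <- Rpower_plus by easy; f_equal; unfold q, p_exp; field; lra. }
  rewrite HQ, Gfun_shift in HC by easy.
  assert (Hneg : Rpower t (- INR K - 1) = / t ^ n).
  { replace (- INR K - 1) with (- INR n) by (unfold n; rewrite S_INR; ring).
    rewrite Rpower_Ropp, Rpower_pow; easy. }
  rewrite Hneg, (Fml_Hfun alpha beta m t n) by easy.
  unfold n at 1; rewrite Hfun_S; fold n.
  set (F := Fml alpha (beta - alpha * INR n) m (- t)) in *; set (G := Gfun alpha beta m t) in *.
  set (sg := (-1) ^ n) in *.
  assert (Hsg : sg * sg = 1) by (unfold sg; rewrite <- pow_add, <- (Rmult_1_l 1), <- (pow1 n);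
    replace (n + n)%nat with (2 * n)%nat by lia; rewrite pow_mult; replace ((-1) ^ 2) with 1 by
      ring; rewrite pow1; ring).
  assert (Hsg1 : Rabs sg = 1) by apply pow_1_abs.
  replace (Hfun alpha beta m K t + (-1) ^ (n + 1) * / t ^ n * rgamma (beta - alpha * INR n) ^ m
     + sg * / t ^ n * F - c * G - Hfun alpha beta m K t) with
   (sg * / t ^ n * (F - c * (sg * t ^ n * G)) + (-1) ^ (n + 1) * / t ^ n * rgamma (beta - alpha *
     INR n) ^ m).
  2:{ transitivity (sg * / t ^ n * F - (sg * sg) * c * (/ t ^ n * t ^ n) * G + (-1) ^ (n + 1) * / t
    ^ n * rgamma (beta - alpha * INR n) ^ m); [ring|].
      rewrite Hsg, Rinv_l by lra; ring. }
  assert (Hit : 0 < / t ^ n) by now apply Rinv_0_lt_compat.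
  eapply Rle_trans; [apply Rabs_triang|].
  rewrite !Rabs_mult, pow_1_abs, Hsg1, (Rabs_pos_eq (/ t ^ n)) by lra; fold g.
  assert (H1 : 1 * / t ^ n * Rabs (F - c * (sg * t ^ n * G)) <= / t ^ n * (C * (1 + c * (t ^ n *
    Rpower t q * X)))).
  { rewrite Rmult_1_l; apply Rmult_le_compat_l; lra. }
  replace (/ t ^ n * (C * (1 + c * (t ^ n * Rpower t q * X)))) with
    (C * (/ t ^ n + c * (Rpower t q * X))) in H1 by (field; lra).
  assert (0 <= g * (c * (Rpower t q * X))).
  { apply Rmult_le_pos; [easy|]; apply Rmult_le_pos; [lra|]; apply Rmult_le_pos; [left; apply
    exp_pos | lra]. }
  lra.
Qed.

(* Big-O as t -> +oo is written out: exists C, T such that for all t > T,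
   |remainder| <= C * (bound).  A sum O(g1) + O(g2) is O(|g1| + |g2|). *)
Theorem theorem4p4 (alpha beta : R) (m : nat) :
  0 < alpha -> 0 < beta -> (1 <= m)%nat ->
  (0 < alpha * INR m < 2 ->
     forall K : nat, exists C T : R, forall t : R, T < t ->
       Rabs (Fml alpha beta m (- t) - Hfun alpha beta m K t)
         <= C * Rpower t (- INR K - 1))
  /\
  (alpha * INR m = 2 ->
     forall K : nat, exists C T : R, forall t : R, T < t ->
       Rabs (Fml alpha beta m (- t) - Gfun alpha beta m t - Hfun alpha beta m K t)
         <= C * (Rpower t (p_exp alpha beta m - / 2) + Rpower t (- INR K - 1)))
  /\
  (2 < alpha * INR m ->
     exists C T : R, forall t : R, T < t ->
       Rabs (Fml alpha beta m (- t) - Gfun alpha beta m t)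
         <= C * (Rpower t (p_exp alpha beta m - / (alpha * INR m))
                 * exp (INR m * Rpower t (/ (alpha * INR m))
                        * cos (PI / (alpha * INR m))))).
Proof.
  intros Hal _ Hm; assert (Hm1 : 1 <= INR m) by now apply (le_INR 1).
  split; [|split].
  - intros Ha K; destruct (Fml_Hfun_asym alpha beta m K Hal Hm) as (C & T & HT & HC0 & HC).
    exists C, T; intros t Ht; specialize (HC t (Rlt_le _ _ Ht)).
    unfold chi in HC; destruct Rlt_dec; [|lra].
    rewrite !Rmult_0_l, Rplus_0_r, Rminus_0_r in HC; exact HC.
  - intros Ha K; destruct (Fml_Hfun_asym alpha beta m K Hal Hm) as (C & T & HT & HC0 & HC).
    exists C, T; intros t Ht; specialize (HC t (Rlt_le _ _ Ht)).
    unfold chi in HC; destruct Rlt_dec; [lra|].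
    rewrite Ha, cos_PI2, Rmult_0_r, exp_0, !Rmult_1_l, Rmult_1_r, Rplus_comm in HC; exact HC.
  - intros Ha; destruct (Fml_asym alpha beta m Hal Hm) as (C & T & HT & HC0 & HC).
    assert (Hpi := PI_RGT_0).
    set (a := alpha * INR m) in *; set (q := p_exp alpha beta m - / a) in *.
    assert (Hcos : 0 < cos (PI / a)).
    { assert (0 < PI / a) by (apply Rdiv_lt_0_compat; lra).
      apply cos_gt_0; [lra|]. apply Rmult_lt_compat_l; [lra|]; apply Rinv_lt_contravar; lra. }
    set (kap := INR m * cos (PI / a)); assert (Hkap : 0 < kap) by (apply Rmult_lt_0_compat; lra).
    (* The bounded part of the error is absorbed by the growing one: with [x = ln t / a], [t^{-q}]
       loses against [exp (kap t^{1/a})]. The [+ 1] compensates the factor [exp x] in the dominating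
       expression. *)
    destruct (exp_exp_dominates (- q * a + 1) kap Hkap) as (K & HK & HKx).
    exists (C * (1 + K)), T; intros t Ht; specialize (HC t (Rlt_le _ _ Ht)).
    unfold chi in HC; destruct Rlt_dec; [lra|]; rewrite !Rmult_1_l in HC.
    eapply Rle_trans; [exact HC|]; rewrite (Rmult_assoc C (1 + K)); apply Rmult_le_compat_l;
      [easy|].
    rewrite Rmult_plus_distr_r, Rmult_1_l, Rplus_comm; apply Rplus_le_compat_l.
    assert (Hx : 0 <= ln t / a) by (apply Rdiv_le_0_compat; [apply ln_nonneg|]; lra).
    specialize (HKx _ Hx).
    replace (exp (ln t / a)) with (Rpower t (/ a)) in HKx by (unfold Rpower; f_equal; field; lra).
    set (u := Rpower t (/ a)) in *; assert (Hu : 0 < u) by apply exp_pos.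
    replace ((- q * a + 1) * (ln t / a) - kap * u) with (ln t / a - (q * ln t + INR m * u * cos (PI
      / a))) in HKx
      by (unfold kap; field; lra).
    unfold Rminus at 1 in HKx; rewrite exp_plus, exp_Ropp, exp_plus in HKx.
    change (exp (q * ln t)) with (Rpower t q) in HKx.
    replace (exp (ln t / a)) with u in HKx by (unfold u, Rpower; f_equal; field; lra).
    set (Z := Rpower t q * exp (INR m * u * cos (PI / a))) in *.
    assert (HZ : 0 < Z) by (apply Rmult_lt_0_compat; apply exp_pos).
    assert (Hle : exp (- (kap / 2) * u) <= 1) by (rewrite <- exp_0; apply exp_le; nra).
    assert (H1 : / Z <= K).
    { apply (Rmult_le_reg_l u); [easy|]; eapply Rle_trans; [exact HKx|].
      assert (K * (u * exp (- (kap / 2) * u)) <= K * (u * 1)) by (apply Rmult_le_compat_l; [lra|];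
        apply Rmult_le_compat_l; lra).
      lra. }
    apply (Rmult_le_compat_r Z) in H1; [|lra]. rewrite Rinv_l in H1; lra.
Qed.
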